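(* Let $1<p<\infty$, let $[X,d,m]$ be a metric random walk space with invariant and reversible measure $\nu$, and let $\Omega\subset X$ and $\mathbf{a}_p$ satisfy all the assumptions listed in the context (including the Poincaré type inequality on $\Omega_m$). Let $\varphi\in L^{p'}(\partial_m\Omega,\nu)$. The operator $B^m_{\mathbf{a}_p,\varphi}$ is completely accretive and satisfies the range condition $$L^{p'}(\Omega,\nu)\subset R(I+B^m_{\mathbf{a}_p,\varphi}).$$ Consequently, $B^m_{\mathbf{a}_p,\varphi}$ is $m$-completely accretive in $L^{p'}(\Omega,\nu)$.
   Context: Setting. $(X,d)$ is a Polish metric space with its Borel $\sigma$-algebra. A random walk $m=(m_x)_{x\in X}$ is a family of Borel probability measures on $X$ such that $x\mapsto m_x(A)$ is Borel measurable for every Borel $A$, and each $m_x$ has finite first moment ($\int_X d(z,y)\,dm_x(y)<\infty$ for some, hence any, $z\in X$); $[X,d,m]$ is then a metric random walk space. $\nu$ is a Radon measure on $X$ that is invariant, $d\nu(x)=\int_{y\in X}d\nu(y)\,dm_y(x)$, and reversible, $dm_x(y)d\nu(x)=dm_y(x)d\nu(y)$ as measures on $X\times X$. Assume $m_x\ll\nu$ for all $x\in X$, and that $[X,d,m]$ with $\nu$ is $m$-connected: for every Borel $D$ with $\nu(D)>0$, for $\nu$-a.e. $x$ there is $n\ge1$ with $m_x^{*n}(D)>0$, where $m_x^{*n}$ is the law after $n$ steps started at $x$. The measure $\nu\otimes m_x$ on $X\times X$ is $(\nu\otimes m_x)(U)=\int_X\int_X \chi_U(x,y)\,dm_x(y)\,d\nu(x)$.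 $\Omega\subset X$ is $\nu$-measurable, $\partial_m\Omega:=\{x\in X\setminus\Omega: m_x(\Omega)>0\}$, $\Omega_m:=\Omega\cup\partial_m\Omega$, and $\nu(\Omega_m)<\infty$. Put $Q_1=\Omega_m\times\Omega_m$. Poincaré type inequality (assumed): there is $\lambda>0$ such that for all $u\in L^p(\Omega_m,\nu)$, $\|u\|_{L^p(\Omega_m,\nu)}\le\lambda\Big(\big(\int_{Q_1}|u(y)-u(x)|^p\,d(\nu\otimes m_x)(x,y)\big)^{1/p}+\big|\int_\Omega u\,d\nu\big|\Big)$. Assumptions on $\mathbf{a}_p:X\times X\times\mathbb{R}\to\mathbb{R}$: $(x,y)\mapsto\mathbf{a}_p(x,y,r)$ is $\nu\otimes m_x$-measurable for all $r$; and for $\nu\otimes m_x$-a.e. $(x,y)$: $\mathbf{a}_p(x,y,\cdot)$ is continuous; $\mathbf{a}_p(x,y,r)=-\mathbf{a}_p(y,x,-r)$ for all $r$; $(\mathbf{a}_p(x,y,r)-\mathbf{a}_p(x,y,s))(r-s)>0$ for all $r\ne s$; and there are constants $c,C>0$ with $|\mathbf{a}_p(x,y,r)|\le C(1+|r|^{p-1})$ and $\mathbf{a}_p(x,y,r)r\ge c|r|^p$ for all $r$. The operator $B^m_{\mathbf{a}_p,\varphi}\subset L^1(\Omega,\nu)\times L^1(\Omega,\nu)$: $(u,v)\in B^m_{\mathbf{a}_p,\varphi}$ iff $u,v\in L^1(\Omega,\nu)$ and there is an extension of $u$ to $\Omega_m$ (still denoted $u$) with $u\in L^p(\Omega_m,\nu)$,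 $(x,y)\mapsto\mathbf{a}_p(x,y,u(y)-u(x))\in L^{p'}(Q_1,\nu\otimes m_x)$, $v(x)=-\int_{\Omega_m}\mathbf{a}_p(x,y,u(y)-u(x))\,dm_x(y)$ for $x\in\Omega$, and $\varphi(x)=-\int_{\Omega_m}\mathbf{a}_p(x,y,u(y)-u(x))\,dm_x(y)$ for $x\in\partial_m\Omega$. $p'=p/(p-1)$; $R(\cdot)$ denotes range. Complete accretivity. Let $J_0$ be the set of convex lower semicontinuous $j:\mathbb{R}\to[0,+\infty]$ with $j(0)=0$. For $u,v\in L^1(\Omega,\nu)$ write $u\ll v$ if $\int_\Omega j(u)\,d\nu\le\int_\Omega j(v)\,d\nu$ for all $j\in J_0$. An operator $\mathcal{A}\subset L^1(\Omega,\nu)\times L^1(\Omega,\nu)$ is completely accretive if $u_1-u_2\ll u_1-u_2+\lambda(v_1-v_2)$ for all $(u_i,v_i)\in\mathcal{A}$, $i=1,2$, and all $\lambda>0$. For a linear subspace $E\subset L^1(\Omega,\nu)$, $\mathcal{A}$, regarded as an operator in $E$ (i.e. $\mathcal{A}\cap(E\times E)$), is $m$-completely accretive in $E$ if it is completely accretive and $R(I+\lambda\mathcal{A})=E$ for all $\lambda>0$ (equivalently, for some $\lambda>0$). *)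

(* Defs.v *)
From HB Require Import structures.
From mathcomp Require Import all_boot all_order all_algebra.
From mathcomp Require Import all_classical all_reals all_analysis.
From mathcomp Require Import measurable_realfun.

Set Implicit Arguments.
Unset Strict Implicit.
Unset Printing Implicit Defensive.

Import Order.TTheory GRing.Theory Num.Theory.
Import numFieldNormedType.Exports.

Local Open Scope classical_set_scope.
Local Open Scope ring_scope.
Local Open Scope ereal_scope.

(* [Complete] makes the type pointed, which [measurableType] requires. *)
#[short(type="completeMetricType")]
HB.structure Definition CompleteMetric (R : numDomainType) :=
  {X of Metric R X & Complete X}.

Definition separable_space (X : topologicalType) :=
  exists2 D : set X, countable D & dense D.

Notation borel X := (g_sigma_algebraType (@open X)).

Definition completed_measurable_fun d d' (T : measurableType d)
    (U : measurableType d') (R : realType) (mu : set T -> \bar R)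
    (D : set T) (f : T -> U) :=
  forall B, measurable B -> completed_algebra_gen mu (D `&` f @^-1` B).

(* The library integral is defined for all functions, and by the following
   lemma it only depends on the a.e. class, measurable or not.  A function that
   is measurable for the completion of mu is a.e. equal to a measurable one,
   so its library integral w.r.t. mu is its integral w.r.t. the completion. *)
Section integral_ae.
Context d (T : measurableType d) (R : realType).
Variable mu : {measure set T -> \bar R}.
Import HBNNSimple.

Let ge0_le_integral_ae (f g : T -> \bar R) :
  (forall x, 0 <= f x) -> (forall x, 0 <= g x) ->
  f = g %[ae mu] -> \int[mu]_x f x <= \int[mu]_x g x.
Proof.
move=> f0 g0 [N [mN N0 fgN]].
rewrite (ge0_integralTE mu f0); apply: ge_ereal_sup => _ [h /= hf <-].
rewrite -integralT_nnsfun (ge0_negligible_integral _ _ _ _ N0)//; last 2 first.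
- exact/measurable_EFinP.
- by move=> x _; rewrite lee_fin.
rewrite setTD integral_mkcond.
pose h' : {nnsfun T >-> R} := proj_nnsfun h (measurableC mN).
rewrite (_ : _ \_ _ = EFin \o h'); last first.
  apply/funext => x; rewrite patchE /= mindicE.
  by case: (x \in _); rewrite ?mulr1 ?mulr0.
rewrite [leLHS](_ : _ = sintegral mu h'); last exact: integralT_nnsfun.
rewrite (ge0_integralTE mu g0); apply: ereal_sup_ubound; exists h' => //= x.
rewrite mindicE; case: (boolP (x \in _)) => [/set_mem xN|_]; last first.
  by rewrite mulr0.
rewrite mulr1; suff <- : f x = g x by exact: hf.
by apply: contrapT => fg; apply/xN/fgN => /= /(_ I).
Qed.

Lemma integral_ae_eq (D : set T) (f g : T -> \bar R) :
  f = g %[ae mu in D] -> \int[mu]_(x in D) f x = \int[mu]_(x in D) g x.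
Proof.
move=> fg; rewrite [LHS]integral_mkcond [RHS]integral_mkcond.
have {fg} : f \_ D = g \_ D %[ae mu].
  apply: filterS fg => x fg _; rewrite !patchE.
  by case: ifPn => // /set_mem /fg.
move: (f \_ D) (g \_ D) => {}f {}g fg.
have gf : g = f %[ae mu] by apply: filterS fg => x + _ => /(_ I) ->.
rewrite [LHS]integralE [RHS]integralE.
by congr (_ - _); apply/eqP; rewrite eq_le; apply/andP; split;
  apply: ge0_le_integral_ae => //;
  [move: fg|move: gf|move: fg|move: gf]; apply: filterS => x + _;
  move=> /(_ I) fgx; rewrite ?(funeposE, funenegE) fgx.
Qed.

End integral_ae.

(* [kernel_prod mu k] is written $\mu\otimes k_x$ *)
Section kernel_prod.
Context d d' (T : measurableType d) (U : measurableType d') (R : realType).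
Variables (mu : {measure set T -> \bar R}) (k : R.-pker T ~> U).

Definition kernel_prod (A : set (T * U)) : \bar R :=
  \int[mu]_x \int[k x]_y (\1_A (x, y))%:E.

Let kernel_prod0 : kernel_prod set0 = 0.
Proof.
by apply: integral0_eq => x _; apply: integral0_eq => y _; rewrite indic0.
Qed.

Let kernel_prod_ge0 A : 0 <= kernel_prod A.
Proof.
by apply: integral_ge0 => x _; apply: integral_ge0 => y _; rewrite lee_fin.
Qed.

Let msec (A : set (T * U)) x : measurable A ->
  measurable_fun [set: U] (fun y => (\1_A (x, y))%:E : \bar R).
Proof.
move=> mA; apply/measurable_EFinP.
exact: measurable_fun_pair2 (measurable_indic mA).
Qed.

Let mint (A : set (T * U)) : measurable A ->
  measurable_fun [set: T] (fun x => \int[k x]_y (\1_A (x, y))%:E).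
Proof.
move=> mA.
apply: (measurable_fun_integral_finite_kernel (fun z => (\1_A z)%:E) k).
  by move=> z; rewrite lee_fin.
exact/measurable_EFinP/measurable_indic.
Qed.

Let kernel_prod_additive : semi_sigma_additive kernel_prod.
Proof.
move=> A mA tA mUA.
rewrite (_ : kernel_prod (\bigcup_n A n) = \sum_(n <oo) kernel_prod (A n)).
  by apply: is_cvg_nneseries.
rewrite -integral_nneseries//=; last 2 first.
- by move=> n; exact: mint.
- by move=> n x _; apply: integral_ge0 => y _; rewrite lee_fin.
apply: eq_integral => x _; rewrite -integral_nneseries//=; last first.
  by move=> n; exact: msec.
by apply: eq_integral => y _; rewrite indic_bigcup.
Qed.

HB.instance Definition _ := isMeasure.Build _ _ R kernel_prod
  kernel_prod0 kernel_prod_ge0 kernel_prod_additive.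

End kernel_prod.

Section random_walk.
Context (R : realType) (X : completeMetricType R).
Variables (m : R.-pker borel X ~> borel X).

Definition finite_first_moments :=
  forall x : X, exists z : X, \int[m x]_y (mdist z y)%:E < +oo.

(* [walk n x] is the law after n steps started at x *)
Fixpoint walk (n : nat) : R.-spker borel X ~> borel X :=
  if n is n'.+1 then mkcomp_noparam (walk n') m
  else kdirac (@measurable_id _ (borel X) setT).

Variable (nu : {measure set (borel X) -> \bar R}).

Definition radon :=
  (forall x : X, exists U : set X, open_nbhs x U /\ nu U < +oo) /\
  (forall A : set (borel X), measurable A ->
    nu A = ereal_sup [set nu K | K in [set K : set X | compact K /\ K `<=` A]]).

Definition invariant_measure :=
  forall A : set (borel X), measurable A -> nu A = \int[nu]_x m x A.

Definition reversible_measure :=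
  forall A : set (borel X * borel X), measurable A ->
    kernel_prod nu m A = kernel_prod nu m [set z | A (z.2, z.1)].

Definition m_connected :=
  forall D : set (borel X), measurable D -> 0 < nu D ->
    \forall x \ae nu, exists2 n, (0 < n)%N & 0 < walk n x D.

End random_walk.

(* L^p(D, mu), for D and f measurable for the completion of mu; only the values
   of f on D matter *)
Definition Lp_on d (T : measurableType d) (R : realType)
    (mu : {measure set T -> \bar R}) (D : set T) (p : R) : set (T -> R) :=
  [set f | completed_measurable_fun mu D f /\ finite_norm mu p%:E (f \_ D)].

Definition conj_exp (R : realType) (p : R) : R := (p / (p - 1))%R.

Section domain.
Context (R : realType) (X : completeMetricType R).
Variables (m : R.-pker borel X ~> borel X) (Om : set (borel X)).

(* Om is only assumed measurable for the completion of nu, hence (as m x is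
   dominated by nu) for that of m x, on which the outer measure [(m x)^*] is
   the completed measure. *)
Definition m_boundary : set (borel X) :=
  [set x | ~ Om x /\ 0 < (m x)^*%mu Om].

Definition m_closure : set (borel X) := Om `|` m_boundary.

Variable (nu : {measure set (borel X) -> \bar R}).

Definition poincare (p : R) :=
  exists2 lam : R, (0 < lam)%R &
  forall u : borel X -> R, Lp_on nu m_closure p u ->
    'N[nu]_p%:E[EFin \o (u \_ m_closure)] <=
    lam%:E * ('N[kernel_prod nu m]_p%:E[EFin \o
                 ((fun z => u z.2 - u z.1)%R \_ (m_closure `*` m_closure))]
              + `| \int[nu]_(x in Om) (u x)%:E |).

Definition leray_lions (p : R) (a : X -> X -> R -> R) :=
  [/\ forall r : R, completed_measurable_fun (kernel_prod nu m) setT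
        (fun z : borel X * borel X => a z.1 z.2 r),
      \forall z \ae kernel_prod nu m, continuous (a z.1 z.2),
      \forall z \ae kernel_prod nu m, forall r,
        a z.1 z.2 r = (- a z.2 z.1 (- r))%R,
      \forall z \ae kernel_prod nu m, forall r s, r != s ->
        (0 < (a z.1 z.2 r - a z.1 z.2 s) * (r - s))%R &
      exists c C : R, [/\ (0 < c)%R, (0 < C)%R,
        \forall z \ae kernel_prod nu m, forall r,
          (`|a z.1 z.2 r| <= C * (1 + `|r| `^ (p - 1)))%R &
        \forall z \ae kernel_prod nu m, forall r,
          (c * `|r| `^ p <= a z.1 z.2 r * r)%R]].

(* Operators in L^1(Om, nu) are sets of pairs of representatives. *)
Definition B_op (p : R) (a : X -> X -> R -> R) (phi : borel X -> R) :
    set ((borel X -> R) * (borel X -> R)) :=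
  [set uv | [/\ Lp_on nu Om 1 uv.1, Lp_on nu Om 1 uv.2 &
    exists u : borel X -> R,
      [/\ u = uv.1 %[ae nu in Om],
          Lp_on nu m_closure p u,
          Lp_on (kernel_prod nu m) (m_closure `*` m_closure) (conj_exp p)
            (fun z => a z.1 z.2 (u z.2 - u z.1)%R),
          \forall x \ae nu, Om x ->
            (uv.2 x)%:E = - \int[m x]_(y in m_closure) (a x y (u y - u x))%:E &
          \forall x \ae nu, m_boundary x ->
            (phi x)%:E = - \int[m x]_(y in m_closure) (a x y (u y - u x))%:E]]].

End domain.

Section accretivity.
Context d (T : measurableType d) (R : realType).
Variables (nu : {measure set T -> \bar R}) (Om : set T).
Implicit Types (A : set ((T -> R) * (T -> R))) (E : set (T -> R)).

Definition J0 : set (R -> \bar R) :=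
  [set j | [/\ forall r, 0 <= j r,
    forall (t x y : R), (0 <= t <= 1)%R ->
      j (t * x + (1 - t) * y)%R <= t%:E * j x + (1 - t)%:E * j y,
    lower_semicontinuous j &
    j 0%R = 0]].

Definition j_le (u v : T -> R) := forall j, J0 j ->
  \int[nu]_(x in Om) j (u x) <= \int[nu]_(x in Om) j (v x).

Definition completely_accretive A :=
  forall uv1 uv2, A uv1 -> A uv2 -> forall lam : R, (0 < lam)%R ->
    j_le (fun x => uv1.1 x - uv2.1 x)%R
         (fun x => uv1.1 x - uv2.1 x + lam * (uv1.2 x - uv2.2 x))%R.

(* R(I + lam A) *)
Definition resolvent_range (lam : R) A : set (T -> R) :=
  [set f | exists2 uv, A uv & f = (fun x => uv.1 x + lam * uv.2 x)%R %[ae nu in Om]].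

Definition m_completely_accretive E A :=
  completely_accretive (A `&` (E `*` E)) /\
  forall lam : R, (0 < lam)%R ->
    resolvent_range lam (A `&` (E `*` E)) = E.

End accretivity.

(* Main.v *)
(* Write K for a Borel version of Omega_m. On a symmetric Borel set G, a.e. equal
   to K x K, the coefficient a_p satisfies all its assumptions pointwise; let A
   be a_p on G and 0 elsewhere, and Phi z the primitive of A z. By reversibility
   and antisymmetry, the equation u + lam v = f with v in B u is the
   Euler-Lagrange equation of the convex energy
     1/2 int Phi(grad u) d(nu (x) m_x) + 1/(2 lam) int_Omega u^2 - int g u,
   where g = f / lam on Omega and g = phi on the boundary.

   The Poincare inequality makes the energy coercive. No weak compactness is
   used: among the nearly minimising functions one chooses a sequence that also
   nearly minimises int_K sqrt(1 + w^2). The strict convexity of this integrand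
   turns consecutive near-minimality into summable differences of
   w / sqrt(1 + w^2), so the sequence converges a.e., and Fatou's lemma shows
   that its limit is a minimiser.

   For complete accretivity, j in J_0 is the increasing limit of Lipschitz convex
   functions with bounded nondecreasing subgradients q, and
   int q(u_1 - u_2) (v_1 - v_2) >= 0 by monotonicity of A and of q. *)

Require Import Defs.
From HB Require Import structures.
From mathcomp Require Import all_boot all_order all_algebra.
From mathcomp Require Import all_classical all_reals all_analysis.
From mathcomp Require Import measurable_realfun.
From mathcomp Require Import ring lra.

Set Implicit Arguments.
Unset Strict Implicit.
Unset Printing Implicit Defensive.

Import Order.TTheory GRing.Theory Num.Theory.
Import numFieldNormedType.Exports.

Local Open Scope classical_set_scope.
Local Open Scope ring_scope.
Local Open Scope ereal_scope.

(** * Versions modulo null sets *)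

(** The energy offers no quantitative strict convexity: [a_p] is strictly monotone without any
    modulus. The functional built on [sqrt (1 + w^2)] supplies it: its linear growth lets the L^p
    bound control it for every [p > 1], and its midpoint defect dominates an explicit square.

    The boundary carries no zero-order term, so control there comes from the Poincare inequality
    alone, whose mean over Omega is absorbed by the quadratic term. For [p < 2] that term confines
    the trial functions to those square integrable on Omega. The L^p' integrability of [u] and [v]
    on Omega is then read off the equation: [v] is an average of the flux, which is in L^p', and
    [u = f - lam v].

    Omega, [a_p] and the functions are measurable for completions only. Passing to [K], [G] and [A]
    confines the exceptional null sets to two places: where a member of the operator is unfolded and
    where one is produced. In between, antisymmetry, continuity and growth hold at every point. [G]
    has to be symmetric, since antisymmetry compares [A] at [(x, y)] and at [(y, x)]. *)

Section completion.
Context d (T : measurableType d) (R : realType) (mu : {measure set T -> \bar R}).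

Lemma ae_measurable_cover (P : T -> Prop) : (\forall x \ae mu, P x) ->
  exists C, [/\ measurable C, mu C = 0 & forall x, ~ C x -> P x].
Proof.
move=> [C [mC C0 PC]]; exists C; split => // x nCx.
by apply: contrapT => nPx; exact/nCx/PC.
Qed.

Lemma completed_algebra_genP (A : set T) : completed_algebra_gen mu A <->
  exists2 B, measurable B & \forall x \ae mu, A x <-> B x.
Proof.
split=> [[B mB [N [C [mC C0 NC]]] <-]|[B mB /ae_measurable_cover[C [mC C0 AB]]]].
  exists B => //; exists C; split => // x /= nAB; apply: NC.
  apply: contrapT => nNx; apply: nAB; split; last by left.
  by case.
exists (B `\` C); first exact: measurableD.
exists (A `&` C).
  by apply: (@negligibleS _ _ _ _ C); [exact: subIsetr|exact/negligibleP].
apply/seteqP; split => x.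
  by move=> [[Bx nCx]|[]//]; exact/(AB _ nCx).
move=> Ax; have [Cx|nCx] := pselect (C x); first by right.
by left; split => //; exact/(AB _ nCx).
Qed.

Lemma completed_algebra_gen_ae (A B : set T) :
  (\forall x \ae mu, A x <-> B x) ->
  completed_algebra_gen mu A -> completed_algebra_gen mu B.
Proof.
move=> AB /completed_algebra_genP[C mC AC]; apply/completed_algebra_genP.
by exists C => //; apply: filterS2 AB AC => x ? ?; tauto.
Qed.

Lemma completed_algebra_genI (A B : set T) : completed_algebra_gen mu A ->
  completed_algebra_gen mu B -> completed_algebra_gen mu (A `&` B).
Proof.
move=> /completed_algebra_genP[A' mA AA] /completed_algebra_genP[B' mB BB].
apply/completed_algebra_genP; exists (A' `&` B'); first exact: measurableI.
by apply: filterS2 AA BB => x ? ?; split => -[? ?]; split; tauto.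
Qed.

Lemma ae_forall_countable (I : countType) (P : I -> T -> Prop) :
  (forall i, \forall x \ae mu, P i x) -> \forall x \ae mu, forall i, P i x.
Proof.
move=> aP; suff : \forall x \ae mu, forall n : nat,
    if unpickle n is Some i then P i x else True.
  by apply: filterS => x Px i; have := Px (pickle i); rewrite pickleK.
by apply: ae_foralln => n; case: unpickle => [i|]; [exact: aP|exact: aeW].
Qed.

(** Superlevel sets at rational levels determine a function, so only countably many exceptional sets
    occur. One measurable null set [C] covers them all, and the version is [F] off [C] and 0 on
    [C]. *)
Lemma ae_measurable_version (F : T -> R) (B : rat -> set T) :
  (forall q, measurable (B q)) ->
  (forall q, \forall x \ae mu, (ratr q < F x)%R <-> B q x) ->
  exists2 g : T -> R, measurable_fun setT g & \forall x \ae mu, F x = g x.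
Proof.
move=> mB /ae_forall_countable/ae_measurable_cover[C [mC C0 FB]].
exists (fun x => if x \in C then 0%R else F x); last first.
  exists C; split => // x /= Fx; apply: contrapT => nCx; apply: Fx.
  by rewrite memNset.
move=> mT; apply: (measurability _ (RGenOInfty.measurableE R)) => //.
move=> /= _ [_ [r ->] <-]; rewrite setTI.
(* The version is 0 on [C], so [C] lies in its superlevel sets of negative level and in no other. *)
pose E (q : rat) := if (ratr q < 0 :> R)%R then C `|` B q else B q `\` C.
rewrite (_ : _ @^-1` _ = \bigcup_(q in [set q : rat | (r < ratr q)%R]) E q).
  rewrite bigcup_mkcond; apply: bigcupT_measurable_rat => q; rewrite /E.
  by case: ifPn => // _; case: ifPn => _; [exact: measurableU|exact: measurableD].
apply/seteqP; split => x /=; rewrite in_itv/= andbT.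
  case: ifPn => xC.
    move=> /rat_in_itvoo[q]; rewrite in_itv/= => /andP[rq q0].
    by exists q => //; rewrite /E q0; left; exact/set_mem.
  move=> /rat_in_itvoo[q]; rewrite in_itv/= => /andP[rq qF].
  have nCx : ~ C x by move=> /mem_set; rewrite (negbTE xC).
  exists q => //; rewrite /E; case: ifPn => _.
    by right; exact/(FB _ nCx).
  by split => //; exact/(FB _ nCx).
move=> [q /= rq]; rewrite /E; case: ifPn => q0.
  case: ifPn => xC; first by move=> _; rewrite (lt_trans rq).
  have nCx : ~ C x by move=> /mem_set; rewrite (negbTE xC).
  by move=> [//|/(FB _ nCx)]; exact: lt_trans.
move=> [Bx nCx]; rewrite memNset//.
by have /(FB _ nCx) := Bx; exact: lt_trans.
Qed.

Lemma completed_measurable_funP (D : set T) (f : T -> R) :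
  completed_algebra_gen mu D ->
  completed_measurable_fun mu D f <->
  exists2 g : T -> R, measurable_fun setT g & \forall x \ae mu, (f \_ D) x = g x.
Proof.
move=> cD; split=> [mf|[g mg fg] B mB]; last first.
  have : completed_algebra_gen mu (D `&` g @^-1` B).
    apply: completed_algebra_genI => //; apply/completed_algebra_genP.
    by exists (g @^-1` B); [rewrite -[X in measurable X]setTI; exact: mg|exact: aeW].
  apply: completed_algebra_gen_ae; apply: filterS fg => x; rewrite patchE.
  case: ifPn => [_ fgx|xD _]; first by rewrite /setI /preimage /= fgx.
  by split => -[/mem_set]; rewrite (negbTE xD).
have [D0 mD0 DD0] := (completed_algebra_genP D).1 cD.
have /choice[A /all_and2[mA fA]] (q : rat) : exists A, measurable A /\
    \forall x \ae mu, (D `&` f @^-1` `]ratr q, +oo[%classic) x <-> A x.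
  have /completed_algebra_genP[A mA fA] := mf _ (measurable_itv `]ratr q, +oo[).
  by exists A.
(* The patched function is 0 off [D], hence the complement of [D] enters exactly at negative
   levels. *)
apply: (@ae_measurable_version _
  (fun q => if (ratr q < 0 :> R)%R then ~` D0 `|` A q else A q)).
  by move=> q; case: ifPn => // _; apply: measurableU => //; exact: measurableC.
move=> q; apply: filterS2 DD0 (fA q) => x Dx; rewrite /setI /preimage/= in_itv/= andbT.
rewrite patchE /= => fx; case: ifPn => [/set_mem xD|/negP xD].
  case: ifPn => q0; last by rewrite -fx; tauto.
  by rewrite /setU /setC/= -fx; tauto.
have nD : ~ D x by move=> /mem_set.
case: ifPn => q0; last by rewrite -fx; split => // -[].
split => // _; left => /=; rewrite /setC/=; tauto.
Qed.

Lemma Lp_onP (D : set T) (p : R) (f : T -> R) : (0 < p)%R ->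
  completed_algebra_gen mu D -> Lp_on mu D p f <->
  exists g : T -> R, [/\ measurable_fun setT g,
    \forall x \ae mu, (f \_ D) x = g x &
    \int[mu]_x (`|g x| `^ p)%:E < +oo].
Proof.
move=> p0 cD.
have finE : finite_norm mu p%:E (f \_ D) <->
    \int[mu]_x (`|(f \_ D) x| `^ p)%:E < +oo.
  have pos : 0 <= \int[mu]_x (`|(f \_ D) x| `^ p)%:E.
    by apply: integral_ge0 => x _; rewrite lee_fin powR_ge0.
  rewrite /finite_norm unlock/=; split => [|fin]; last first.
    by rewrite poweR_lty.
  by move=> /(@poweR_lty _ _ p); rewrite -poweRrM mulVf ?gt_eqF// poweRe1.
have eqE g : (\forall x \ae mu, (f \_ D) x = g x) ->
    \int[mu]_x (`|(f \_ D) x| `^ p)%:E = \int[mu]_x (`|g x| `^ p)%:E.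
  by move=> fg; apply: Defs.integral_ae_eq; apply: filterS fg => x -> _.
split=> [[/(completed_measurable_funP _ cD)[g mg fg] /finE fin]|[g [mg fg fin]]].
  by exists g; split => //; rewrite -(eqE _ fg).
split; first by apply/completed_measurable_funP => //; exists g.
by apply/finE; rewrite (eqE _ fg).
Qed.

End completion.

(** * Integration against [kernel_prod] *)

Section kernel_prod_tonelli.
Context d d' (T : measurableType d) (U : measurableType d') (R : realType).
Variables (nu : {measure set T -> \bar R}) (k : R.-pker T ~> U).
Local Notation mu := (kernel_prod nu k).
Import HBNNSimple.

Lemma measurable_fun_integral_kernel_prod (f : T * U -> \bar R) :
  (forall z, 0 <= f z) -> measurable_fun setT f ->
  measurable_fun setT (fun x => \int[k x]_y f (x, y)).
Proof. exact: (measurable_fun_integral_finite_kernel f k). Qed.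

Let integral_kernel_prod_nnsfun (f : {nnsfun (T * U)%type >-> R}) :
  \int[mu]_z (f z)%:E = \int[nu]_x \int[k x]_y (f (x, y))%:E.
Proof.
under [in LHS]eq_integral do rewrite fimfunE -fsumEFin//.
rewrite ge0_integral_fsum//; last 2 first.
- by move=> r; exact/measurable_EFinP/measurableT_comp.
- by move=> r z _; rewrite EFinM nnfun_muleindic_ge0.
have mf r : measurable (f @^-1` [set r]).
  by rewrite -[X in measurable X]setTI; exact: measurable_funP.
have mfr r x : measurable_fun [set: U]
    (fun y => (r * \1_(f @^-1` [set r]) (x, y))%:E).
  apply/measurable_EFinP; apply: (@measurable_fun_pair2 _ _ _ _ _ _
    (fun z : T * U => r * \1_(f @^-1` [set r]) z)%R).
  by apply: measurable_funM => //; exact: measurable_indic.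
under [in RHS]eq_integral.
  move=> x _; under eq_integral.
    by move=> y _; rewrite fimfunE -fsumEFin//; over.
  rewrite /= ge0_integral_fsum//; last first.
    by move=> r y _; rewrite EFinM nnfun_muleindic_ge0.
  under eq_fsbigr.
    move=> r _; under eq_integral do rewrite EFinM.
    over.
  over.
rewrite /= ge0_integral_fsum//; last 2 first.
- move=> r; have [r0|r0] := leP 0%R r.
    apply: (@measurable_fun_integral_kernel_prod
      (fun z => r%:E * (\1_(f @^-1` [set r]) z)%:E)).
      by move=> z; rewrite mule_ge0 ?lee_fin.
    by apply: measurable_funeM; exact/measurable_EFinP/measurable_indic.
  rewrite (_ : (fun x => _) = cst 0); first exact: measurable_cst.
  apply/funext => x; apply: integral0_eq => y _.
  by rewrite preimage_nnfun0// indic0 mule0.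
- by move=> r x _; apply: integral_ge0 => y _; rewrite nnfun_muleindic_ge0.
apply: eq_fsbigr => r _.
have [r0|r0] := leP 0%R r; last first.
  rewrite preimage_nnfun0// [LHS]integral0_eq; last first.
    by move=> x _; rewrite indic0 mulr0.
  rewrite [RHS]integral0_eq// => x _.
  by apply: integral0_eq => y _; rewrite indic0 mule0.
under [in LHS]eq_integral do rewrite EFinM.
rewrite ge0_integralZl//; last exact/measurable_EFinP/measurable_indic.
under [in RHS]eq_integral.
  move=> x _; rewrite ge0_integralZl//; last first.
    apply/measurable_EFinP.
    exact: (@measurable_fun_pair2 _ _ _ _ _ _
      (\1_(f @^-1` [set r]) : T * U -> R) _ (measurable_indic (mf r))).
  over.
rewrite /= ge0_integralZl//; last 2 first.
- apply: (@measurable_fun_integral_kernel_prod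
    (fun z => (\1_(f @^-1` [set r]) z)%:E)) => //.
  exact/measurable_EFinP/measurable_indic.
- by move=> x _; apply: integral_ge0 => y _; rewrite lee_fin.
have -> : \int[mu]_z (\1_(f @^-1` [set r]) z)%:E = mu (f @^-1` [set r]).
  by rewrite integral_indic ?setIT.
by [].
Qed.

(** The measure [kernel_prod] is iterated integration by definition, which settles indicators.
    Simple functions follow by linearity, and the general case by monotone convergence in the inner
    integral and then in the outer one. *)
Lemma ge0_integral_kernel_prod (f : T * U -> \bar R) :
  (forall z, 0 <= f z) -> measurable_fun setT f ->
  \int[mu]_z f z = \int[nu]_x \int[k x]_y f (x, y).
Proof.
move=> f0 mf.
pose f_ := nnsfun_approx measurableT mf.
have mf_ n x : measurable_fun setT (fun y => (f_ n (x, y))%:E).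
  exact/measurable_EFinP/(@measurable_fun_pair2 _ _ _ _ _ _ (f_ n)).
transitivity (\int[mu]_z (lim ((f_ n z)%:E @[n --> \oo]))).
  by apply/eq_integral => z _; apply/esym/cvg_lim => //=; exact: cvg_nnsfun_approx.
rewrite monotone_convergence//; last 3 first.
  by move=> n; exact/measurable_EFinP.
  by move=> n z _; rewrite lee_fin.
  by move=> z _ a b ab; rewrite lee_fin; exact/lefP/nd_nnsfun_approx.
under eq_fun do rewrite integral_kernel_prod_nnsfun.
rewrite -monotone_convergence//; last 3 first.
- move=> n; apply: (@measurable_fun_integral_kernel_prod (EFin \o f_ n)).
    by move=> z; rewrite lee_fin.
  exact/measurable_EFinP.
- by move=> n y _; apply: integral_ge0 => // z _; rewrite lee_fin.
- move=> y _ a b ab; apply: ge0_le_integral => //.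
  + by move=> z _; rewrite lee_fin.
  + by move=> z _; rewrite lee_fin; exact/lefP/nd_nnsfun_approx.
apply: eq_integral => y _; rewrite -monotone_convergence//; last 2 first.
  by move=> n z _; rewrite lee_fin.
  by move=> z _ a b ab; rewrite lee_fin; exact/lefP/nd_nnsfun_approx.
by apply: eq_integral => z _; apply/cvg_lim => //; exact: cvg_nnsfun_approx.
Qed.

(** A measurable null cover has zero iterated integral, so almost all of its sections are null. *)
Lemma kernel_prod_ae (P : T * U -> Prop) : (\forall z \ae mu, P z) ->
  \forall x \ae nu, \forall y \ae k x, P (x, y).
Proof.
move=> /ae_measurable_cover[C [mC C0 PC]].
have mC1 : measurable_fun setT (fun x => \int[k x]_y (\1_C (x, y))%:E).
  apply: (@measurable_fun_integral_kernel_prod (fun z => (\1_C z)%:E)) => //.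
  exact/measurable_EFinP/measurable_indic.
have mC2 x : measurable_fun setT (fun y => (\1_C (x, y))%:E : \bar R).
  exact/measurable_EFinP/(@measurable_fun_pair2 _ _ _ _ _ _ (\1_C : T * U -> R))/measurable_indic.
have h0 x : 0 <= \int[k x]_y (\1_C (x, y))%:E :> \bar R.
  by apply: integral_ge0 => y _; rewrite lee_fin.
have : \int[nu]_x `|\int[k x]_y (\1_C (x, y))%:E| = 0.
  by under eq_integral do rewrite gee0_abs//.
move/(ae_eq_integral_abs nu measurableT mC1); apply: filterS => x /(_ I) /= eq0.
have : \int[k x]_y `|(\1_C (x, y))%:E| = 0.
  by under eq_integral do rewrite gee0_abs ?lee_fin//.
move/(ae_eq_integral_abs (k x) measurableT (mC2 x)); apply: filterS => y /(_ I) /= h.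
apply: PC => Cxy; move: h; rewrite indicE mem_set// => -[] /eqP.
by rewrite oner_eq0.
Qed.

Lemma integrable_kernel_prod (f : T * U -> \bar R) :
  mu.-integrable setT f ->
  nu.-integrable setT (fun x => \int[k x]_y f (x, y)) /\
  \int[mu]_z f z = \int[nu]_x \int[k x]_y f (x, y).
Proof.
move=> fi; have mf := measurable_int _ fi.
have mfp : measurable_fun setT f^\+ by exact: measurable_funepos.
have mfn : measurable_fun setT f^\- by exact: measurable_funeneg.
have p0 (h : T * U -> \bar R) x : (forall z, 0 <= h z) -> 0 <= \int[k x]_y h (x, y).
  by move=> h0; apply: integral_ge0.
have ip : nu.-integrable setT (fun x => \int[k x]_y f^\+ (x, y)).
  apply/integrableP; split; first exact: measurable_fun_integral_kernel_prod.
  under eq_integral do rewrite gee0_abs ?p0//.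
  by rewrite -ge0_integral_kernel_prod// integral_funepos_lt_pinfty.
have im : nu.-integrable setT (fun x => \int[k x]_y f^\- (x, y)).
  apply/integrableP; split; first exact: measurable_fun_integral_kernel_prod.
  under eq_integral do rewrite gee0_abs ?p0//.
  by rewrite -ge0_integral_kernel_prod// integral_funeneg_lt_pinfty.
have fE : (fun x => \int[k x]_y f (x, y)) =
    (fun x => \int[k x]_y f^\+ (x, y)) \- (fun x => \int[k x]_y f^\- (x, y)).
  apply/funext => x; rewrite [LHS]integralE; congr (_ - _);
  by apply: eq_integral => y _; rewrite ?funeposE ?funenegE.
split; first by rewrite fE; exact: integrableB.
rewrite fE integralB// [LHS]integralE ge0_integral_kernel_prod//.
by rewrite ge0_integral_kernel_prod.
Qed.

Lemma ae_integrable_kernel_prod (f : T * U -> \bar R) :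
  mu.-integrable setT f ->
  \forall x \ae nu, (k x).-integrable setT (fun y => f (x, y)).
Proof.
move=> /integrableP[mf fi].
have mf1 : measurable_fun setT (fun x => \int[k x]_y `|f (x, y)|).
  apply: (@measurable_fun_integral_kernel_prod (fun z => `|f z|)) => //.
  exact: measurableT_comp.
have : nu.-integrable setT (fun x => \int[k x]_y `|f (x, y)|).
  apply/integrableP; split => //.
  under eq_integral do rewrite gee0_abs ?integral_ge0//.
  rewrite -(@ge0_integral_kernel_prod (fun z => `|f z|))//.
  exact: measurableT_comp.
move=> /(integrable_ae measurableT); apply: filterS => x /(_ I) fin.
apply/integrableP; split; first exact: measurable_fun_pair2 mf.
by rewrite ltey_eq fin.
Qed.

(** Each [k x] has mass 1, so [nu] is the first marginal of [mu]. *)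
Lemma kernel_prod_fst A : measurable A -> mu (A `*` setT) = nu A.
Proof.
move=> mA; rewrite /kernel_prod -[A in RHS]setIT -integral_indic//; apply: eq_integral => x _.
rewrite (_ : (fun _ => _) = cst (\1_A x)%:E).
  by rewrite integral_cst// prob_kernel mule1.
by apply/funext => y; rewrite !indicE in_setX/= in_setT andbT.
Qed.

Lemma ae_kernel_prod_fst (P : T -> Prop) :
  (\forall x \ae nu, P x) -> \forall z \ae mu, P z.1.
Proof.
move=> [C [mC C0 PC]]; exists (C `*` setT); split.
- exact: measurableX.
- by rewrite [LHS]kernel_prod_fst.
- by move=> z /= nP; split => //; exact: PC.
Qed.

Lemma ge0_integral_kernel_prod_fst (f : T -> \bar R) :
  (forall x, 0 <= f x) -> measurable_fun setT f ->
  \int[mu]_z f z.1 = \int[nu]_x f x.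
Proof.
move=> f0 mf; rewrite (@ge0_integral_kernel_prod (fun z => f z.1))//; last first.
  exact: measurableT_comp.
apply: eq_integral => x _ /=.
transitivity (\int[k x]_y cst (f x) y) => //.
by rewrite integral_cst// prob_kernel mule1.
Qed.

Lemma integrable_kernel_prod_fst (f : T -> \bar R) :
  nu.-integrable setT f -> mu.-integrable setT (fun z => f z.1).
Proof.
move=> /integrableP[mf fi]; apply/integrableP; split.
  exact: measurableT_comp.
rewrite (@ge0_integral_kernel_prod_fst (fun x => `|f x|))//.
exact: measurableT_comp.
Qed.

Lemma integral_kernel_prod_fst (f : T -> \bar R) :
  nu.-integrable setT f -> \int[mu]_z f z.1 = \int[nu]_x f x.
Proof.
move=> /integrable_kernel_prod_fst/integrable_kernel_prod[_ ->].
apply: eq_integral => x _ /=.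
transitivity (\int[k x]_y cst (f x) y) => //.
by rewrite integral_cst// prob_kernel mule1.
Qed.

End kernel_prod_tonelli.

Section kernel_prod_swap.
Context d (T : measurableType d) (R : realType).
Variables (nu : {measure set T -> \bar R}) (k : R.-pker T ~> T).
Local Notation mu := (kernel_prod nu k).
Hypothesis rev : forall A : set (T * T), measurable A ->
  mu A = mu [set z | A (z.2, z.1)].

Lemma ae_kernel_prod_swap (P : T * T -> Prop) :
  (\forall z \ae mu, P z) -> \forall z \ae mu, P (swap_pair z).
Proof.
move=> [C [mC C0 PC]]; exists [set z | C (z.2, z.1)]; split.
- rewrite -[X in measurable X]setTI.
  by apply: (@measurable_swap _ _ T T).
- by rewrite -C0 [RHS]rev.
- by move=> -[x y] /= nP; exact: PC.
Qed.

Lemma ge0_integral_kernel_prod_swap (f : T * T -> \bar R) :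
  (forall z, 0 <= f z) -> measurable_fun setT f ->
  \int[mu]_z f (swap_pair z) = \int[mu]_z f z.
Proof.
move=> f0 mf.
transitivity (\int[pushforward mu (@swap_pair T T)]_z f z).
  rewrite (ge0_integral_pushforward (@measurable_swap _ _ T T)) ?preimage_setT//.
apply: eq_measure_integral; first exact: measurable_swap.
by move=> ? A mA _; exact: esym (rev mA).
Qed.

Lemma integrable_kernel_prod_swap (f : T * T -> \bar R) :
  mu.-integrable setT f -> mu.-integrable setT (f \o swap_pair).
Proof.
move=> /integrableP[mf fi]; apply/integrableP; split.
  apply: measurableT_comp => //; exact: measurable_swap.
rewrite (@ge0_integral_kernel_prod_swap (fun x => `|f x|))//.
exact: measurableT_comp.
Qed.

Lemma integral_kernel_prod_swap (f : T * T -> \bar R) :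
  measurable_fun setT f ->
  \int[mu]_z f (swap_pair z) = \int[mu]_z f z.
Proof.
move=> mf; rewrite [LHS]integralE [RHS]integralE.
congr (_ - _).
  transitivity (\int[mu]_z f^\+ (swap_pair z)); last first.
    by rewrite ge0_integral_kernel_prod_swap//; exact: measurable_funepos.
  by apply: eq_integral => z _; rewrite !funeposE.
transitivity (\int[mu]_z f^\- (swap_pair z)); last first.
    by rewrite ge0_integral_kernel_prod_swap//; exact: measurable_funeneg.
  by apply: eq_integral => z _; rewrite !funenegE.
Qed.

(** Reversibility makes [nu] the second marginal too, so [nu]-null sets can be discarded in either
    variable. *)
Lemma ae_kernel_prod_snd (P : T -> Prop) :
  (\forall x \ae nu, P x) -> \forall z \ae mu, P z.2.
Proof. by move=> /(ae_kernel_prod_fst k)/ae_kernel_prod_swap. Qed.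

End kernel_prod_swap.

(** * Accretivity inequalities *)

Section convex_approximation.
Context (R : realType).
Local Open Scope ring_scope.

(** The subgradient is the left derivative, taken as the supremum of the slopes to the left of [r].
    Convexity places these below every slope to the right, and the Lipschitz bound confines them all
    to [[-L, L]]. *)
Lemma convex_lipschitz_subgradient (l : R -> R) (L : R) :
  (forall t x y, 0 <= t <= 1 ->
    l (t * x + (1 - t) * y) <= t * l x + (1 - t) * l y) ->
  (forall x y, l x - l y <= L * `|x - y|) ->
  exists q : R -> R, (forall r, `|q r| <= L) /\
    (forall r s, l r + q r * (s - r) <= l s).
Proof.
move=> lconv llip.
pose S r := [set (l r - l s) / (r - s) | s in [set s | s < r]].
have S0 r : S r !=set0.
  by exists ((l r - l (r - 1)) / (r - (r - 1))); exists (r - 1) => //=; lra.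
have Sle r t : r < t -> ubound (S r) ((l t - l r) / (t - r)).
  move=> rt _ [s /= sr <-].
  have sr0 : 0 < r - s by rewrite subr_gt0.
  have tr0 : 0 < t - r by rewrite subr_gt0.
  have ts0 : 0 < t - s by lra.
  rewrite ler_pdivrMr// mulrAC ler_pdivlMr//.
  have := lconv ((t - r) / (t - s)) s t.
  have th01 : 0 <= (t - r) / (t - s) <= 1.
    apply/andP; split; first exact: divr_ge0 (ltW _) (ltW _).
    by rewrite ler_pdivrMr// mul1r; lra.
  move=> /(_ th01).
  have -> : (t - r) / (t - s) * s + (1 - (t - r) / (t - s)) * t = r.
    by field; rewrite gt_eqF.
  have -> : (t - r) / (t - s) * l s + (1 - (t - r) / (t - s)) * l t =
      ((t - r) * l s + (r - s) * l t) / (t - s).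
    by field; rewrite gt_eqF.
  by rewrite ler_pdivlMr//; nra.
have Sb r : has_sup (S r).
  split; first exact: S0.
  by exists ((l (r + 1) - l r) / (r + 1 - r)); apply: Sle; lra.
exists (fun r => sup (S r)); split => [r|r s].
  rewrite ler_norml; apply/andP; split.
    apply: (@le_trans _ _ ((l r - l (r - 1)) / (r - (r - 1)))).
      have := llip (r - 1) r.
      rewrite (_ : r - (r - 1) = 1) ?divr1; last by ring.
      by rewrite (_ : r - 1 - r = - 1) ?normrN ?normr1 ?mulr1; [lra|ring].
    apply: sup_upper_bound => //; exists (r - 1) => //=; lra.
  apply: ge_sup => // _ [s /= sr <-].
  have sr0 : 0 < r - s by rewrite subr_gt0.
  by rewrite ler_pdivrMr//; have := llip r s; rewrite gtr0_norm.
have [rs|sr|->] := ltgtP r s; last by rewrite subrr mulr0 addr0.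
  have : sup (S r) <= (l s - l r) / (s - r) by apply: ge_sup => //; exact: Sle.
  by rewrite ler_pdivlMr ?subr_gt0// => h; lra.
have : (l r - l s) / (r - s) <= sup (S r).
  by apply: sup_upper_bound => //; exists s.
by rewrite ler_pdivrMr ?subr_gt0// => h; lra.
Qed.

Variable j : R -> \bar R.
Hypothesis jJ0 : J0 j.

(** Minimising over real points of the epigraph, rather than over values of [j], keeps the
    inf-convolution real although [j] may be infinite. *)
Let epi : set (R * R) := [set z | (j z.1 <= z.2%:E)%E].

Let pen n r : set R := [set z.2 + n%:R * `|r - z.1| | z in epi].

(* The inf-convolution of j with [n |.|]. *)
Let l n r : R := inf (pen n r).

Let epi_ge0 z : epi z -> 0 <= z.2.
Proof.
by case: jJ0 => j0 _ _ _ jz; rewrite -lee_fin; exact: le_trans (j0 z.1) jz.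
Qed.

Let pen_ge0 n r : lbound (pen n r) 0.
Proof. by move=> _ [z ez <-]; rewrite addr_ge0 ?mulr_ge0 ?epi_ge0. Qed.

Let epi0 : epi (0, 0).
Proof. by case: jJ0 => _ _ _ j00; rewrite /epi/= j00. Qed.

Let has_inf_pen n r : has_inf (pen n r).
Proof.
by split; [exists (0 + n%:R * `|r - 0|); exists (0, 0)|exists 0; exact: pen_ge0].
Qed.

Let l_le n r z : epi z -> l n r <= z.2 + n%:R * `|r - z.1|.
Proof. by move=> ez; apply: inf_lbound; [exists 0; exact: pen_ge0|exists z]. Qed.

Let le_l n r v : (forall z, epi z -> v <= z.2 + n%:R * `|r - z.1|) -> v <= l n r.
Proof.
by move=> h; apply: lb_le_inf; [have [] := has_inf_pen n r|move=> _ [z /h ? <-]].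
Qed.

Let l_convex n t x y : 0 <= t <= 1 ->
  l n (t * x + (1 - t) * y) <= t * l n x + (1 - t) * l n y.
Proof.
move=> t01; apply/ler_addgt0Pr => e e0.
have [_ [z1 ez1 <-] h1] := inf_adherent e0 (has_inf_pen n x).
have [_ [z2 ez2 <-] h2] := inf_adherent e0 (has_inf_pen n y).
have t0 : 0 <= t by case/andP: t01.
have t1 : 0 <= 1 - t by rewrite subr_ge0; case/andP: t01.
have ez : epi (t * z1.1 + (1 - t) * z2.1, t * z1.2 + (1 - t) * z2.2).
  case: jJ0 => _ jc _ _; rewrite /epi/=; apply: (le_trans (jc _ _ _ t01)).
  by rewrite [leRHS]EFinD !EFinM leeD// lee_wpmul2l// lee_fin.
apply: le_trans (l_le n _ ez) _ => /=.
have : n%:R * `|t * x + (1 - t) * y - (t * z1.1 + (1 - t) * z2.1)| <=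
    t * (n%:R * `|x - z1.1|) + (1 - t) * (n%:R * `|y - z2.1|).
  rewrite (_ : _ - _ = t * (x - z1.1) + (1 - t) * (y - z2.1)); last by ring.
  apply: le_trans (ler_wpM2l _ (ler_normD _ _)) _ => //.
  by rewrite !normrM (ger0_norm t0) (ger0_norm t1); lra.
rewrite -/(l n x) -/(l n y) in h1 h2; move: h1 h2 => /ltW h1 /ltW h2.
have := ler_wpM2l t0 h1; have := ler_wpM2l t1 h2; lra.
Qed.

Let l_lip n x y : l n x - l n y <= n%:R * `|x - y|.
Proof.
rewrite lerBlDr -lerBlDl; apply: le_l => z ez.
have := l_le n x ez; have : n%:R * `|x - z.1| <= n%:R * `|x - y| + n%:R * `|y - z.1|.
  by rewrite -mulrDr ler_wpM2l// -(subrKA y) ler_normD.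
by lra.
Qed.

Let l_ge0 n r : 0 <= l n r.
Proof. by apply: le_l => z ez; apply: pen_ge0; exists z. Qed.

Let l_nd r : {homo l^~ r : m n / (m <= n)%N >-> m <= n}.
Proof.
move=> m n mn; apply: le_l => z ez; apply: le_trans (l_le m r ez) _.
by rewrite lerD2l ler_wpM2r// ler_nat.
Qed.

Let l_le_j n r : ((l n r)%:E <= j r)%E.
Proof.
have j0 : (0 <= j r)%E by case: jJ0.
case jr : (j r) j0 => [v| |]//= _; last by rewrite leey.
rewrite lee_fin; have /(l_le n r) : epi (r, v) by rewrite /epi/= jr.
by rewrite /= subrr normr0 mulr0 addr0.
Qed.

(** Within some distance [e] of [r], lower semicontinuity keeps [j] above [M]. Farther away the
    penalty alone is at least [n e], hence at least [M] once [n >= M / e]. *)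
Let l_large r M : (M%:E < j r)%E -> exists n, M <= l n r.
Proof.
have [M0|M0] := leP M 0; first by exists 0%N; exact: le_trans M0 (l_ge0 _ _).
case: jJ0 => _ _ jlsc _ /jlsc[V /nbhs_ballP[e /= e0 eV] VM].
have [n nM] : exists n : nat, M / e <= n%:R.
  by exists (Num.truncn (M / e)).+1; exact/ltW/truncnS_gt.
exists n; apply: le_l => z ez.
have [rz|rz] := ltP `|r - z.1| e.
  have Mz : M < z.2.
    by rewrite -lte_fin; apply: lt_le_trans ez; exact/VM/eV.
  by rewrite ler_wpDr ?mulr_ge0// ltW.
rewrite ler_wpDl ?epi_ge0//.
move: nM; rewrite ler_pdivrMr// => /le_trans; apply.
by rewrite ler_wpM2l.
Qed.

Let l_cvg r : ((l n r)%:E @[n --> \oo] --> j r)%E.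
Proof.
have -> : j r = ereal_sup (range (fun n => (l n r)%:E)).
  apply/eqP; rewrite eq_le; apply/andP; split; last first.
    by apply: ge_ereal_sup => _ [n _ <-].
  have lS n : ((l n r)%:E <= ereal_sup (range (fun n => (l n r)%:E)))%E.
    by apply: ereal_sup_ubound; exists n.
  case: ereal_sup lS => [v lv| |/(_ 0%N)//]; last by rewrite leey.
  rewrite leNgt; apply/negP => vj.
  have [M vM Mj] : exists2 M, v < M & (M%:E < j r)%E.
    case: (j r) vj => [w vw| _|//]; last by exists (v + 1); rewrite ?ltry// ltrDl.
    by rewrite lte_fin in vw; exists ((v + w) / 2); rewrite ?lte_fin; lra.
  have [n Mn] := l_large Mj.
  by have := lv n; rewrite lee_fin => /(le_trans Mn); rewrite leNgt vM.
by apply: ereal_nondecreasing_cvgn => m n mn; rewrite lee_fin l_nd.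
Qed.

(** These are the Pasch-Hausdorff envelopes of [j]. The bound by [n |r|] comes from the epigraph
    point [(0, 0)] and makes [l n] of an integrable function integrable. *)
Lemma J0_lipschitz_approx : exists (l q : nat -> R -> R),
  [/\ forall n r, 0 <= l n r <= n%:R * `|r|,
      forall r, {homo l^~ r : m n / (m <= n)%N >-> m <= n},
      forall n r, ((l n r)%:E <= j r)%E,
      forall r, ((l n r)%:E @[n --> \oo] --> j r)%E &
      forall n, [/\ forall x y, `|l n x - l n y| <= n%:R * `|x - y|,
        forall r, `|q n r| <= n%:R &
        forall r s, l n r + q n r * (s - r) <= l n s]].
Proof.
have /choice[q qP] n := convex_lipschitz_subgradient (@l_convex n) (@l_lip n).
exists l, q; split => //.
  move=> n r; rewrite l_ge0/=; have := l_le n r epi0.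
  by rewrite subr0 add0r.
move=> n; have [q1 q2] := qP n; split => // x y.
by rewrite ler_norml l_lip andbT lerNl opprB distrC l_lip.
Qed.

End convex_approximation.

Section accretivity_inequalities.
Context d (T : measurableType d) (R : realType).
Variables (nu : {measure set T -> \bar R}).

(** Adding the subgradient inequalities at [r] and at [s] gives [(q s - q r) (s - r) >= 0]. *)
Lemma subgradient_nondecreasing (l q : R -> R) :
  (forall r s, l r + q r * (s - r) <= l s)%R ->
  {homo q : r s / (r <= s)%R}.
Proof.
move=> lq r s; rewrite le_eqVlt => /predU1P[->//|rs].
rewrite -subr_ge0 -(pmulr_lge0 _ (_ : 0 < s - r)%R) ?subr_gt0//.
have := lq r s; have := lq s r; nra.
Qed.

Lemma continuous_lipschitz (l : R -> R) (L : R) :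
  (forall x y, `|l x - l y| <= L * `|x - y|)%R -> continuous l.
Proof.
move=> ll x; apply/cvgrPdist_le => e e0.
have M0 : (0 < Num.max L 1)%R by rewrite lt_max ltr01 orbT.
apply/nbhs_ballP; exists (e / Num.max L 1)%R => /=; first by rewrite divr_gt0.
move=> y /ltW xy; apply: le_trans (ll _ _) _.
apply: (@le_trans _ _ (Num.max L 1 * `|x - y|)%R).
  by rewrite ler_wpM2r// le_max lexx.
by rewrite mulrC -ler_pdivlMr.
Qed.

(** Integrating [l n (w + lam z) >= l n w + lam q(w) z] leaves exactly the pairing of the last
    hypothesis. Boundedness of [q] keeps that pairing finite when [z] is merely integrable. *)
Lemma integral_J0_le (O : set T) (w z : T -> R) (lam : R) (j : R -> \bar R) :
  measurable O -> (0 < lam)%R -> J0 j ->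
  nu.-integrable O (EFin \o w) -> nu.-integrable O (EFin \o z) ->
  (forall (q : R -> R) L, {homo q : r s / (r <= s)%R} ->
    (forall r, `|q r| <= L)%R ->
    0 <= \int[nu]_(x in O) (q (w x) * z x)%:E) ->
  \int[nu]_(x in O) j (w x) <= \int[nu]_(x in O) j (w x + lam * z x)%R.
Proof.
move=> mO lam0 jJ0 iw iz hq.
have [l [q [l0 lnd lj lcvg lq]]] := J0_lipschitz_approx jJ0.
have mw : measurable_fun O w by exact/measurable_EFinP/(measurable_int _ iw).
have mz : measurable_fun O z by exact/measurable_EFinP/(measurable_int _ iz).
have iwz : nu.-integrable O (fun x => (w x + lam * z x)%:E).
  under eq_fun do rewrite EFinD EFinM.
  by apply: integrableD => //; exact: integrableZl.
have ml n : measurable_fun setT (l n).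
  apply: continuous_measurable_fun; have [ll _ _] := lq n.
  exact: continuous_lipschitz ll.
have mj : measurable_fun setT j.
  by apply: lower_semicontinuous_measurable; case: jJ0.
have mwz : measurable_fun O (fun x => w x + lam * z x)%R.
  exact/measurable_EFinP/(measurable_int _ iwz).
have il n (f : T -> R) : nu.-integrable O (EFin \o f) ->
    nu.-integrable O (fun x => (l n (f x))%:E).
  move=> fi; have mf : measurable_fun O f.
    exact/measurable_EFinP/(measurable_int _ fi).
  apply: (@le_integrable _ _ _ _ _ mO _ (fun x => n%:R%:E * (EFin \o f) x)).
  - exact/measurable_EFinP/measurableT_comp.
  - move=> x _ /=; rewrite lee_fin; have /andP[h1 h2] := l0 n (f x).
    by rewrite ger0_norm// normrM (@ger0_norm _ n%:R).
  - exact: integrableZl.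
have qmono n : {homo q n : r s / (r <= s)%R}.
  by have [_ _] := lq n; exact: subgradient_nondecreasing.
have mq n : measurable_fun setT (q n) by exact: nondecreasing_measurable.
have iqz n : nu.-integrable O (fun x => (q n (w x) * z x)%:E).
  apply: (@le_integrable _ _ _ _ _ mO _ (fun x => n%:R%:E * (EFin \o z) x)).
  - by apply/measurable_EFinP/measurable_funM => //; exact: measurableT_comp.
  - move=> x _ /=; rewrite lee_fin !normrM ler_wpM2r//.
    by have [_ + _] := lq n => /(_ (w x)) /le_trans; apply; exact: ler_norm.
  - exact: integrableZl.
have step n : \int[nu]_(x in O) (l n (w x))%:E <=
    \int[nu]_(x in O) (l n (w x + lam * z x)%R)%:E.
  apply: (@le_trans _ _
    (\int[nu]_(x in O) ((l n (w x))%:E + lam%:E * (q n (w x) * z x)%:E))).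
    rewrite integralD//; [|exact: il|exact: integrableZl].
    rewrite integralZl// leeDl// mule_ge0//; first by rewrite lee_fin ltW.
    by have [_ q1 _] := lq n; exact: (hq _ _ (@qmono n) q1).
  apply: le_integral => //; [|exact: il|].
    by apply: integrableD => //; [exact: il|exact: integrableZl].
  move=> x _; rewrite -EFinM -EFinD lee_fin.
  have [_ _ /(_ (w x) (w x + lam * z x)%R)] := lq n.
  by apply: le_trans; rewrite lerD2l; lra.
(* Monotone convergence serves the left-hand side; on the right the bound [l n <= j] is enough. *)
have : \int[nu]_(x in O) (l n (w x))%:E @[n --> \oo] --> \int[nu]_(x in O) j (w x).
  have -> : \int[nu]_(x in O) j (w x) =
      \int[nu]_(x in O) limn (fun n => (l n (w x))%:E).
    by apply: eq_integral => x _; apply/esym/cvg_lim.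
  apply: cvg_monotone_convergence => //.
  - by move=> n; exact/measurable_EFinP/measurableT_comp.
  - by move=> n x _; rewrite lee_fin; have /andP[] := l0 n (w x).
  - by move=> x _ m n mn; rewrite lee_fin; exact: lnd.
move=> cv; rewrite -(cvg_lim _ cv)//; apply: lime_le; first by apply/cvg_ex; eexists; exact: cv.
apply: nearW => n; apply: le_trans (step n) _.
apply: ge0_le_integral => //.
- by move=> x _; rewrite lee_fin; have /andP[] := l0 n (w x + lam * z x)%R.
- exact/measurable_EFinP/measurableT_comp.
- exact: measurableT_comp.
Qed.

Variable k : R.-pker T ~> T.
Local Notation mu := (kernel_prod nu k).
Hypothesis rev : forall A : set (T * T), measurable A ->
  mu A = mu [set z | A (z.2, z.1)].

Lemma integrable_bounded_mul d' (S : measurableType d')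
    (m : {measure set S -> \bar R}) (f g : S -> R) (L : R) :
  m.-integrable setT (EFin \o f) -> measurable_fun setT g ->
  (forall x, `|g x| <= L)%R -> m.-integrable setT (fun x => (f x * g x)%:E).
Proof.
move=> fi mg gL.
apply: (@le_integrable _ _ _ _ _ measurableT _ (fun x => L%:E * (EFin \o f) x)).
- apply/measurable_EFinP/measurable_funM => //.
  exact/measurable_EFinP/(measurable_int _ fi).
- move=> x _ /=; rewrite lee_fin !normrM mulrC ler_wpM2r//.
  exact: le_trans (gL x) (ler_norm _).
- exact: integrableZl.
Qed.

(* Swapping the variables and using antisymmetry of [b], twice the left-hand
   side is [- \int b(x,y) (q (w y) - q (w x))]. *)
Lemma monotone_flux_le0 (b : T * T -> R) (w : T -> R) (q : R -> R) (L : R) :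
  mu.-integrable setT (EFin \o b) -> measurable_fun setT w ->
  (\forall z \ae mu, b (swap_pair z) = - b z)%R ->
  (\forall z \ae mu, 0 <= b z * (w z.2 - w z.1))%R ->
  {homo q : r s / (r <= s)%R} -> (forall r, `|q r| <= L)%R ->
  \int[nu]_x ((q (w x))%:E * \int[k x]_y (b (x, y))%:E) <= 0.
Proof.
move=> bi mw bA bw qm qL.
have mb : measurable_fun setT b.
  by apply/measurable_EFinP; exact: (measurable_int mu bi).
have mq : measurable_fun setT q by exact: nondecreasing_measurable.
have m1 : measurable_fun setT (fun z : T * T => q (w z.1)).
  by apply: measurableT_comp => //; exact: measurableT_comp.
have m2 : measurable_fun setT (fun z : T * T => q (w z.2)).
  by apply: measurableT_comp => //; exact: measurableT_comp.
have i1 : mu.-integrable setT (fun z => (b z * q (w z.1))%:E).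
  exact: (integrable_bounded_mul bi m1 (fun z => qL _)).
have i2 : mu.-integrable setT (fun z => (b z * q (w z.2))%:E).
  exact: (integrable_bounded_mul bi m2 (fun z => qL _)).
have E1 : \int[mu]_z (b z * q (w z.1))%:E =
    \int[nu]_x ((q (w x))%:E * \int[k x]_y (b (x, y))%:E).
  rewrite (integrable_kernel_prod i1).2.
  apply: Defs.integral_ae_eq.
  have : \forall x \ae nu, (k x).-integrable setT (fun y => (b (x, y))%:E).
    exact: ae_integrable_kernel_prod bi.
  apply: filterS => x bx _ /=; rewrite -integralZl//.
  by apply: eq_integral => y _; rewrite -EFinM mulrC.
have E2 : \int[mu]_z (b z * q (w z.1))%:E = - \int[mu]_z (b z * q (w z.2))%:E.
  rewrite -(integral_kernel_prod_swap rev (measurable_int _ i1)).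
  rewrite -[RHS]mulN1e -integralZl//.
  apply: Defs.integral_ae_eq; apply: filterS bA => z bz _.
  by rewrite /= bz mulN1e mulNr.
have : 0 <= \int[mu]_z (b z * q (w z.2))%:E - \int[mu]_z (b z * q (w z.1))%:E.
  rewrite -integralB//.
  (* The integrand is nonnegative only almost everywhere; taking the maximum with 0 gives a version
     nonnegative at every point. *)
  rewrite (@Defs.integral_ae_eq _ _ _ _ _ _ (fun z => (Num.max 0 (b z * (q (w z.2) - q (w z.1))))%:E)).
    by apply: integral_ge0 => z _; rewrite lee_fin le_max lexx.
  apply: filterS bw => z bz _; rewrite -EFinB -mulrBr; congr EFin.
  apply/esym/max_idPr; have [h|h] := leP (w z.1) (w z.2).
    have := qm _ _ h; have [->|h2 qh] := eqVneq (w z.1) (w z.2).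
      by rewrite subrr mulr0.
    by rewrite mulr_ge0 ?subr_ge0// -(pmulr_lge0 _ (_ : 0 < w z.2 - w z.1)%R) ?subr_gt0// lt_neqAle h2.
  have := qm _ _ (ltW h) => qh.
  by rewrite mulr_le0 ?subr_le0// -(nmulr_lge0 _ (_ : w z.2 - w z.1 < 0)%R) ?subr_lt0.
rewrite -[X in 0 <= X - _]oppeK -E2 -E1.
have : \int[mu]_z (b z * q (w z.1))%:E \is a fin_num by exact: integrable_fin_num.
by case: integral => [r| |]//= _; rewrite ?(EFinN, EFinD) !lee_fin; lra.
Qed.

End accretivity_inequalities.

(** * Potential of a monotone flux *)

Section monotone_primitive.
Context (R : realType) (b : R -> R).
Hypothesis bmono : {homo b : r s / (r <= s)%R}.
Hypothesis b0 : forall r, (0 <= r -> 0 <= b r)%R.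
Local Open Scope ring_scope.
Notation leb := (@lebesgue_measure R).

(* Vanishes for r <= 0; negative arguments of a flux are handled by reflection. *)
Definition primitive (r : R) : R := \int[leb]_(t in `[0%R, r]%classic) b t.

Lemma primitive_le0 r : r <= 0 -> primitive r = 0.
Proof.
rewrite /primitive le_eqVlt => /predU1P[->|r0]; first by rewrite set_itv1 Rintegral_set1.
by rewrite set_itv_ge ?Rintegral_set0//= bnd_simp -ltNge.
Qed.

Lemma primitive_ge0 r : 0 <= primitive r.
Proof. by apply: Rintegral_ge0 => x /=; rewrite in_itv/= => /andP[? _]; exact: b0. Qed.

Let ib (r s : R) (c : bool) : 0 <= r ->
  leb.-integrable [set` Interval (BSide c r) (BRight s)] (EFin \o b).
Proof.
move=> r0; apply: measurable_bounded_integrable => //.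
- rewrite /= lebesgue_measure_itv/=; case: ifPn => // _; first by rewrite -EFinD ltry.
- by apply: measurable_funTS; exact: nondecreasing_measurable.
- exists (b s); split; first exact: num_real.
  move=> M sM x /=; rewrite in_itv/= => /andP[rx xs].
  have x0 : 0 <= x.
    by case: c rx => /= [|/ltW]; exact: le_trans.
  by rewrite ger0_norm ?b0// (le_trans (bmono xs))// ltW.
Qed.

Let primitiveB r s : 0 <= r -> r <= s ->
  primitive s - primitive r = \int[leb]_(t in `]r, s]%classic) b t.
Proof. by move=> r0 rs; apply: Rintegral_itvB => //; [exact: ib|rewrite bnd_simp..]. Qed.

Let fine_itv (r s : R) : r <= s -> fine (leb `]r, s]%classic) = s - r.
Proof.
move=> rs; rewrite lebesgue_measure_itv/= lte_fin; case: ltgtP rs => //= ->.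
by rewrite subrr.
Qed.

Lemma primitive_bounds r s : 0 <= r -> r <= s ->
  b r * (s - r) <= primitive s - primitive r <= b s * (s - r).
Proof.
move=> r0 rs; rewrite primitiveB// -!(fine_itv rs) -!Rintegral_cst//.
have ic c : leb.-integrable `]r, s]%classic (EFin \o cst c).
  apply: measurable_bounded_integrable => //.
    by rewrite /= lebesgue_measure_itv/=; case: ifPn => // _; rewrite -EFinD ltry.
  by exists `|c|; split; [exact: num_real|move=> M /ltW cM x _].
apply/andP; split; apply: le_Rintegral => //; try exact: ic; try exact: ib.
  by move=> x /=; rewrite in_itv/= => /andP[/ltW ? _]; exact: bmono.
by move=> x /=; rewrite in_itv/= => /andP[_ ?]; exact: bmono.
Qed.

End monotone_primitive.

Section potential.
Context d (S : measurableType d) (R : realType) (A : S -> R -> R).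
Local Open Scope ring_scope.
Hypothesis mA : measurable_fun setT (fun t : S * R => A t.1 t.2).
Hypothesis Amono : forall z r s, 0 <= (A z r - A z s) * (r - s).
Hypothesis A00 : forall z, A z 0 = 0.

Let Am z r := - A z (- r).

Let homoA z : {homo A z : r s / r <= s}.
Proof.
move=> r s; rewrite le_eqVlt => /predU1P[->//|rs].
by have := Amono z s r; rewrite pmulr_lge0 ?subr_ge0// subr_gt0.
Qed.

Let homoAm z : {homo Am z : r s / r <= s}.
Proof. by move=> r s rs; rewrite lerN2 homoA// lerN2. Qed.

Let A_ge0 z r : 0 <= r -> 0 <= A z r.
Proof. by move=> r0; rewrite -(A00 z) homoA. Qed.

Let Am_ge0 z r : 0 <= r -> 0 <= Am z r.
Proof. by move=> r0; rewrite oppr_ge0 -(A00 z) homoA// lerNl oppr0. Qed.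

(** The variable upper limit becomes a constraint on the product [S * R], where the integrand is
    jointly measurable and Tonelli applies. *)
Let measurable_primitive (D : S -> R -> R) (g : S -> R) :
  measurable_fun setT (fun t : S * R => D t.1 t.2) ->
  (forall z r, 0 <= r -> 0 <= D z r) ->
  measurable_fun setT g -> measurable_fun setT (fun z => primitive (D z) (g z)).
Proof.
move=> mD D0 mg.
pose f (t : S * R) : R := if (0 <= t.2) && (t.2 <= g t.1) then D t.1 t.2 else 0.
have f0 t : (0 <= (f t)%:E)%E.
  by rewrite lee_fin /f; case: ifPn => // /andP[/D0].
have mf : measurable_fun setT (EFin \o f).
  apply/measurable_EFinP; apply: measurable_fun_ifT => //.
  apply: measurable_and; apply: measurable_fun_ler => //.
  exact: measurableT_comp.
have fE z : (\int[lebesgue_measure]_(t in `[0%R, g z]%classic) (D z t)%:E)%E =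
    (\int[lebesgue_measure]_t (f (z, t))%:E)%E.
  rewrite integral_mkcond; apply: eq_integral => t _.
  by rewrite patchE /f /= mem_setE in_itv/=; case: ifPn.
rewrite /primitive /Rintegral; under eq_fun do rewrite fE.
apply: measurableT_comp; first exact: fine_measurable.
exact: (@measurable_fun_fubini_tonelli_F _ _ _ _ _ lebesgue_measure _ mf f0).
Qed.

(** [Phi z r] is the integral of [A z] from 0 to [r]; for [r < 0] it is the primitive of the
    reflected flux [Am z] at [- r]. The subgradient inequality, split by the signs of [r] and [s],
    follows by bounding a nondecreasing integrand by its endpoint values. *)
Lemma exists_potential : exists Phi : S -> R -> R,
  [/\ forall g, measurable_fun setT g -> measurable_fun setT (fun z => Phi z (g z)),
    forall z, Phi z 0 = 0,
    forall z r, 0 <= Phi z r &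
    forall z r s, Phi z r + A z r * (s - r) <= Phi z s].
Proof.
exists (fun z r => primitive (A z) r + primitive (Am z) (- r)); split.
- move=> g mg; apply: measurable_funD; first exact: measurable_primitive.
  apply: (@measurable_primitive Am (fun z => - g z)) => //.
    apply: measurableT_comp => //.
    apply: (@measurableT_comp _ _ _ _ _ _ _ _ (fun t : S * R => (t.1, - t.2)) mA).
    by apply: measurable_fun_pair => //; exact: measurableT_comp.
  exact: measurableT_comp.
- by move=> z; rewrite oppr0 !primitive_le0 ?addr0.
- by move=> z r; apply: addr_ge0; apply: primitive_ge0; [exact: A_ge0|exact: Am_ge0].
have bA z := @primitive_bounds _ _ (@homoA z) (@A_ge0 z).
have bAm z := @primitive_bounds _ _ (@homoAm z) (@Am_ge0 z).
have pA z := @primitive_ge0 _ _ (@A_ge0 z).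
have pAm z := @primitive_ge0 _ _ (@Am_ge0 z).
have z0 (b : R -> R) : primitive b 0 = 0 by apply: primitive_le0.
have zn (b : R -> R) r : 0 <= r -> primitive b (- r) = 0.
  by move=> r0; apply: primitive_le0; rewrite oppr_le0.
move=> z r s; have [r0|/ltW r0] := leP 0 r; have [s0|/ltW s0] := leP 0 s.
- rewrite (zn _ _ r0) (zn _ _ s0) !addr0.
  have [rs|/ltW sr] := leP r s.
    by have /andP[] := bA z _ _ r0 rs; lra.
  by have /andP[] := bA z _ _ s0 sr; lra.
- rewrite (zn _ _ r0) (primitive_le0 _ s0) addr0 add0r.
  have /andP[_] := bA z _ _ (lexx 0) r0; rewrite z0 !subr0.
  have := mulr_ge0 (A_ge0 z r0) (_ : 0 <= - s); rewrite oppr_ge0 => /(_ s0).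
  by have := pAm z (- s); lra.
- have nr0 : 0 <= - r by rewrite oppr_ge0.
  rewrite (zn _ _ s0) (primitive_le0 _ r0) addr0 add0r.
  have /andP[_] := bAm z _ _ (lexx 0) nr0; rewrite z0 !subr0.
  have := mulr_ge0 (Am_ge0 z nr0) s0; rewrite /Am opprK.
  by have := pA z s; lra.
have nr0 : 0 <= - r by rewrite oppr_ge0.
have ns0 : 0 <= - s by rewrite oppr_ge0.
rewrite (primitive_le0 _ r0) (primitive_le0 _ s0) !add0r.
have [rs|/ltW sr] := leP r s.
  have sr : - s <= - r by rewrite lerN2.
  by have /andP[_] := bAm z _ _ ns0 sr; rewrite /Am opprK; lra.
have rs : - r <= - s by rewrite lerN2.
by have /andP[+ _] := bAm z _ _ nr0 rs; rewrite /Am opprK; lra.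
Qed.

End potential.

Section caratheodory.
Context d (S : measurableType d) (R : realType) (A : S -> R -> R).
Local Open Scope ring_scope.

Let grid n (r : R) : R := (Num.floor (r * n.+1%:R))%:~R / n.+1%:R.

Let grid_cvg r : grid n r @[n --> \oo] --> r.
Proof.
apply/cvgrPdist_le => e e0; near=> n.
have n0 : 0 < n.+1%:R :> R by rewrite ltr0n.
have h1 := floor_le_tmp (r * n.+1%:R); have h2 := floorD1_gt (r * n.+1%:R).
rewrite intrD1 in h2.
have -> : r - grid n r = (r * n.+1%:R - (Num.floor (r * n.+1%:R))%:~R) / n.+1%:R.
  by rewrite /grid mulrBl mulfK// gt_eqF.
rewrite ger0_norm; last by apply: divr_ge0; rewrite ?ler0n// subr_ge0.
apply: (@le_trans _ _ (n.+1%:R^-1)).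
  by rewrite ler_pdivrMr// mulVf ?gt_eqF//; lra.
by apply/ltW; near: n; exact: near_infty_natSinv_lt (PosNum e0).
Unshelve. all: by end_near. Qed.

(** Rounding the second variable down to the grid of step [1/(n+1)] gives functions that converge to
    [A] by continuity. On the strip between two consecutive grid points the rounded function is [A]
    at a single rational. *)
Lemma caratheodory_measurable :
  (forall q : rat, measurable_fun setT (A^~ (ratr q))) ->
  (forall z, continuous (A z)) ->
  measurable_fun setT (fun t : S * R => A t.1 t.2).
Proof.
move=> mA cA.
apply: (@measurable_fun_cvg _ _ _ _ (fun n t => A t.1 (grid n t.2))); last first.
  move=> t _; apply: (@cvg_comp _ _ _ (grid^~ t.2) (A t.1)); first exact: grid_cvg.
  exact: cA.
move=> n mT B mB; rewrite setTI.
pose q (i : int) : rat := i%:~R / n.+1%:R.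
have qE i : ratr (q i) = i%:~R / n.+1%:R :> R.
  by rewrite /q rmorphM/= fmorphV/= ratr_int ratr_nat.
pose cell (i : int) : set (S * R) := [set t | A t.1 (ratr (q i)) \in B /\
  i%:~R <= t.2 * n.+1%:R < (i + 1)%:~R].
rewrite (_ : _ @^-1` B = \bigcup_i cell i).
  apply: countable_bigcupT_measurable => // i.
  rewrite (_ : cell i = [set t | A t.1 (ratr (q i)) \in B] `&`
      ([set t | i%:~R <= t.2 * n.+1%:R] `&` [set t | t.2 * n.+1%:R < (i + 1)%:~R])).
    apply: measurableI.
      rewrite -[X in measurable X]setTI.
      rewrite (_ : [set t | _] = (fun t : S * R => A t.1 (ratr (q i))) @^-1` B).
        by apply: (measurableT_comp (mA (q i)) measurable_fst).
      by apply/seteqP; split => t /=; rewrite inE.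
    have m2 : measurable_fun setT (fun t : S * R => t.2 * n.+1%:R).
      by apply: measurable_funM.
    apply: measurableI; first by rewrite -[X in measurable X]setTI; exact: measurable_fun_le.
    rewrite (_ : [set t | _] = ~` [set t : S * R | (i + 1)%:~R <= t.2 * n.+1%:R]).
      by apply: measurableC; rewrite -[X in measurable X]setTI; exact: measurable_fun_le.
    by apply/seteqP; split => t /=; rewrite ltNge => /negP.
  by apply/seteqP; split => t /=; [move=> [? /andP[]]|move=> [? [/= h1 h2]]; split; rewrite ?h1].
apply/seteqP; split => t /=.
  move=> Bt; exists (Num.floor (t.2 * n.+1%:R)) => //; split.
    by apply/mem_set; rewrite qE.
  by rewrite floor_le_tmp floorD1_gt.
move=> [i _ [/set_mem Bi /floor_def fi]].
by rewrite /grid fi -qE.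
Qed.

End caratheodory.

(** * Pointwise version of the coefficient on a symmetric set *)

Section flux.
Context d (T : measurableType d) (R : realType).
Local Open Scope ring_scope.

(* Only weak monotonicity can be required on all of T * T, the flux being 0 off
   G. *)
Record flux (G : set (T * T)) (p c C : R) (A : T * T -> R -> R) : Prop := Flux {
  flux_measurable : measurable_fun setT (fun t : (T * T) * R => A t.1 t.2);
  flux_continuous : forall z, continuous (A z);
  flux_anti : forall z r, A z r = - A (swap_pair z) (- r);
  flux_mono : forall z r s, 0 <= (A z r - A z s) * (r - s);
  flux_growth : forall z r, `|A z r| <= C * (1 + `|r| `^ (p - 1));
  flux_coercive : forall z r, G z -> c * `|r| `^ p <= A z r * r;
  flux_off : forall z r, ~ G z -> A z r = 0
}.

Variables (nu : {measure set T -> \bar R}) (k : R.-pker T ~> T).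
Local Notation mu := (kernel_prod nu k).
Hypothesis rev : forall A : set (T * T), measurable A ->
  mu A = mu [set z | A (z.2, z.1)].

(** All the conditions, together with the Borel versions at rational arguments, hold off one null
    set. That set is removed along with its transpose: this keeps [G] symmetric, and reversibility
    keeps what is removed null. Continuity then recovers joint measurability from the rational
    arguments. *)
Lemma exists_flux (a : T -> T -> R -> R) (p c C : R) (Q : set (T * T)) :
  0 < c -> 0 < C ->
  (forall r : R, completed_measurable_fun mu setT (fun z : T * T => a z.1 z.2 r)) ->
  (\forall z \ae mu, continuous (a z.1 z.2)) ->
  (\forall z \ae mu, forall r, a z.1 z.2 r = - a z.2 z.1 (- r)) ->
  (\forall z \ae mu, forall r s, r != s -> 0 < (a z.1 z.2 r - a z.1 z.2 s) * (r - s)) ->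
  (\forall z \ae mu, forall r, `|a z.1 z.2 r| <= C * (1 + `|r| `^ (p - 1))) ->
  (\forall z \ae mu, forall r, c * `|r| `^ p <= a z.1 z.2 r * r) ->
  measurable Q -> (forall z, Q z -> Q (swap_pair z)) ->
  exists G A, [/\ measurable G, G `<=` Q /\ (forall z, G z -> G (swap_pair z)),
    flux G p c C A, (\forall z \ae mu, Q z -> G z) &
    forall z r, G z -> A z r = a z.1 z.2 r].
Proof.
move=> c0 C0 ma h1 h2 h3 h4 h5 mQ Qs.
have /choice[f fP] (q : rat) : exists g : T * T -> R, measurable_fun setT g /\
    \forall z \ae mu, a z.1 z.2 (ratr q) = g z.
  have [g mg ag] := (completed_measurable_funP _
    ((completed_algebra_genP mu setT).2 (ex_intro2 _ _ setT measurableT (aeW _ (fun=> iff_refl _))))).1 (ma (ratr q)).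
  by exists g; split => //; apply: filterS ag => z; rewrite patchE in_setT.
have /ae_forall_countable af q := (fP q).2.
pose H z := [/\ continuous (a z.1 z.2), (forall r, a z.1 z.2 r = - a z.2 z.1 (- r)),
  (forall r s, r != s -> 0 < (a z.1 z.2 r - a z.1 z.2 s) * (r - s)),
  (forall r, `|a z.1 z.2 r| <= C * (1 + `|r| `^ (p - 1))) /\
  (forall r, c * `|r| `^ p <= a z.1 z.2 r * r) &
  forall q, a z.1 z.2 (ratr q) = f q z].
have aH : \forall z \ae mu, H z.
  near=> z; split.
  - by near: z.
  - by near: z.
  - by near: z.
  - by split; near: z.
  - by near: z.
have [N [mN N0 HN]] := ae_measurable_cover (filterS2 _ (fun z h1 h2 => conj h1 h2)
  aH (ae_kernel_prod_swap rev aH)).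
have msw : measurable_fun setT (@swap_pair T T) by exact: measurable_swap.
pose N' := N `|` swap_pair @^-1` N.
have mN' : measurable N'.
  by apply: measurableU => //; rewrite -[X in measurable X]setTI; exact: msw.
pose G := Q `\` N'.
have Gs z : G z -> G (swap_pair z).
  move=> [Qz nz]; split; first exact: Qs.
  by case: z {Qz} nz => x y /= nz [?|?]; apply: nz; [right|left].
have GH z : G z -> H z.
  by move=> [_ nz]; apply: (HN z _).1 => Nz; apply: nz; left.
have Gdec z : {G z} + {~ G z} by exact: pselect.
exists G, (fun z r => if z \in G then a z.1 z.2 r else 0).
have mG : measurable G by exact: measurableD.
have cA z : continuous (fun r => if z \in G then a z.1 z.2 r else 0).
  case: (boolP (z \in G)) => [/set_mem/GH[]//|_]; exact: cst_continuous.
split => //.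
- by split => // z [].
- split.
  + apply: (@caratheodory_measurable _ _ _
      (fun z r => if z \in G then a z.1 z.2 r else 0)).
      move=> q; apply: (eq_measurable_fun (fun z => \1_G z * f q z)).
        move=> z _; rewrite indicE; case: ifPn => [/set_mem/GH[]//|_].
          by rewrite mul1r.
        by rewrite mul0r.
      apply: measurable_funM; last exact: (fP q).1.
      exact: measurable_indic.
    exact: cA.
  + exact: cA.
  + move=> z r; case: (boolP (z \in G)) => [/set_mem Gz|nGz].
      have [_ aa _ _ _] := GH _ Gz.
      by rewrite (mem_set (Gs _ Gz)) aa.
    have nGs : ~ G (swap_pair z).
      by move=> /Gs; case: z nGz => x y /negP nGz /mem_set.
    by rewrite (memNset nGs) oppr0.
  + move=> z r s; case: (boolP (z \in G)) => [/set_mem/GH[_ _ aa _ _]|_]; last by rewrite subrr mul0r.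
    by have [->|rs] := eqVneq r s; [rewrite !subrr mul0r|exact/ltW/aa].
  + move=> z r; case: (boolP (z \in G)) => [/set_mem/GH[_ _ _ [aa _] _]//|_].
    by rewrite normr0 mulr_ge0 ?addr_ge0 ?powR_ge0// ltW.
  + by move=> z r Gz; rewrite mem_set//; have [_ _ _ [_ aa] _] := GH _ Gz.
  + by move=> z r nGz; rewrite memNset.
- exists N'; split => //.
    have N'0 : (mu N' <= mu N + mu (swap_pair @^-1` N))%E.
      by apply: measureU2 => //; rewrite -[X in measurable X]setTI; exact: msw.
    apply/eqP; rewrite eq_le measure_ge0 andbT; apply: le_trans N'0 _.
    by rewrite -[X in (_ + X)%E](rev mN) [X in (X + _)%E]N0 [X in (_ + X)%E]N0 adde0.
  by move=> z /= nG; apply: contrapT => nN'; apply: nG => Qz; split.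
- by move=> z r Gz; rewrite mem_set.
Unshelve. all: by end_near. Qed.

End flux.

(** * Almost everywhere convergent minimising sequences *)

Section minimizing_sequence.
Context (R : realType) (V : Type) (P : set V) (mid : V -> V -> V).
Context (J F : V -> R) (v0 : V) (B M : R).
Local Open Scope ring_scope.
Hypothesis Pv0 : P v0.
Hypothesis Pmid : forall u v, P u -> P v -> P (mid u v).
Hypothesis Jmid : forall u v, P u -> P v -> J (mid u v) <= Num.max (J u) (J v).
Hypothesis JB : forall v, P v -> B <= J v.
Hypothesis F0 : forall v, P v -> 0 <= F v.
Hypothesis FM : forall v, P v -> J v <= J v0 + 1 -> F v <= M.

Let lev e := [set v | P v /\ forall v', P v' -> J v <= J v' + e].

Let lev_neq0 e : 0 < e -> lev e !=set0.
Proof.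
move=> e0.
have hJ : has_inf (J @` P).
  by split; [exists (J v0), v0|exists B => _ [v /JB ? <-]].
have [_ [v Pv <-] vE] := inf_adherent e0 hJ.
exists v; split => // v' Pv'; apply: le_trans (ltW vE) _.
by rewrite lerD2r; apply: inf_lbound; [case: hJ|exists v'].
Qed.

Let lev_mid e u v : lev e u -> lev e v -> lev e (mid u v).
Proof.
move=> [Pu uJ] [Pv vJ]; split; first exact: Pmid.
by move=> v' Pv'; apply: le_trans (Jmid Pu Pv) _; rewrite ge_max uJ// vJ.
Qed.

Let levS e e' : e <= e' -> lev e `<=` lev e'.
Proof.
by move=> ee' v [Pv vJ]; split => // v' Pv'; apply: le_trans (vJ _ Pv') _; rewrite lerD2l.
Qed.

(** As [e] decreases the sets [lev e] shrink and [s e] grows, up to a supremum kept finite by [M].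
    Near this supremum the infima of [F] on different levels almost agree. *)
Let s e := inf (F @` lev e).

Let hs e : 0 < e -> has_inf (F @` lev e).
Proof.
move=> e0; split; first by have [v lv] := lev_neq0 e0; exists (F v), v.
by exists 0 => _ [v [/F0 ? _] <-].
Qed.

Let s_le e v : 0 < e -> lev e v -> s e <= F v.
Proof. by move=> e0 lv; apply: inf_lbound; [have [] := hs e0|exists v]. Qed.

Let sup_s := [set s e | e in [set e | 0 < e <= 1]].

Let has_sup_s : has_sup sup_s.
Proof.
split; first by exists (s 1), 1 => //=; rewrite ltr01 lexx.
exists M => _ [e /= /andP[e0 e1] <-].
have [v lv] := lev_neq0 e0; apply: le_trans (s_le e0 lv) _.
have [Pv vJ] := lv; apply: FM => //; apply: le_trans (vJ _ Pv0) _.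
by rewrite lerD2l.
Qed.

(* Nearly minimising the strictly convex functional F over the sublevel sets of
   J makes the convexity defect of F along the sequence summable. *)
Lemma minimizing_sequence_small_defect : exists w : nat -> V,
  [/\ forall n, P (w n), forall n, J (w n) <= J v0 + 1,
    forall n v, P v -> J (w n) <= J v + n.+1%:R^-1 &
    forall n, (F (w n) + F (w n.+1)) / 2 - F (mid (w n) (w n.+1)) <= 4^-1 ^+ n].
Proof.
pose S := sup sup_s.
have q0 n : 0 < 4^-1 ^+ n / 2 :> R by rewrite divr_gt0// exprn_gt0// invr_gt0.
have /choice[e eP] n : exists e, [/\ 0 < e, e <= n.+1%:R^-1, e <= 1 &
    S - 4^-1 ^+ n / 2 < s e].
  have [_ [e /= /andP[e0 e1] <-] Se] := sup_adherent (q0 n) has_sup_s.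
  exists (Num.min e n.+1%:R^-1); split.
  - by rewrite lt_min e0 invr_gt0 ltr0n.
  - by rewrite ge_min lexx orbT.
  - by rewrite ge_min e1.
  - apply: lt_le_trans Se _.
    have m0 : 0 < Num.min e n.+1%:R^-1 by rewrite lt_min e0 invr_gt0 ltr0n.
    apply: lb_le_inf; first by have [] := hs m0.
    move=> _ [v lv <-]; apply: s_le => //; apply: levS lv.
    by rewrite ge_min lexx.
have /choice[w wP] n : exists w, lev (e n) w /\ F w < s (e n) + 4^-1 ^+ n / 2.
  have [e0 _ _ _] := eP n.
  by have [_ [v lv <-] Fv] := inf_adherent (q0 n) (hs e0); exists v.
have sS n : s (e n) <= S.
  have [e0 _ e1 _] := eP n.
  by apply: sup_upper_bound => //; exists (e n) => //=; rewrite e0.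
exists w; split.
- by move=> n; have [[]] := wP n.
- move=> n; have [[_ /(_ _ Pv0) Jw] _] := wP n; have [_ _ e1 _] := eP n.
  by apply: le_trans Jw _; rewrite lerD2l.
- move=> n v Pv; have [[_ /(_ _ Pv) Jw] _] := wP n; have [_ e1 _ _] := eP n.
  by apply: le_trans Jw _; rewrite lerD2l.
- move=> n; have [l1 f1] := wP n; have [l2 f2] := wP n.+1.
  have [e1 _ _ s1] := eP n; have [e2 _ _ s2] := eP n.+1.
  have q1 : 4^-1 ^+ n.+1 <= 4^-1 ^+ n :> R.
    by rewrite exprS ler_piMl ?exprn_ge0 ?invr_ge0// invf_le1 ?ler1n.
  (* Both points, hence their midpoint, lie in the larger of the two level sets, where [F] exceeds
     [S - 4^-n / 2]. At both points [F] is below [S + 4^-n / 2], so the defect is at most [4^-n]. *)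
  have [ee|/ltW ee] := leP (e n) (e n.+1).
    have := s_le e2 (lev_mid (levS ee l1) l2).
    by have := sS n; have := sS n.+1; lra.
  have := s_le e1 (lev_mid l1 (levS ee l2)).
  by have := sS n; have := sS n.+1; lra.
Qed.

End minimizing_sequence.

(** * Quantitative strict convexity of the square root integrand *)

Section hyperbolic_convexity.
Context (R : realType).
Local Open Scope ring_scope.
Implicit Types r s : R.

(** For [r = sinh t] these two functions are [cosh t] and [tanh t]. [tanhyp] is the derivative of
    [hyp] and a bijection onto the open interval from -1 to 1. *)
Definition hyp r : R := Num.sqrt (1 + r ^+ 2).
Definition tanhyp r : R := r / hyp r.

Lemma sqr_hyp r : hyp r ^+ 2 = 1 + r ^+ 2.
Proof. by rewrite sqr_sqrtr// addr_ge0// sqr_ge0. Qed.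

Lemma hyp_ge1 r : 1 <= hyp r.
Proof. by rewrite -[leLHS]sqrtr1 ler_wsqrtr// lerDl sqr_ge0. Qed.

Lemma hyp_gt0 r : 0 < hyp r.
Proof. exact: lt_le_trans (hyp_ge1 r). Qed.

Lemma hyp_le r : hyp r <= 1 + `|r|.
Proof.
rewrite -[leRHS]ger0_norm ?addr_ge0// -sqrtr_sqr ler_wsqrtr//.
by rewrite -[r ^+ 2]real_normK ?num_real//; have := normr_ge0 r; nra.
Qed.

Lemma sqr_tanhyp r : tanhyp r ^+ 2 = 1 - (hyp r ^+ 2)^-1.
Proof.
rewrite /tanhyp expr_div_n sqr_hyp.
have : 1 + r ^+ 2 != 0 by rewrite gt_eqF// ltr_pwDl ?sqr_ge0.
by move=> h; field.
Qed.

(** Let [a], [b], [m] be the values of [hyp] at [r], [s] and the midpoint, [x] the squared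
    difference, and [D = a b - 1 - r s]. Since [((a + b)/2)^2 - m^2 = D/2], the defect is [D/2]
    divided by [(a + b)/2 + m], which is at most [a + b]. From [1/a^2 + 1/b^2 >= 2/(a b)] one gets
    [a b x <= 2 D], and [(a + b)/2 <= a b] because [a, b >= 1]; the constant 1/8 results. *)
Lemma hyp_midpoint_defect r s :
  (tanhyp r - tanhyp s) ^+ 2 / 8 <= (hyp r + hyp s) / 2 - hyp ((r + s) / 2).
Proof.
set a := hyp r; set b := hyp s; set m := hyp _.
have a1 : 1 <= a := hyp_ge1 r; have b1 : 1 <= b := hyp_ge1 s.
have m1 : 1 <= m := hyp_ge1 _.
have a2 : a ^+ 2 = 1 + r ^+ 2 := sqr_hyp r.
have b2 : b ^+ 2 = 1 + s ^+ 2 := sqr_hyp s.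
have m2 : m ^+ 2 = 1 + ((r + s) / 2) ^+ 2 := sqr_hyp _.
have ab0 : 0 < a * b by apply: mulr_gt0; lra.
pose D := a * b - 1 - r * s.
pose x := (tanhyp r - tanhyp s) ^+ 2.
have x0 : 0 <= x := sqr_ge0 _.
have hx : a * b * x <= 2 * D.
  have -> : x = 2 - (a ^+ 2)^-1 - (b ^+ 2)^-1 - 2 * (r * s) / (a * b).
    rewrite /x sqrrB !sqr_tanhyp -/a -/b /tanhyp -/a -/b.
    by field; rewrite !gt_eqF//; lra.
  have : 2 / (a * b) <= (a ^+ 2)^-1 + (b ^+ 2)^-1.
    have := sqr_ge0 (a^-1 - b^-1); rewrite sqrrB !exprVn -invfM => h.
    by rewrite -mulr_natl in h; lra.
  rewrite /D => h; have := ler_wpM2l (ltW ab0) h.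
  have -> : a * b * (2 / (a * b)) = 2 by field; rewrite !gt_eqF//; lra.
  have -> : a * b * (2 - (a ^+ 2)^-1 - (b ^+ 2)^-1 - 2 * (r * s) / (a * b)) =
    2 * (a * b) - a * b * ((a ^+ 2)^-1 + (b ^+ 2)^-1) - 2 * (r * s).
    by field; rewrite !gt_eqF//; lra.
  by lra.
have D0 : 0 <= D by have := mulr_ge0 (ltW ab0) x0; lra.
have mD : ((a + b) / 2 - m) * ((a + b) / 2 + m) = D / 2.
  by rewrite -subr_sqr m2 /D !expr_div_n sqrrD a2 b2; field.
have hm : m <= (a + b) / 2.
  rewrite -subr_ge0 -(pmulr_lge0 _ (_ : 0 < (a + b) / 2 + m)); last by lra.
  by rewrite mD divr_ge0.
have := ler_wpM2r x0 (_ : (a + b) / 2 <= a * b).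
have -> : (a + b) / 2 <= a * b by nra.
move=> /(_ isT) h1.
rewrite -/x.
have ab' : 0 < a + b by lra.
rewrite -(ler_pM2r ab'); apply: (@le_trans _ _ (D / 2)); first by lra.
rewrite -mD ler_wpM2l; lra.
Qed.

(** A bound on infinitely many terms suffices: it forces the limit [l] of [tanhyp] to satisfy
    [l^2 <= 1 - 1/(1 + b^2) < 1], and the inverse map [l / sqrt (1 - l^2)] is continuous there. *)
Lemma cvg_tanhyp (x : nat -> R) (b : R) :
  cvgn (tanhyp \o x) -> (forall N, exists2 n, (N <= n)%N & `|x n| <= b) -> cvgn x.
Proof.
move=> /cvg_ex[l hl] xb.
have tb y : `|y| <= b -> tanhyp y ^+ 2 <= 1 - (1 + b ^+ 2)^-1.
  move=> yb; rewrite sqr_tanhyp sqr_hyp lerD2l lerN2 lef_pV2 ?posrE ?ltr_pwDl ?sqr_ge0//.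
  by rewrite lerD2l -[y ^+ 2]real_normK ?num_real// lerXn2r ?nnegrE// (le_trans _ yb).
have l2 : l ^+ 2 <= 1 - (1 + b ^+ 2)^-1.
  have h2 : (tanhyp (x n)) ^+ 2 @[n --> \oo] --> l ^+ 2.
    by rewrite (_ : (fun _ => _) = (fun n => tanhyp (x n) * tanhyp (x n))); [exact: cvgM|apply/funext => n; rewrite expr2].
  rewrite leNgt; apply/negP => lb.
  have [N _ NP] : \forall n \near \oo, 1 - (1 + b ^+ 2)^-1 < tanhyp (x n) ^+ 2.
    exact: (cvgr_gt _ h2).
  have [n Nn /tb] := xb N; by rewrite leNgt (NP n Nn).
have l1 : 0 < 1 - l ^+ 2.
  have : 0 < (1 + b ^+ 2)^-1 by rewrite invr_gt0 ltr_pwDl ?sqr_ge0.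
  by lra.
have xE y : y = tanhyp y / Num.sqrt (1 - tanhyp y ^+ 2).
  rewrite sqr_tanhyp opprB addrC subrK sqrtrV ?sqr_ge0// sqrtr_sqr.
  by rewrite ger0_norm ?(ltW (hyp_gt0 _))// invrK /tanhyp divfK// gt_eqF ?hyp_gt0.
apply/cvg_ex; exists (l / Num.sqrt (1 - l ^+ 2)).
rewrite (_ : x = (fun n => tanhyp (x n) / Num.sqrt (1 - tanhyp (x n) ^+ 2))); last first.
  by apply/funext => n; exact: xE.
apply: cvgM => //; apply: cvgV; first by rewrite gt_eqF// sqrtr_gt0.
apply: (@cvg_comp _ _ _ (fun n => 1 - tanhyp (x n) ^+ 2) Num.sqrt); last first.
  exact: sqrt_continuous.
apply: cvgB; first exact: cvg_cst.
by rewrite (_ : (fun _ => _) = (fun n => tanhyp (x n) * tanhyp (x n))); [exact: cvgM|apply/funext => n; rewrite expr2].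
Qed.

End hyperbolic_convexity.

Section defect_cvg.
Context d (T : measurableType d) (R : realType).
Variables (nu : {measure set T -> \bar R}) (K : set T).
Hypothesis mK : measurable K.
Hypothesis nuK : nu K < +oo.

Lemma nneseries_lty_is_cvg (f : nat -> R) : (forall n, 0 <= f n)%R ->
  \sum_(n <oo) (f n)%:E < +oo -> cvgn (series f).
Proof.
move=> f0 fy; apply: nondecreasing_is_cvgn.
  by apply: nondecreasing_series => n _ _; exact: f0.
have ffin : \sum_(n <oo) (f n)%:E \is a fin_num.
  by rewrite ge0_fin_numE// nneseries_ge0// => n _ _; rewrite lee_fin.
exists (fine (\sum_(n <oo) (f n)%:E)) => _ [n _ <-].
rewrite -lee_fin fineK// seriesEnat/= -sumEFin.
by apply: nneseries_lim_ge => k _; rewrite lee_fin.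
Qed.

Lemma hyp_measurable : measurable_fun setT (@hyp R).
Proof.
apply: continuous_measurable_fun => x.
apply: (@cvg_comp _ _ _ (fun y : R => 1 + y ^+ 2)%R Num.sqrt); last exact: sqrt_continuous.
by apply: cvgD; [exact: cvg_cst|exact: exprn_continuous].
Qed.

Lemma tanhyp_measurable : measurable_fun setT (@tanhyp R).
Proof.
apply: continuous_measurable_fun => x; apply: cvgM => //; apply: cvgV.
  by rewrite gt_eqF ?hyp_gt0.
apply: (@cvg_comp _ _ _ (fun y : R => 1 + y ^+ 2)%R Num.sqrt); last exact: sqrt_continuous.
by apply: cvgD; [exact: cvg_cst|exact: exprn_continuous].
Qed.

Lemma normr_powR_continuous (p : R) : (1 <= p)%R ->
  continuous (fun x : R => `|x| `^ p)%R.
Proof.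
move=> p1 x; have [->|x0] := eqVneq x 0%R; last first.
  have ax : `|x|%R \in `]0%R, +oo[ by rewrite in_itv/= normr_gt0 x0.
  apply: (@cvg_comp _ _ _ (fun y : R => `|y|%R) (@powR R ^~ p)).
    exact: (@norm_continuous _ R).
  have /derivable1_diffP/differentiable_continuous := @derivable_powR R 1%R p _ ax.
  exact.
apply/cvgrPdist_le => e e0; near=> y.
rewrite normr0 powR0 ?gt_eqF ?(lt_le_trans _ p1)// sub0r normrN ger0_norm ?powR_ge0//.
have y1 : (`|y| <= Num.min 1 e)%R.
  near: y; apply/nbhs_ballP; exists (Num.min 1 e)%R => /=.
    by rewrite lt_min ltr01 e0.
  by move=> y /=; rewrite /ball/= sub0r normrN => /ltW.
move: y1; rewrite le_min => /andP[y1 ye]; apply: le_trans ye.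
have [->|y0] := eqVneq y 0%R; first by rewrite normr0 powR0// gt_eqF ?(lt_le_trans _ p1).
by apply: ge1r_powR => //; rewrite normr_gt0 y0.
Unshelve. all: by end_near. Qed.

Lemma einfs_le_limn_einf (u : (\bar R)^nat) n : einfs u n <= limn_einf u.
Proof.
rewrite limn_einf_lim (cvg_lim _ (@cvg_einfs_sup _ u))//.
by apply: ereal_sup_ubound; exists n.
Qed.

Lemma limn_einf_lty_bound (f : nat -> R) : limn_einf (EFin \o f) < +oo ->
  exists B, forall N, exists2 n, (N <= n)%N & (f n <= B)%R.
Proof.
move=> fy.
have [B fB] : exists B, limn_einf (EFin \o f) < B%:E.
  case: limn_einf fy => [r _| //|_]; last by exists 0%R; rewrite ltNyr.
  by exists (r + 1)%R; rewrite lte_fin ltrDl.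
exists B => N; apply: contrapT => h; move: fB; apply/negP; rewrite -leNgt.
apply: le_trans (einfs_le_limn_einf _ N).
apply: le_ereal_inf_tmp => _ [n /= Nn <-]; rewrite lee_fin leNgt.
by apply/negP => /ltW fB; apply: h; exists n.
Qed.

Lemma fatou_le d' (T' : measurableType d') (m : {measure set T' -> \bar R})
    (f : nat -> T' -> \bar R) (M : \bar R) :
  (forall n, measurable_fun setT (f n)) -> (forall n x, 0 <= f n x) ->
  (forall n, \int[m]_x f n x <= M) -> \int[m]_x limn_einf (f^~ x) <= M.
Proof.
move=> mf f0 fM; apply: le_trans (fatou _ _ _ _) _ => //.
rewrite limn_einf_lim; apply: lime_le; first exact: is_cvg_einfs.
apply: nearW => n; apply: le_trans (fM n).
by apply: ereal_inf_lbound; exists n => /=.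
Qed.

(* The inequality t <= 2^-n + 2^n t^2 makes the differences of tanhyp summable;
   the bound in L^p keeps the limit of tanhyp (w n x) away from +-1, where tanhyp
   cannot be inverted. *)
Lemma ae_cvg_small_defect (w : nat -> T -> R) (p c M : R) : (1 <= p)%R ->
  (forall n, measurable_fun setT (w n)) ->
  (forall n x, ~ K x -> w n x = 0%R) ->
  (forall n, \int[nu]_x (((tanhyp (w n x) - tanhyp (w n.+1 x)) ^+ 2)%R)%:E
     <= (c * 4^-1 ^+ n)%:E) ->
  (forall n, \int[nu]_x (`|w n x| `^ p)%:E <= M%:E) ->
  exists u : T -> R, [/\ measurable_fun setT u, forall x, ~ K x -> u x = 0%R,
    \forall x \ae nu, w^~ x @ \oo --> u x &
    \int[nu]_x (`|u x| `^ p)%:E <= M%:E].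
Proof.
move=> p1 mw w0 defect wM.
pose f n x : R := `|tanhyp (w n x) - tanhyp (w n.+1 x)|%R.
have mt n : measurable_fun setT (@tanhyp R \o w n).
  by apply: measurableT_comp => //; exact: tanhyp_measurable.
have mf n : measurable_fun setT (f n).
  by apply: measurableT_comp => //; exact: (measurable_funB (mt n) (mt n.+1)).
have f0 n x : 0 <= (f n x)%:E by rewrite lee_fin normr_ge0.
have fint n : \int[nu]_x (f n x)%:E <= ((fine (nu K) + c) / 2 ^+ n)%:E.
  apply: (@le_trans _ _ (\int[nu]_x ((2^-1 ^+ n)%:E * (\1_K x)%:E +
      (2 ^+ n)%:E * ((tanhyp (w n x) - tanhyp (w n.+1 x)) ^+ 2)%:E))).
    apply: ge0_le_integral => //.
    - exact/measurable_EFinP/mf.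
    - apply/measurable_EFinP; apply: measurable_funD; apply: measurable_funM => //.
      by apply: measurable_funX; exact: (measurable_funB (mt n) (mt n.+1)).
    - move=> x _; rewrite -!EFinM -EFinD lee_fin.
      have [Kx|nKx] := pselect (K x); last first.
        rewrite /f !w0// subrr normr0.
        by apply: addr_ge0; apply: mulr_ge0; rewrite ?sqr_ge0 ?exprn_ge0 ?invr_ge0.
      rewrite indicE mem_set// mulr1 /f -(real_normK (num_real (_ - _)))//.
      set t := `|_|%R; have t0 : (0 <= t)%R by exact: normr_ge0.
      have e0 : (0 < 2 ^+ n :> R)%R by rewrite exprn_gt0.
      rewrite exprVn -(ler_pM2r e0) mulrDl mulVf ?gt_eqF//.
      by set y := (2 ^+ n)%R; have := sqr_ge0 (1 - y * t)%R; nra.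
  have mD : measurable_fun setT
      (fun x => ((tanhyp (w n x) - tanhyp (w n.+1 x)) ^+ 2)%:E).
    by apply/measurable_EFinP/measurable_funX; exact: (measurable_funB (mt n) (mt n.+1)).
  have mI : measurable_fun setT (fun x => (\1_K x)%:E : \bar R).
    exact/measurable_EFinP/measurable_indic.
  have q0 : (0 <= 2^-1 ^+ n :> R)%R by rewrite exprn_ge0// invr_ge0.
  have q1 : (0 <= 2 ^+ n :> R)%R by rewrite exprn_ge0.
  rewrite ge0_integralD//; try by [exact: measurable_funeM|
    move=> x _; rewrite mule_ge0 ?lee_fin ?sqr_ge0].
  rewrite !ge0_integralZl_EFin//; last by move=> x _; rewrite lee_fin sqr_ge0.
  rewrite integral_indic// setIT.
  have /fineK <- : nu K \is a fin_num by rewrite ge0_fin_numE.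
  apply: le_trans (leeD2l _ (lee_wpmul2l _ (defect n))) _.
    by rewrite lee_fin exprn_ge0.
  rewrite -!EFinM -EFinD lee_fin (_ : 4^-1 = 2^-1 * 2^-1 :> R)%R; last by field.
  rewrite exprMn !exprVn le_eqVlt; apply/orP; left; apply/eqP.
  by field; rewrite expf_neq0.
have c0 : (0 <= c)%R.
  have := defect 0%N; rewrite expr0 mulr1 -lee_fin; apply: le_trans.
  by apply: integral_ge0 => x _; rewrite lee_fin sqr_ge0.
have sumf : \sum_(n <oo) \int[nu]_x (f n x)%:E < +oo.
  have e0 : (0 <= 2 * (fine (nu K) + c))%R by rewrite mulr_ge0// addr_ge0// fine_ge0.
  apply: le_lt_trans (le_trans _ (epsilon_trick0 xpredT e0)) (ltry _).
  apply: lee_nneseries => [n _ _|n _].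
    by apply: integral_ge0 => x _; exact: f0.
  apply: le_trans (fint n) _; rewrite lee_fin natrX exprS -mulf_div divff// mul1r.
  exact: lexx.
have : nu.-integrable setT (fun x => \sum_(n <oo) (f n x)%:E).
  apply/integrableP; split.
    apply: ge0_emeasurable_sum => [n x _ _|n _]; first exact: f0.
    exact/measurable_EFinP/mf.
  under eq_integral do rewrite gee0_abs ?nneseries_ge0//.
  rewrite integral_nneseries//.
    by move=> n; exact/measurable_EFinP/mf.
move=> /(integrable_ae measurableT) aef.
have mwp n : measurable_fun setT (fun x => (`|w n x| `^ p)%:E).
  apply/measurable_EFinP; apply: (measurableT_comp (measurable_powR _)).
  exact: measurableT_comp.
have wp0 n x : 0 <= (`|w n x| `^ p)%:E by rewrite lee_fin powR_ge0.
have liminf0 x : 0 <= limn_einf (fun n => (`|w n x| `^ p)%:E).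
  apply: le_trans (einfs_le_limn_einf _ 0%N).
  by apply: le_ereal_inf_tmp => _ [n _ <-].
(* Fatou's lemma bounds only the lower limit, that is, infinitely many terms at almost every point,
   which is the form [cvg_tanhyp] asks for. *)
have aeinf : \forall x \ae nu, limn_einf (fun n => (`|w n x| `^ p)%:E) < +oo.
  have : nu.-integrable setT (fun x => limn_einf (fun n => (`|w n x| `^ p)%:E)).
    apply/integrableP; split.
      apply: measurableT_comp => //; apply: measurable_fun_limn_esup => n.
      exact: measurableT_comp.
    under eq_integral do rewrite gee0_abs//.
    by apply: le_lt_trans (fatou_le mwp wp0 wM) (ltry _).
  move=> /(integrable_ae measurableT); apply: filterS => x /(_ I) fx.
  by rewrite ltey_eq fx.
have aecvg : \forall x \ae nu, cvgn (w^~ x).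
  apply: filterS2 aef aeinf => x /(_ I) fx /limn_einf_lty_bound[B wB].
  (* The bound [B] is on [|w n x| ^ p]; when [|w n x| > 1] this power dominates [|w n x|], whence
     the maximum with 1. *)
  apply: (@cvg_tanhyp _ _ (Num.max 1 B)%R).
    have : cvgn (series (telescope (fun n => tanhyp (w n x)))).
      apply: normed_cvg.
      have -> : [normed series (telescope (fun n => tanhyp (w n x)))] = series (f^~ x).
        by apply/funext => n; apply: eq_bigr => i _; rewrite /f distrC.
      apply: nneseries_lty_is_cvg; first by move=> n; exact: normr_ge0.
      by rewrite ltey_eq fx.
    rewrite telescopeK => cv.
    rewrite (_ : _ \o _ = (fun n => (tanhyp (w n x) - tanhyp (w 0%N x)) + tanhyp (w 0%N x))%R).
      by apply: is_cvgD => //; exact: is_cvg_cst.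
    by apply/funext => n /=; rewrite subrK.
  move=> N; have [n Nn wn] := wB N; exists n => //.
  rewrite le_max; have [//|h] := leP `|w n x|%R 1%R.
  by rewrite (le_trans _ wn) ?orbT// le1r_powR// ltW.
have [C [mC C0 wC]] := ae_measurable_cover aecvg.
(* Multiplying by the indicator of the complement of [C] makes the sequence converge at every point,
   so its limit is measurable and still vanishes off [K]. *)
pose w' n x := ((\1_(~` C) x : R) * w n x)%R.
have w'cvg x : w'^~ x @ \oo --> limn (w'^~ x).
  have [Cx|nCx] := pselect (C x).
    by rewrite /w' indicE memNset//=; under eq_fun do rewrite mul0r; exact: is_cvg_cst.
  by rewrite /w' indicE mem_set//=; under eq_fun do rewrite mul1r; exact: wC.
have mw' n : measurable_fun setT (w' n).
  by apply: measurable_funM => //; apply: measurable_indic; exact: measurableC.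
have aeu : \forall x \ae nu, w^~ x @ \oo --> limn (w'^~ x).
  exists C; split => // x /= h; apply: contrapT => nCx; apply: h.
  have := w'cvg x; rewrite /w' indicE mem_set//=.
  by under eq_fun do rewrite mul1r.
exists (fun x => limn (w'^~ x)); split => //.
- by apply: (measurable_fun_cvg mw') => x _; exact: w'cvg.
- move=> x nKx; rewrite /w'; under eq_fun do rewrite w0// mulr0.
  by apply/cvg_lim => //; exact: cvg_cst.
- apply: le_trans (fatou_le mwp wp0 wM).
  rewrite (@Defs.integral_ae_eq _ _ _ _ _ _ (fun x => limn_einf (fun n => (`|w n x| `^ p)%:E)))//.
  apply: filterS aeu => x wu _; apply/esym.
  have cv : (`|w n x| `^ p)%:E @[n --> \oo] --> (`|limn (w'^~ x)| `^ p)%:E.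
    apply/fine_cvgP; split; first exact: nearW.
    apply: (@cvg_comp _ _ _ (w^~ x) (fun y => `|y| `^ p)%R _ _ _ wu).
    exact: normr_powR_continuous.
  by rewrite is_cvg_limn_einfE; [exact: cvg_lim|apply/cvg_ex; eexists; exact: cv].
Qed.

End defect_cvg.

(** * Real integrals and power estimates *)

Section real_integrable.
Context d (S : measurableType d) (R : realType) (m : {measure set S -> \bar R}).
Local Open Scope ring_scope.

Implicit Types (f g : S -> R).

Definition rintegrable f := m.-integrable setT (EFin \o f).

Lemma rintegrable_measurable f : rintegrable f -> measurable_fun setT f.
Proof. by move=> fi; apply/measurable_EFinP; exact: (measurable_int m fi). Qed.

Lemma rintegrableD f g : rintegrable f -> rintegrable g ->
  rintegrable (fun x => f x + g x).
Proof. by move=> fi gi; exact: (integrableD measurableT fi gi). Qed.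

Lemma rintegrableB f g : rintegrable f -> rintegrable g ->
  rintegrable (fun x => f x - g x).
Proof. by move=> fi gi; exact: (integrableB measurableT fi gi). Qed.

Lemma rintegrableZ r f : rintegrable f -> rintegrable (fun x => r * f x).
Proof. by move=> fi; exact: (integrableZl measurableT r fi). Qed.

Lemma rintegrable_le f g : measurable_fun setT f -> rintegrable g ->
  (forall x, `|f x| <= g x) -> rintegrable f.
Proof.
move=> mf gi fg; apply: (@le_integrable _ _ _ _ _ measurableT _ (EFin \o g)) => //.
  exact/measurable_EFinP.
by move=> x _ /=; rewrite lee_fin (le_trans (fg x))// ler_norm.
Qed.

Lemma rintegrable_ge0 f : measurable_fun setT f -> (forall x, 0 <= f x) ->
  (\int[m]_x (f x)%:E < +oo)%E -> rintegrable f.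
Proof.
move=> mf f0 fy; apply/integrableP; split; first exact/measurable_EFinP.
by under eq_integral do rewrite /= ger0_norm//.
Qed.

Lemma rintegrable_indic (K : set S) : measurable K -> (m K < +oo)%E ->
  rintegrable (\1_K : S -> R).
Proof.
move=> mK Ky; apply: rintegrable_ge0 => //.
by rewrite integral_indic// setIT.
Qed.

Lemma EFin_Rintegral f : rintegrable f ->
  (\int[m]_x (f x)%:E)%E = (\int[m]_x f x)%:E.
Proof. by move=> fi; rewrite /Rintegral fineK//; exact: integrable_fin_num. Qed.

Lemma RintegralDT f g : rintegrable f -> rintegrable g ->
  \int[m]_x (f x + g x) = \int[m]_x f x + \int[m]_x g x.
Proof. exact: RintegralD. Qed.

Lemma RintegralBT f g : rintegrable f -> rintegrable g ->
  \int[m]_x (f x - g x) = \int[m]_x f x - \int[m]_x g x.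
Proof. exact: RintegralB. Qed.

Lemma RintegralZT r f : rintegrable f -> \int[m]_x (r * f x) = r * \int[m]_x f x.
Proof. by move=> fi; exact: RintegralZl. Qed.

Lemma le_RintegralT f g : rintegrable f -> rintegrable g ->
  (forall x, f x <= g x) -> \int[m]_x f x <= \int[m]_x g x.
Proof. by move=> fi gi fg; exact: le_Rintegral. Qed.

Lemma Rintegral_ge0T f : (forall x, 0 <= f x) -> 0 <= \int[m]_x f x.
Proof. by move=> f0; exact: Rintegral_ge0. Qed.

End real_integrable.

Section powR_estimates.
Context (R : realType).
Local Open Scope ring_scope.
Implicit Types r s p : R.

Lemma powR_le_mono p r s : 0 <= p -> 0 <= r -> r <= s -> r `^ p <= s `^ p.
Proof.
by move=> p0 r0 rs; apply: ge0_ler_powR; rewrite ?nnegrE// (le_trans r0).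
Qed.

Lemma normr_le_powR p r : 1 <= p -> `|r| <= 1 + `|r| `^ p.
Proof.
move=> p1; have [h|/ltW h] := leP `|r| 1.
  by apply: le_trans h _; rewrite lerDl powR_ge0.
by apply: le_trans (le1r_powR h p1) _; rewrite lerDr.
Qed.

Lemma powRD_le p r s : 0 <= p ->
  `|r + s| `^ p <= 2 `^ p * (`|r| `^ p + `|s| `^ p).
Proof.
move=> p0; pose m := Num.max `|r| `|s|.
have m0 : 0 <= m by rewrite le_max normr_ge0.
apply: (@le_trans _ _ ((2 * m) `^ p)).
  apply: powR_le_mono => //; apply: le_trans (ler_normD _ _) _.
  by rewrite mulr_natl mulr2n lerD// le_max lexx ?orbT.
rewrite powRM// ler_wpM2l ?powR_ge0// /m.
by have [_|_] := leP `|r| `|s|; [rewrite lerDr|rewrite lerDl]; exact: powR_ge0.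
Qed.

Lemma powR_pred_le p r : 1 <= p -> `|r| `^ (p - 1) <= 1 + `|r| `^ p.
Proof.
move=> p1; have [h|/ltW h] := leP `|r| 1.
  apply: (@le_trans _ _ 1); last by rewrite lerDl powR_ge0.
  by apply: le_trans (powR_le_mono _ _ h) _; rewrite ?powR1 ?subr_ge0.
apply: (@le_trans _ _ (`|r| `^ p)); last by rewrite lerDr.
by apply: ler_powR => //; rewrite gerBl.
Qed.

Lemma mul_powR_pred p r : 0 < p -> `|r| * `|r| `^ (p - 1) = `|r| `^ p.
Proof. by move=> p0; rewrite mulr_powRB1. Qed.

Lemma conj_exp_gt1 p : 1 < p -> 1 < conj_exp p.
Proof. by move=> p1; rewrite /conj_exp ltr_pdivlMr ?subr_gt0// mul1r gtrBl. Qed.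

Lemma young p r s : 1 < p -> `|r * s| <= `|r| `^ p + `|s| `^ (conj_exp p).
Proof.
move=> p1; have q1 := conj_exp_gt1 p1; rewrite normrM.
have p0 : 0 < p by exact: lt_trans p1. have q0 : 0 < conj_exp p by exact: lt_trans q1.
apply: le_trans (conjugate_powR (normr_ge0 r) (normr_ge0 s) p0 q0 _) _.
  rewrite /conj_exp invf_div -[X in X + _]mul1r -mulrDl addrC subrK divff// gt_eqF//.
by apply: lerD; rewrite ler_pdivrMr// ler_peMr ?powR_ge0// ltW.
Qed.

(** Young's inequality for [t r] and [s / t], with [t] chosen so that [t ^ p = e]. *)
Lemma young_eps p (e : R) : 1 < p -> 0 < e ->
  exists2 Ce, 0 <= Ce & forall r s,
    `|r * s| <= e * `|r| `^ p + Ce * `|s| `^ (conj_exp p).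
Proof.
move=> p1 e0; have p0 : 0 < p by exact: lt_trans p1.
pose t := e `^ p^-1; have t0 : 0 < t by exact: powR_gt0.
have tp : t `^ p = e by rewrite /t -powRrM mulVf ?gt_eqF// powRr1// ltW.
exists (t^-1 `^ (conj_exp p)); first exact: powR_ge0.
move=> r s; have := young (t * r) (t^-1 * s) p1.
have ti0 : 0 < t^-1 by rewrite invr_gt0.
rewrite mulrACA mulfV ?gt_eqF// mul1r !normrM (gtr0_norm t0) (gtr0_norm ti0).
by rewrite (powRM _ (ltW t0)) // (powRM _ (ltW ti0))// tp.
Qed.

(** The identity [(p - 1) p' = p] turns growth of order [p - 1] into growth of order [p] for the
    p'-th power. *)
Lemma growth_powR p (C r x : R) : 1 < p -> 0 <= C -> `|x| <= C * (1 + `|r| `^ (p - 1)) ->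
  `|x| `^ conj_exp p <= C `^ conj_exp p * (2 `^ conj_exp p * (1 + `|r| `^ p)).
Proof.
move=> p1 C0 xC; have q1 := conj_exp_gt1 p1.
have q0 : 0 <= conj_exp p by rewrite ltW// (lt_trans _ q1).
apply: le_trans (powR_le_mono q0 (normr_ge0 _) xC) _.
rewrite powRM ?addr_ge0 ?powR_ge0// ler_wpM2l ?powR_ge0//.
have := powRD_le 1 (`|r| `^ (p - 1)) q0.
rewrite normr1 powR1 (ger0_norm (powR_ge0 _ _)) -powRrM.
rewrite ger0_norm ?addr_ge0 ?powR_ge0//.
by rewrite /conj_exp mulrCA mulfV ?mulr1// gt_eqF// subr_gt0.
Qed.

(** This is coercivity reduced to real numbers: [D], [W], [b], [P], [J] stand for the p-th power
    integral of the gradient, the integral of [w^2] over [O], the modulus of the integral of [w]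
    over [O], the p-th power integral of [w], and the energy; [Gam] belongs to the source and [N] is
    the mass of [K]. With [t] the Poincare bound for the norm of [w], the source costs a term linear
    in [D ^ (1/p)] and [b]. The first is absorbed by [a1 D], as [p > 1], and the second by
    [kap W]. *)
Lemma coercive_bound p (a1 kap L Gam N : R) : 1 < p -> 0 < a1 -> 0 < kap ->
  0 <= L -> 0 <= Gam -> 0 <= N -> exists B M, forall D W b P J : R,
  0 <= D -> 0 <= W -> 0 <= b -> 0 <= P ->
  P `^ p^-1 <= L * (D `^ p^-1 + b) ->
  (forall e, 0 < e -> b <= e * W + N / (4 * e)) ->
  (forall t, 0 < t -> P <= t `^ p -> a1 * D + kap / 2 * W - t * (1 + Gam) <= J) ->
  B <= J /\ (J <= 1 -> P <= M /\ W <= M).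
Proof.
move=> p1 a0 k0 L0 G0 N0.
have p0 : 0 < p by exact: lt_trans p1.
have pV0 : 0 <= p^-1 by rewrite invr_ge0 ltW.
have q0 : 0 < p - 1 by rewrite subr_gt0.
pose Lam := (1 + Gam) * L.
have Lam0 : 0 <= Lam by rewrite mulr_ge0// addr_ge0.
(* Beyond [d0] one has [Lam d <= a1/2 d^p]; below it [Lam d <= Lam d0]. *)
pose d0 := (2 * Lam / a1) `^ (p - 1)^-1.
pose M0 := N * (Lam + 1) ^+ 2 / kap + Lam * d0 + (1 + Gam).
pose MD := 2 * (1 + M0) / a1; pose MW := 4 * (1 + M0) / kap.
pose MP := (L * (MD `^ p^-1 + (MW + N / 4)) + 1) `^ p.
exists (- M0), (Num.max MP MW) => D W b P J D0 W0 b0 P0 hP hb hJ.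
pose d := D `^ p^-1.
have dd0 : 0 <= d by exact: powR_ge0.
have dD : d `^ p = D by rewrite /d -powRrM mulVf ?gt_eqF// powRr1.
(* The summand 1 keeps [t] positive when the Poincare bound vanishes. *)
pose t := L * (d + b) + 1.
have t0 : 0 < t by rewrite ltr_pwDr// mulr_ge0// addr_ge0.
have Pt : P <= t `^ p.
  have -> : P = (P `^ p^-1) `^ p by rewrite -powRrM mulVf ?gt_eqF// powRr1.
  apply: powR_le_mono; [exact: ltW|exact: powR_ge0|].
  by apply: le_trans hP _; rewrite lerDl.
(* The choice [e = kap / (4 (Lam + 1))] spends half of the available [kap/2 W]; [Lam + 1] replaces
   [Lam], which may be 0. *)
have hb1 : Lam * b <= kap / 4 * W + N * (Lam + 1) ^+ 2 / kap.
  have l1 : 0 < Lam + 1 by rewrite ltr_pwDr.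
  have e0 : 0 < kap / (4 * (Lam + 1)) by rewrite divr_gt0// mulr_gt0.
  have := ler_wpM2l (ltW l1) (hb _ e0).
  have -> : (Lam + 1) * (kap / (4 * (Lam + 1)) * W + N / (4 * (kap / (4 * (Lam + 1))))) =
      kap / 4 * W + N * (Lam + 1) ^+ 2 / kap.
    by field; rewrite !gt_eqF.
  by apply: le_trans; rewrite ler_wpM2r// lerDl.
have hd : Lam * d <= a1 / 2 * D + Lam * d0.
  have [dle|/ltW dgt] := leP d d0.
    by rewrite ler_wpDl ?ler_wpM2l// mulr_ge0// divr_ge0// ltW.
  apply: ler_wpDr; first by rewrite mulr_ge0 ?powR_ge0.
  rewrite -dD -(mulr_powRB1 dd0 p0).
  have h : 2 * Lam / a1 <= d `^ (p - 1).
    have -> : 2 * Lam / a1 = d0 `^ (p - 1).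
      rewrite /d0 -powRrM mulVf ?gt_eqF// powRr1//.
      by apply: divr_ge0; [exact: mulr_ge0|exact: ltW].
    by apply: powR_le_mono; [exact: ltW|exact: powR_ge0|].
  rewrite mulrCA [leLHS]mulrC ler_wpM2l//.
  have := ler_wpM2l (ltW a0) h; rewrite mulrC divfK ?gt_eqF// => h'.
  by lra.
have hJ1 : a1 / 2 * D + kap / 4 * W - M0 <= J.
  apply: le_trans (hJ _ t0 Pt); rewrite /M0.
  have -> : t * (1 + Gam) = Lam * d + Lam * b + (1 + Gam) by rewrite /t /Lam; ring.
  by lra.
have aD : 0 <= a1 / 2 * D by rewrite mulr_ge0// divr_ge0// ltW.
have kW : 0 <= kap / 4 * W by rewrite mulr_ge0// divr_ge0// ltW.
split=> [|J1]; first by lra.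
have WM : W <= MW by rewrite /MW ler_pdivlMr//; lra.
have DM : D <= MD by rewrite /MD ler_pdivlMr//; lra.
rewrite !le_max WM orbT; split => //; apply/orP; left.
apply: le_trans Pt _; apply: powR_le_mono; [exact: ltW|exact: ltW|].
rewrite /t lerD2r ler_wpM2l// lerD//; first by apply: powR_le_mono.
have := hb 1 ltr01; rewrite mul1r mulr1 => /le_trans; apply.
by rewrite lerD2r.
Qed.

End powR_estimates.

(** * Minimisation of the energy *)

Section variational_problem.
Context d (T : measurableType d) (R : realType).
Variables (nu : {measure set T -> \bar R}) (k : R.-pker T ~> T).
Local Notation mu := (kernel_prod nu k).
Hypothesis rev : forall A : set (T * T), measurable A ->
  mu A = mu [set z | A (z.2, z.1)].
Variables (K O : set T) (G : set (T * T)).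
Hypotheses (mK : measurable K) (nuK : (nu K < +oo)%E).
Hypotheses (mO : measurable O) (OK : O `<=` K).
Hypotheses (mG : measurable G) (GK : forall z, G z -> K z.1 /\ K z.2).
Variables (p c C : R) (A : T * T -> R -> R) (Phi : T * T -> R -> R).
Local Open Scope ring_scope.
Hypotheses (p1 : 1 < p) (c0 : 0 < c) (C0 : 0 < C) (fA : flux G p c C A).
Hypothesis mPhi : forall g, measurable_fun setT g ->
  measurable_fun setT (fun z => Phi z (g z)).
Hypothesis Phi0 : forall z, Phi z 0 = 0.
Hypothesis Phi_ge0 : forall z r, 0 <= Phi z r.
Hypothesis Phi_subgradient : forall z r s, Phi z r + A z r * (s - r) <= Phi z s.
Variables (g : T -> R) (kap : R).
Hypotheses (kap0 : 0 < kap) (mg : measurable_fun setT g).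
Hypothesis g_off : forall x, ~ K x -> g x = 0.
Hypothesis ig : rintegrable nu (fun x => `|g x| `^ conj_exp p).

Let p0 : 0 < p. Proof. exact: lt_trans p1. Qed.
Let p1' : 1 <= p. Proof. exact: ltW. Qed.

Definition gradient (w : T -> R) (z : T * T) : R := w z.2 - w z.1.

Definition Lp_supported (w : T -> R) := [/\ measurable_fun setT w,
  forall x, ~ K x -> w x = 0 & rintegrable nu (fun x => `|w x| `^ p)].

(** For [p < 2] a function in L^p need not be square integrable on [O], whereas the energy contains
    its square. *)
Definition admissible (w : T -> R) :=
  Lp_supported w /\ rintegrable nu (fun x => \1_O x * w x ^+ 2).

Let Phi_le z r : Phi z r <= A z r * r.
Proof. by have := Phi_subgradient z r 0; rewrite Phi0 sub0r; lra. Qed.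

(** Coercivity is assumed for [A z r * r]. The subgradient inequality at [r / 2], evaluated at [r],
    transfers it to [Phi] at the cost of the factor [2 ^ (- p)]. *)
Let Phi_lb z r : G z -> c * 2 `^ (- p) * `|r| `^ p <= Phi z r.
Proof.
move=> Gz; have := Phi_subgradient z (r / 2) r.
have := Phi_ge0 z (r / 2); have := flux_coercive fA (r / 2) Gz.
have -> : `|r / 2| `^ p = 2 `^ (- p) * `|r| `^ p.
  rewrite normrM powRM// mulrC (ger0_norm (_ : 0 <= 2^-1))//; congr (_ * _).
  by rewrite -[in LHS]powR_inv1// -powRrM mulN1r.
by rewrite mulrA (_ : r - r / 2 = r / 2); [lra|field].
Qed.

Let Phi_off z r : ~ G z -> Phi z r = 0.
Proof.
move=> nG; apply/eqP; rewrite eq_le Phi_ge0 andbT.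
by rewrite (le_trans (Phi_le z r))// (flux_off fA)// mul0r.
Qed.

Let mgrad w : measurable_fun setT w -> measurable_fun setT (gradient w).
Proof. by move=> mw; apply: measurable_funB; exact: measurableT_comp. Qed.

Let mpow d' (S : measurableType d') (h : S -> R) (q : R) : measurable_fun setT h ->
  measurable_fun setT (fun x => `|h x| `^ q).
Proof.
move=> mh; apply: (measurableT_comp (measurable_powR _)).
exact: measurableT_comp.
Qed.

Let iK : rintegrable nu (\1_K : T -> R).
Proof. exact: rintegrable_indic. Qed.

Lemma rintegrable_fst (f : T -> R) : rintegrable nu f ->
  rintegrable mu (fun z => f z.1).
Proof. exact: (@integrable_kernel_prod_fst _ _ _ _ _ _ _ (EFin \o f)). Qed.

Lemma rintegrable_snd (f : T -> R) : rintegrable nu f ->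
  rintegrable mu (fun z => f z.2).
Proof. by move=> /rintegrable_fst; exact: integrable_kernel_prod_swap. Qed.

Lemma Rintegral_fst (f : T -> R) : rintegrable nu f ->
  \int[mu]_z f z.1 = \int[nu]_x f x.
Proof.
move=> fi; rewrite /Rintegral; congr fine.
exact: (@integral_kernel_prod_fst _ _ _ _ _ _ _ (EFin \o f)).
Qed.

Lemma Rintegral_swap (f : T * T -> R) : measurable_fun setT f ->
  \int[mu]_z f (swap_pair z) = \int[mu]_z f z.
Proof.
move=> mf; rewrite /Rintegral; congr fine.
by apply: (@integral_kernel_prod_swap _ _ _ _ _ rev (EFin \o f)); exact/measurable_EFinP.
Qed.

Lemma admissible_lincomb (u v : T -> R) (a b : R) : admissible u -> admissible v ->
  admissible (fun x => a * u x + b * v x).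
Proof.
move=> [[mu_ u0 up] u2] [[mv v0 vp] v2]; split; first split.
- by apply: measurable_funD; exact: measurable_funM.
- by move=> x nK; rewrite u0// v0// !mulr0 addr0.
- apply: (rintegrable_le (g := fun x => 2 `^ p * (`|a| `^ p * `|u x| `^ p + `|b| `^ p * `|v x| `^ p))).
  + by apply: mpow; apply: measurable_funD; exact: measurable_funM.
  + by apply: rintegrableZ; apply: rintegrableD; exact: rintegrableZ.
  + move=> x; rewrite ger0_norm ?powR_ge0// -!powRM// -!normrM.
    by apply: powRD_le; exact: ltW.
- apply: (rintegrable_le (g := fun x =>
      2 * a ^+ 2 * (\1_O x * u x ^+ 2) + 2 * b ^+ 2 * (\1_O x * v x ^+ 2))).
  + apply: measurable_funM; first exact: measurable_indic.
    by apply: measurable_funX; apply: measurable_funD; exact: measurable_funM.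
  + by apply: rintegrableD; exact: rintegrableZ.
  + move=> x; have I0 : 0 <= (\1_O x : R) by [].
    rewrite ger0_norm; last by rewrite mulr_ge0 ?sqr_ge0.
    by have := mulr_ge0 I0 (sqr_ge0 (a * u x - b * v x)); lra.
Qed.

Lemma admissible_indic (S : set T) : measurable S -> S `<=` K ->
  admissible (\1_S : T -> R).
Proof.
move=> mS SK; have iS : rintegrable nu (\1_S : T -> R).
  apply: rintegrable_indic => //; apply: le_lt_trans nuK.
  by apply: le_measure; rewrite ?inE.
have mI : measurable_fun setT (\1_S : T -> R) by exact: measurable_indic.
split; first split => //.
- by move=> x nK; rewrite indicE memNset// => /SK.
- apply: (rintegrable_le _ iS); first exact: mpow.
  move=> x; rewrite indicE; case: (_ \in _) => /=.
    by rewrite normr1 powR1 normr1.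
  by rewrite normr0 powR0 ?gt_eqF// normr0.
- apply: (rintegrable_le _ iS).
    by apply: measurable_funM => //; exact: measurable_funX.
  move=> x; rewrite !indicE; case: (_ \in _) => /=; case: (_ \in _) => /=;
    by rewrite ?expr0n ?expr1n ?mulr0 ?mul0r ?mul1r/= ?normr0 ?normr1.
Qed.

Section Lp_function.
Variable w : T -> R.
Hypothesis aw : Lp_supported w.

Let mw : measurable_fun setT w. Proof. by have [] := aw. Qed.
Let ip : rintegrable nu (fun x => `|w x| `^ p). Proof. by have [] := aw. Qed.

Lemma rintegrable_gradient :
  rintegrable mu (fun z => \1_G z * `|gradient w z| `^ p).
Proof.
apply: (rintegrable_le (g := fun z => 2 `^ p * (`|w z.2| `^ p + `|w z.1| `^ p))).
- apply: measurable_funM; first exact: measurable_indic.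
  by apply: mpow; exact: mgrad.
- by apply: rintegrableZ; apply: rintegrableD; [exact: (rintegrable_snd ip)|exact: (rintegrable_fst ip)].
- move=> z; rewrite ger0_norm ?mulr_ge0 ?powR_ge0//.
  apply: (@le_trans _ _ (`|gradient w z| `^ p)).
    by rewrite ler_piMl ?powR_ge0// indicE; case: (_ \in _).
  by rewrite -(normrN (w z.1)); apply: powRD_le; exact: ltW.
Qed.

(** The constant in the growth bound is integrable because [f] vanishes off [G], and [G] projects
    into [K], which has finite measure. *)
Lemma rintegrable_growth (f : T * T -> R) (L : R) : 0 <= L ->
  measurable_fun setT f -> (forall z, ~ G z -> f z = 0) ->
  (forall z, `|f z| <= L * (1 + `|gradient w z| `^ p)) -> rintegrable mu f.
Proof.
move=> L0 mf f0 fL.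
apply: (rintegrable_le (g := fun z => L * (\1_K z.1 + \1_G z * `|gradient w z| `^ p))) => //.
  apply: rintegrableZ; apply: rintegrableD; last exact: rintegrable_gradient.
  exact: (rintegrable_fst iK).
move=> z; have [Gz|nG] := pselect (G z).
  by apply: le_trans (fL z) _; rewrite !indicE !mem_set//; [rewrite mul1r|case: (GK Gz)].
by rewrite f0// normr0 mulr_ge0// addr_ge0// mulr_ge0// powR_ge0.
Qed.

Lemma measurable_flux_gradient : measurable_fun setT (fun z => A z (gradient w z)).
Proof.
apply: (@measurableT_comp _ _ _ _ _ _ _ _ (fun z => (z, gradient w z)) (flux_measurable fA)).
by apply: measurable_fun_pair => //; exact: mgrad.
Qed.

Lemma rintegrable_flux : rintegrable mu (fun z => A z (gradient w z)).
Proof.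
apply: (@rintegrable_growth _ (C * 2)) => //; first by rewrite mulr_ge0// ltW.
- exact: measurable_flux_gradient.
- by move=> z nG; rewrite (flux_off fA).
- move=> z; apply: le_trans (flux_growth fA _ _) _; rewrite -mulrA; apply: (ler_wpM2l (ltW C0)).
  by have := powR_pred_le (gradient w z) p1'; have := powR_ge0 `|gradient w z| p; lra.
Qed.

Lemma rintegrable_flux_conj :
  rintegrable mu (fun z => `|A z (gradient w z)| `^ conj_exp p).
Proof.
apply: (@rintegrable_growth _ (C `^ conj_exp p * 2 `^ conj_exp p)).
- by rewrite mulr_ge0 ?powR_ge0.
- by apply: mpow; exact: measurable_flux_gradient.
- move=> z nG; rewrite (flux_off fA)// normr0 powR0// gt_eqF//.
  exact: lt_trans (conj_exp_gt1 p1).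
- move=> z; rewrite ger0_norm ?powR_ge0// -mulrA; apply: growth_powR => //.
    exact: ltW.
  exact: flux_growth fA _ _.
Qed.

Lemma rintegrable_potential : rintegrable mu (fun z => Phi z (gradient w z)).
Proof.
apply: (@rintegrable_growth _ (C * 2)) => //; first by rewrite mulr_ge0// ltW.
- by apply: mPhi; exact: mgrad.
- by move=> z nG; rewrite Phi_off.
- move=> z; rewrite ger0_norm//; apply: le_trans (Phi_le _ _) _.
  apply: le_trans (ler_norm _) _; rewrite normrM.
  apply: le_trans (ler_wpM2r _ (flux_growth fA _ _)) _ => //.
  rewrite -!mulrA; apply: (ler_wpM2l (ltW C0)).
  rewrite mulrDl mul1r [X in _ + X]mulrC mul_powR_pred//.
  by have := normr_le_powR (gradient w z) p1'; have := powR_ge0 `|gradient w z| p; lra.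
Qed.

Lemma rintegrable_source : rintegrable nu (fun x => g x * w x).
Proof.
apply: (rintegrable_le (g := fun x => `|w x| `^ p + `|g x| `^ conj_exp p)).
- exact: measurable_funM.
- exact: rintegrableD.
- by move=> x; rewrite mulrC; exact: young.
Qed.

Lemma rintegrable_admissible : rintegrable nu w.
Proof.
apply: (rintegrable_le (g := fun x => \1_K x + `|w x| `^ p)) => //.
  exact: rintegrableD.
move=> x; have [Kx|nK] := pselect (K x).
  by rewrite indicE mem_set//; exact: normr_le_powR.
by have [_ -> //] := aw; rewrite normr0 addr_ge0// powR_ge0.
Qed.

End Lp_function.

(* The factor 1/2 compensates that mu counts each edge {x, y} twice. *)
Definition energy_density (w : T -> R) (z : T * T) : R :=
  2^-1 * Phi z (gradient w z) + kap / 2 * (\1_O z.1 * w z.1 ^+ 2) - g z.1 * w z.1.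

Definition energy (w : T -> R) : R := \int[mu]_z energy_density w z.

Lemma rintegrable_energy w : admissible w -> rintegrable mu (energy_density w).
Proof.
move=> aw; apply: rintegrableB; last exact: (rintegrable_fst (rintegrable_source aw.1)).
apply: rintegrableD; apply: rintegrableZ; first exact: rintegrable_potential aw.1.
exact: (rintegrable_fst aw.2).
Qed.

Let admissible0 : admissible (fun=> 0).
Proof.
have := admissible_lincomb 0 0 (admissible_indic mO OK) (admissible_indic mO OK).
by congr admissible; apply/funext => x; rewrite !mul0r addr0.
Qed.

Let energy0 : energy (fun=> 0) = 0.
Proof.
rewrite /energy -[RHS](Rintegral_set0 mu (fun=> 0)) [RHS]Rintegral_mkcond.
apply: eq_Rintegral => z _; rewrite patchE in_set0 /energy_density /gradient.
by rewrite subrr Phi0 expr0n/= !mulr0 addr0 subrr.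
Qed.

Hypothesis poinc : exists2 L, 0 <= L & forall w, admissible w ->
  (\int[nu]_x (`|w x| `^ p)) `^ p^-1 <=
  L * ((\int[mu]_z (\1_G z * `|gradient w z| `^ p)) `^ p^-1 +
       `|\int[nu]_x (\1_O x * w x)|).

Lemma energy_coercive : exists B M, forall w, admissible w ->
  B <= energy w /\ (energy w <= 1 ->
    \int[nu]_x (`|w x| `^ p) <= M /\ \int[nu]_x (\1_O x * w x ^+ 2) <= M).
Proof.
have [L L0 LP] := poinc.
pose Gam := \int[nu]_x (`|g x| `^ conj_exp p).
have Gam0 : 0 <= Gam by apply: Rintegral_ge0T => x; exact: powR_ge0.
pose N := \int[nu]_x (\1_K x : R).
have N0 : 0 <= N by exact: Rintegral_ge0T.
have a0 : 0 < 2^-1 * (c * 2 `^ (- p)) by rewrite !mulr_gt0// powR_gt0.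
have [B [M BM]] := coercive_bound p1 a0 kap0 L0 Gam0 N0.
exists B, M => w aw; have [[mw w0 ip] i2] := aw.
have iw := rintegrable_admissible aw.1.
have iOw : rintegrable nu (fun x => \1_O x * w x).
  apply: (rintegrable_le (g := fun x => `|w x|)).
  - by apply: measurable_funM => //; exact: measurable_indic.
  - by have := integrable_abse iw.
  - move=> x; rewrite normrM indicE; case: (_ \in _); first by rewrite normr1 mul1r.
    by rewrite normr0 mul0r.
apply: (BM (\int[mu]_z (\1_G z * `|gradient w z| `^ p)) _
  (`|\int[nu]_x (\1_O x * w x)|)).
- by apply: Rintegral_ge0T => z; rewrite mulr_ge0 ?powR_ge0.
- by apply: Rintegral_ge0T => x; rewrite mulr_ge0 ?sqr_ge0.
- exact: normr_ge0.
- by apply: Rintegral_ge0T => x; exact: powR_ge0.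
- exact: LP.
(* Pointwise on [O], [|w| <= e w^2 + 1/(4 e)] expands [(2 e |w| - 1)^2 >= 0]; integrating produces
   [N / (4 e)]. *)
- move=> e e0; apply: le_trans (le_normr_Rintegral measurableT iOw) _.
  rewrite -[N / _]mulrC -!RintegralZT// -RintegralDT; [|exact: rintegrableZ..].
  apply: le_RintegralT.
  + by have := integrable_abse iOw.
  + by apply: rintegrableD; exact: rintegrableZ.
  + move=> x; rewrite !indicE; case: (boolP (x \in O)) => [/set_mem/OK Kx|_].
      rewrite mem_set// mul1r mul1r mulr1.
      have e4 : 0 < 4 * e by rewrite mulr_gt0.
      rewrite -(ler_pM2r e4) [leRHS]mulrDl [X in _ <= _ + X]mulVf ?gt_eqF//.
      have := sqr_ge0 (2 * e * `|w x| - 1).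
      by rewrite -[w x ^+ 2]real_normK ?num_real//; lra.
    rewrite !mul0r normr0 mulr0 add0r mulr_ge0// invr_ge0 mulr_ge0// ltW//.
- move=> t t0 Pt.
  have iphi := rintegrable_potential aw.1.
  have igr := rintegrable_gradient aw.1.
  have ig1 := rintegrable_fst i2.
  have is1 := rintegrable_fst (rintegrable_source aw.1).
  rewrite /energy /energy_density RintegralBT//; last first.
    by apply: rintegrableD; exact: rintegrableZ.
  rewrite RintegralDT; [|exact: rintegrableZ..].
  rewrite !RintegralZT// (Rintegral_fst i2) (Rintegral_fst (rintegrable_source aw.1)).
  apply: lerB.
    rewrite lerD2r -mulrA ler_wpM2l// -RintegralZT//; apply: le_RintegralT => //.
      exact: rintegrableZ.
    move=> z; have [Gz|nG] := pselect (G z).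
      by rewrite indicE mem_set// mul1r; exact: Phi_lb.
    by rewrite indicE memNset// mul0r mulr0.
  have ht : 0 < t `^ p by exact: powR_gt0.
  (* Young's inequality for [w / t] and [g], multiplied by [t], bounds the source term by
     [t (P / t^p + Gam)], and [P <= t^p]. *)
  apply: (@le_trans _ _ (\int[nu]_x (t * ((t `^ p)^-1 * `|w x| `^ p + `|g x| `^ conj_exp p)))).
    apply: le_RintegralT; first exact: rintegrable_source aw.1.
      by apply: rintegrableZ; apply: rintegrableD => //; exact: rintegrableZ.
    move=> x; apply: le_trans (ler_norm _) _.
    have := young (t^-1 * w x) (g x) p1.
    rewrite -mulrA normrM (gtr0_norm (_ : 0 < t^-1)) ?invr_gt0// [w x * _]mulrC.
    rewrite ler_pdivrMl// => /le_trans; apply.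
    apply: (ler_wpM2l (ltW t0)); rewrite lerD2r normrM powRM//.
    rewrite (gtr0_norm (_ : 0 < t^-1)) ?invr_gt0//.
    by rewrite -(powR_inv1 (ltW t0)) -powRrM mulN1r powRN.
  rewrite RintegralZT; last by apply: rintegrableD => //; exact: rintegrableZ.
  rewrite RintegralDT//; last exact: rintegrableZ.
  rewrite RintegralZT//; apply: (ler_wpM2l (ltW t0)); rewrite lerD2r.
  by rewrite mulrC ler_pdivrMr// mul1r.
Qed.

Let mid (u v : T -> R) x := 2^-1 * u x + 2^-1 * v x.

Let energy_mid u v : admissible u -> admissible v ->
  energy (mid u v) <= Num.max (energy u) (energy v).
Proof.
move=> au av; have am := admissible_lincomb 2^-1 2^-1 au av.
have iu := rintegrable_energy au; have iv := rintegrable_energy av.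
apply: (@le_trans _ _ (2^-1 * energy u + 2^-1 * energy v)); last first.
  by rewrite le_max; have [h|/ltW h] := leP (energy u) (energy v); apply/orP; [right|left]; lra.
rewrite -!RintegralZT// -RintegralDT//; [|exact: rintegrableZ..].
apply: le_RintegralT => //; first exact: rintegrable_energy.
  by apply: rintegrableD; exact: rintegrableZ.
move=> z; rewrite /energy_density.
have h1 : Phi z (gradient (mid u v) z) <=
    2^-1 * Phi z (gradient u z) + 2^-1 * Phi z (gradient v z).
  have -> : gradient (mid u v) z = 2^-1 * gradient u z + 2^-1 * gradient v z.
    by rewrite /gradient /mid; ring.
  set r := gradient u z; set s := gradient v z.
  have := Phi_subgradient z (2^-1 * r + 2^-1 * s) r.
  by have := Phi_subgradient z (2^-1 * r + 2^-1 * s) s; lra.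
have I0 : 0 <= (\1_O z.1 : R) by [].
have h2 : \1_O z.1 * mid u v z.1 ^+ 2 <=
    2^-1 * (\1_O z.1 * u z.1 ^+ 2) + 2^-1 * (\1_O z.1 * v z.1 ^+ 2).
  by have := mulr_ge0 I0 (sqr_ge0 (u z.1 - v z.1)); rewrite /mid; lra.
have k2 : 0 <= kap / 2 by apply: divr_ge0; [exact: ltW|].
have := ler_wpM2l k2 h2.
by rewrite /mid; lra.
Qed.

Let ihyp w : admissible w -> rintegrable nu (fun x => \1_K x * hyp (w x)).
Proof.
move=> aw; have [[mw _ _] _] := aw.
apply: (rintegrable_le (g := fun x => \1_K x + `|w x|)).
- apply: measurable_funM; first exact: measurable_indic.
  by apply: measurableT_comp => //; exact: hyp_measurable.
- apply: rintegrableD => //.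
  by have := integrable_abse (rintegrable_admissible aw.1).
- move=> x; rewrite ger0_norm ?mulr_ge0 ?(ltW (hyp_gt0 _))// indicE.
  by case: (_ \in _) => /=; rewrite ?mul1r ?hyp_le// mul0r add0r.
Qed.

Let minimizing_cvg : exists (w : nat -> T -> R) (u : T -> R),
  [/\ forall n, admissible (w n), admissible u,
    forall n v, admissible v -> energy (w n) <= energy v + n.+1%:R^-1,
    \forall x \ae nu, w^~ x @ \oo --> u x &
    exists2 M, 0 <= M & forall n, \int[nu]_x (`|w n x| `^ p) <= M].
Proof.
have [B [M BM]] := energy_coercive.
(* The bound [hyp r <= 1 + |r| <= 2 + |r|^p] and the finite measure of [K] keep [F] bounded where
   the energy is. *)
pose F w := \int[nu]_x (\1_K x * hyp (w x)).
have F0 v : admissible v -> 0 <= F v.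
  by move=> _; apply: Rintegral_ge0T => x; rewrite mulr_ge0 ?(ltW (hyp_gt0 _)).
have FM v : admissible v -> energy v <= energy (fun=> 0) + 1 ->
    F v <= 2 * \int[nu]_x (\1_K x : R) + M.
  move=> av; rewrite energy0 add0r => /(BM _ av).2[vM _].
  have [[_ _ vp] _] := av.
  apply: (@le_trans _ _ (2 * \int[nu]_x (\1_K x : R) + \int[nu]_x (`|v x| `^ p))).
    rewrite -RintegralZT// -RintegralDT//; last exact: rintegrableZ.
    apply: le_RintegralT; first exact: ihyp.
      by apply: rintegrableD => //; exact: rintegrableZ.
    move=> x; rewrite indicE; case: (_ \in _) => /=; last first.
      by rewrite mul0r mulr0 add0r powR_ge0.
    by rewrite mul1r mulr1; have := hyp_le (v x); have := normr_le_powR (v x) p1'; lra.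
  by rewrite lerD2l.
have [w [aw w1 wmin wF]] := minimizing_sequence_small_defect admissible0
  (fun u v => @admissible_lincomb u v 2^-1 2^-1) energy_mid
  (fun v av => (BM v av).1) F0 FM.
have wM n : \int[nu]_x (`|w n x| `^ p) <= M /\
    \int[nu]_x (\1_O x * w n x ^+ 2) <= M.
  by apply: (BM _ (aw n)).2; have := w1 n; rewrite energy0 add0r.
(* The factor 8 undoes the 1/8 of [hyp_midpoint_defect]; off [K] both integrands vanish. *)
have defect n : (\int[nu]_x ((tanhyp (w n x) - tanhyp (w n.+1 x)) ^+ 2)%:E <=
    (8 * 4^-1 ^+ n)%:E)%E.
  have am := admissible_lincomb 2^-1 2^-1 (aw n) (aw n.+1).
  have i1 := ihyp (aw n); have i2 := ihyp (aw n.+1); have i3 := ihyp am.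
  pose D x := 8 * (2^-1 * (\1_K x * hyp (w n x)) + 2^-1 * (\1_K x * hyp (w n.+1 x))
    - \1_K x * hyp (mid (w n) (w n.+1) x)).
  have iD : rintegrable nu D.
    by apply: rintegrableZ; apply: rintegrableB => //; apply: rintegrableD; exact: rintegrableZ.
  apply: (@le_trans _ _ (\int[nu]_x (D x)%:E)%E).
    have [[mw1 w01 _] _] := aw n; have [[mw2 w02 _] _] := aw n.+1.
    apply: ge0_le_integral => //.
    - by move=> x _; rewrite lee_fin sqr_ge0.
    - apply/measurable_EFinP/measurable_funX/measurable_funB;
        by apply: measurableT_comp => //; exact: tanhyp_measurable.
    - exact/measurable_EFinP/(rintegrable_measurable iD).
    - move=> x _; rewrite lee_fin /D; have [Kx|nK] := pselect (K x).
        rewrite indicE mem_set// !mul1r.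
        have := hyp_midpoint_defect (w n x) (w n.+1 x).
        by rewrite (_ : mid _ _ x = (w n x + w n.+1 x) / 2); [lra|rewrite /mid; field].
      by rewrite w01// w02// subrr expr0n/= indicE memNset// !mul0r !mulr0 addr0 subrr mulr0.
  rewrite EFin_Rintegral// lee_fin /D RintegralZT; last first.
    by apply: rintegrableB => //; apply: rintegrableD; exact: rintegrableZ.
  rewrite RintegralBT//; last by apply: rintegrableD; exact: rintegrableZ.
  rewrite RintegralDT; [|exact: rintegrableZ..].
  by rewrite !RintegralZT//; have := wF n; rewrite /F; lra.
have wpM n : (\int[nu]_x (`|w n x| `^ p)%:E <= M%:E)%E.
  by have [[_ _ ip] _] := aw n; rewrite EFin_Rintegral// lee_fin; have [] := wM n.
have mw n : measurable_fun setT (w n) by have [[]] := aw n.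
have [u [mu_ u0 wu uM]] := ae_cvg_small_defect mK nuK p1' mw
  (fun n => let: And3 _ h _ := (aw n).1 in h) defect wpM.
exists w, u; split => //; last first.
  exists M => [|n]; last by have [] := wM n.
  by apply: le_trans (wM 0%N).1; apply: Rintegral_ge0T => x; exact: powR_ge0.
have mO1 : measurable_fun setT (\1_O : T -> R) by exact: measurable_indic.
split; first split => //.
- apply: rintegrable_ge0; [exact: mpow|by move=> x; exact: powR_ge0|].
  exact: le_lt_trans uM (ltry _).
- apply: rintegrable_ge0.
  + by apply: measurable_funM => //; exact: measurable_funX.
  + by move=> x; rewrite mulr_ge0 ?sqr_ge0.
  apply: (@le_lt_trans _ _ M%:E); last exact: ltry.
  apply: (@le_trans _ _ (\int[nu]_x limn_einf (fun n => (\1_O x * w n x ^+ 2)%:E))%E).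
    rewrite (@Defs.integral_ae_eq _ _ _ _ _ _ (fun x => limn_einf (fun n => (\1_O x * w n x ^+ 2)%:E)))//.
    apply: filterS wu => x wux _; apply/esym.
    have cv : ((\1_O x * w n x ^+ 2)%:E @[n --> \oo] --> (\1_O x * u x ^+ 2)%:E)%E.
      apply/fine_cvgP; split; first exact: nearW.
      rewrite /comp /=; apply: cvgM; first exact: cvg_cst.
      by rewrite expr2; under eq_fun do rewrite expr2; exact: cvgM.
    by rewrite is_cvg_limn_einfE; [exact: cvg_lim|apply/cvg_ex; eexists; exact: cv].
  apply: fatou_le.
  + move=> n; apply/measurable_EFinP; apply: measurable_funM => //.
    exact: measurable_funX.
  + by move=> n x; rewrite lee_fin mulr_ge0 ?sqr_ge0.
  + move=> n; have [[_ _ _] i2] := aw n.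
    by rewrite EFin_Rintegral// lee_fin; have [] := wM n.
Qed.

(** The subgradient inequalities at [r] and at [r_ n] squeeze [Phi z (r_ n)] between two quantities
    tending to [Phi z r]; the upper one needs the continuity of [A z]. *)
Let Phi_cvg z (r_ : nat -> R) r : r_ n @[n --> \oo] --> r ->
  Phi z (r_ n) @[n --> \oo] --> Phi z r.
Proof.
move=> rr.
have cA : A z (r_ n) @[n --> \oo] --> A z r.
  by apply: (@cvg_comp _ _ _ r_ (A z) _ _ _ rr); exact: flux_continuous fA z r.
have cr : r_ n - r @[n --> \oo] --> 0.
  by rewrite -(subrr r); apply: cvgB => //; exact: cvg_cst.
apply: (@squeeze_cvgr _ _ _ _ (fun n => Phi z r + A z r * (r_ n - r))
  (fun n => Phi z r + A z (r_ n) * (r_ n - r))).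
- apply: nearW => n; rewrite Phi_subgradient/=.
  by have := Phi_subgradient z (r_ n) r; lra.
- rewrite -[X in _ --> X]addr0 -[X in _ + X](mulr0 (A z r)).
  by apply: cvgD; [exact: cvg_cst|apply: cvgM => //; exact: cvg_cst].
- rewrite -[X in _ --> X]addr0 -[X in _ + X](mulr0 (A z r)).
  by apply: cvgD; [exact: cvg_cst|exact: cvgM].
Qed.

(* Adding e |w|^p + C_e |g|^p' makes the energy density nonnegative, as Fatou's
   lemma requires; then e tends to 0. *)
Lemma exists_minimizer : exists2 u, admissible u &
  forall v, admissible v -> energy u <= energy v.
Proof.
have [w [u [aw au wmin wu [M M0 wM]]]] := minimizing_cvg.
exists u => // v av.
pose Gam := \int[nu]_x (`|g x| `^ conj_exp p).
suff main (e : R) (N : nat) : 0 < e -> energy u <= energy v + N.+1%:R^-1 + e * M.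
  apply/ler_addgt0Pr => e e0.
  have e20 : 0 < e / 2 / (M + 1) by rewrite !divr_gt0// ltr_pwDr.
  have e2 : 0 < e / 2 by rewrite divr_gt0.
  have [N _ /(_ N (leqnn _)) /ltW NP] := near_infty_natSinv_lt (PosNum e2).
  have := main _ N e20.
  have : e / 2 / (M + 1) * M <= e / 2.
    by rewrite -mulrA ler_piMr ?divr_ge0 ?(ltW e0)// ler_pdivrMl ?mulr1 ?ltr_pwDr// lerDl.
  move: NP => /=; set a := N.+1%:R^-1; set b := _ / (M + 1) * M => h1 h2 h3.
  by lra.
move=> e0; have [Ce Ce0 CeP] := young_eps p1 e0.
pose F (w : T -> R) z := energy_density w z + e * `|w z.1| `^ p + Ce * `|g z.1| `^ conj_exp p.
have F0 f z : 0 <= F f z.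
  have := CeP (f z.1) (g z.1); have := ler_norm (f z.1 * g z.1).
  have := Phi_ge0 z (gradient f z).
  have : 0 <= kap / 2 * (\1_O z.1 * f z.1 ^+ 2).
    by apply: mulr_ge0; [apply: divr_ge0 => //; exact: ltW|rewrite mulr_ge0 ?sqr_ge0].
  by rewrite /F /energy_density; lra.
have iF f : admissible f -> rintegrable mu (F f) /\
    \int[mu]_z F f z = energy f + e * \int[nu]_x (`|f x| `^ p) + Ce * Gam.
  move=> af; have [[_ _ ip] _] := af.
  have i1 := rintegrable_energy af.
  have i2 := rintegrableZ e (rintegrable_fst ip).
  have i3 := rintegrableZ Ce (rintegrable_fst ig).
  have i4 := rintegrableD i1 i2.
  split; first exact: rintegrableD.
  rewrite (RintegralDT i4 i3) (RintegralDT i1 i2).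
  rewrite (RintegralZT _ (rintegrable_fst ip)) (RintegralZT _ (rintegrable_fst ig)).
  by rewrite (Rintegral_fst ip) (Rintegral_fst ig).
have [iFu iFuE] := iF _ au.
suff : \int[mu]_z F u z <= energy v + N.+1%:R^-1 + e * M + Ce * Gam.
  rewrite iFuE => h; have : 0 <= e * \int[nu]_x (`|u x| `^ p).
    by rewrite mulr_ge0 ?(ltW e0)//; apply: Rintegral_ge0T => x; exact: powR_ge0.
  by move: h; set a := N.+1%:R^-1; lra.
rewrite -lee_fin -EFin_Rintegral//.
(* Fatou is applied to the tail from index [N] on, where the slack in near-minimality is at most
   [1/(N+1)]. *)
apply: (@le_trans _ _ (\int[mu]_z limn_einf (fun n => (F (w (n + N)%N) z)%:E))%E).
  rewrite (@Defs.integral_ae_eq _ _ _ _ _ _ (fun z => limn_einf (fun n => (F (w (n + N)%N) z)%:E)))//.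
  apply: filterS2 (ae_kernel_prod_fst k wu) (ae_kernel_prod_snd rev wu) => z w1 w2 _.
  apply/esym.
  have cv : ((F (w n) z)%:E @[n --> \oo] --> (F u z)%:E)%E.
    apply/fine_cvgP; split; first exact: nearW.
    rewrite /comp /= /F /energy_density.
    apply: cvgD; last exact: cvg_cst.
    apply: cvgD; last first.
      apply: cvgM; first exact: cvg_cst.
      apply: (@cvg_comp _ _ _ (fun n => w n z.1) (fun y => `|y| `^ p) _ _ _ w1).
      exact: normr_powR_continuous.
    apply: cvgB; last by apply: cvgM => //; exact: cvg_cst.
    apply: cvgD; apply: cvgM; try exact: cvg_cst.
      by apply: Phi_cvg; exact: cvgB.
    apply: cvgM; first exact: cvg_cst.
    by rewrite expr2; under eq_fun do rewrite expr2; exact: cvgM.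
  have {}cv : ((F (w (n + N)%N) z)%:E @[n --> \oo] --> (F u z)%:E)%E.
    by rewrite (cvg_shiftn N (fun n => (F (w n) z)%:E)).
  by rewrite is_cvg_limn_einfE; [exact: cvg_lim|apply/cvg_ex; eexists; exact: cv].
apply: fatou_le => [n|n z|n].
- by apply/measurable_EFinP/rintegrable_measurable; exact: (iF _ (aw _)).1.
- by rewrite lee_fin.
- have [iFw iFwE] := iF _ (aw (n + N)%N); rewrite EFin_Rintegral// iFwE lee_fin lerD2r.
  apply: lerD; last by rewrite ler_wpM2l// ltW.
  apply: le_trans (wmin _ _ av) _; rewrite lerD2l lef_pV2 ?posrE// ler_nat ltnS.
  exact: leq_addl.
Qed.

(** * Euler-Lagrange equation of a minimiser *)

Section first_variation.
Variable u : T -> R.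
Hypothesis au : admissible u.
Hypothesis umin : forall v, admissible v -> energy u <= energy v.

Let ia := rintegrable_flux au.1.

(** The bound is uniform in [t], since [|r + t s| <= |r| + |s|]; it is the dominating function for
    the passage [t -> 0] in [variation_ge0]. *)
Let ifluxM f t : admissible f -> 0 <= t <= 1 ->
  rintegrable mu (fun z => A z (gradient u z + t * gradient f z) * gradient f z) /\
  forall z, `|A z (gradient u z + t * gradient f z) * gradient f z| <=
    C * (\1_K z.1 + \1_G z * `|gradient f z| `^ p +
      2 `^ p * (\1_G z * `|gradient u z| `^ p + \1_G z * `|gradient f z| `^ p)).
Proof.
move=> af /andP[t0 t1]; have [[mf _ _] _] := af; have [[mu_ _ _] _] := au.
have bound z : `|A z (gradient u z + t * gradient f z) * gradient f z| <=
    C * (\1_K z.1 + \1_G z * `|gradient f z| `^ p +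
      2 `^ p * (\1_G z * `|gradient u z| `^ p + \1_G z * `|gradient f z| `^ p)).
  have [Gz|nG] := pselect (G z); last first.
    have Gz0 : \1_G z = 0 :> R by rewrite indicE memNset.
    rewrite (flux_off fA)// mul0r normr0 Gz0 !mul0r !addr0 mulr0 addr0.
    by apply: mulr_ge0 => //; exact: ltW.
  rewrite normrM; apply: le_trans (ler_wpM2r _ (flux_growth fA _ _)) _ => //.
  rewrite -mulrA; apply: (ler_wpM2l (ltW C0)).
  rewrite !indicE !mem_set//; last by case: (GK Gz).
  rewrite !mul1r mulrDl mul1r; apply: lerD; first exact: normr_le_powR.
  set r := gradient u z; set s := gradient f z.
  have rs : `|r + t * s| <= `|r| + `|s|.
    apply: le_trans (ler_normD _ _) _; rewrite lerD2l normrM ger0_norm//.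
    by rewrite ler_piMl.
  apply: (@le_trans _ _ ((`|r| + `|s|) `^ (p - 1) * (`|r| + `|s|))).
    apply: ler_pM; rewrite ?powR_ge0 ?lerDr//.
    by apply: powR_le_mono => //; rewrite subr_ge0.
  rewrite mulrC mulr_powRB1 ?addr_ge0//.
  have := powRD_le `|r| `|s| (ltW p0).
  by rewrite !normr_id ger0_norm// addr_ge0.
split => //; apply: (rintegrable_le _ _ bound); last first.
  apply: rintegrableZ; apply: rintegrableD.
    by apply: rintegrableD; [exact: (rintegrable_fst iK)|exact: rintegrable_gradient af.1].
  by apply: rintegrableZ; apply: rintegrableD; [exact: rintegrable_gradient au.1|exact: rintegrable_gradient af.1].
apply: measurable_funM; last exact: mgrad.
apply: (@measurableT_comp _ _ _ _ _ _ _ _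
  (fun z => (z, gradient u z + t * gradient f z)) (flux_measurable fA)).
apply: measurable_fun_pair => //; apply: measurable_funD; first exact: mgrad.
by apply: measurable_funM => //; exact: mgrad.
Qed.

Let iOM f : admissible f -> rintegrable nu (fun x => \1_O x * (u x * f x)).
Proof.
move=> af; have [[mf _ _] f2] := af; have [[mu_ _ _] u2] := au.
apply: (rintegrable_le _ (rintegrableD u2 f2)).
  by apply: measurable_funM; [exact: measurable_indic|exact: measurable_funM].
move=> x; rewrite normrM -mulrDr (ger0_norm (_ : 0 <= \1_O x))//.
apply: ler_wpM2l => //; rewrite ler_norml.
by have := sqr_ge0 (u x + f x); have := sqr_ge0 (u x - f x); nra.
Qed.

(** The increment of [Phi] is bounded above by its subgradient at the perturbed point,
    [Phi (r + t s) - Phi r <= t A(r + t s) s]. After division by [t] only the flux has to pass to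
    the limit, by continuity and dominated convergence. *)
Let variation_ge0 f : admissible f ->
  0 <= 2^-1 * \int[mu]_z (A z (gradient u z) * gradient f z) +
    kap * \int[nu]_x (\1_O x * (u x * f x)) - \int[nu]_x (g x * f x).
Proof.
move=> af; have [[mf f0 fp] f2] := af.
pose t n : R := n.+1%:R^-1.
have t0 n : 0 < t n by rewrite invr_gt0.
have t01 n : 0 <= t n <= 1 by rewrite (ltW (t0 n)) invf_le1// ler1n.
pose a n z := A z (gradient u z + t n * gradient f z) * gradient f z.
have ian n : rintegrable mu (a n) by exact: (ifluxM af (t01 n)).1.
have tcvg : t n @[n --> \oo] --> 0 by exact: cvg_harmonic.
have acvg : \int[mu]_z a n z @[n --> \oo] -->
    \int[mu]_z (A z (gradient u z) * gradient f z).
  have z01 : 0 <= (0 : R) <= 1 by rewrite lexx ler01.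
  have i0 : rintegrable mu (fun z => A z (gradient u z) * gradient f z).
    have := (ifluxM af z01).1; congr rintegrable; apply/funext => z.
    by rewrite mul0r addr0.
  have aae : \forall z \ae mu, setT z -> ((a n z)%:E @[n --> \oo] -->
      (A z (gradient u z) * gradient f z)%:E)%E.
    apply: aeW => z _; apply/fine_cvgP; split; first exact: nearW.
    apply: cvgM; last exact: cvg_cst.
    have gcv : gradient u z + t n * gradient f z @[n --> \oo] --> gradient u z.
      rewrite -[X in _ --> X]addr0 -[X in _ + X](mul0r (gradient f z)).
      by apply: cvgD; [exact: cvg_cst|apply: cvgM => //; exact: cvg_cst].
    apply: (@cvg_comp _ _ _ _ (A z) _ _ _ gcv); exact: flux_continuous fA z _.
  have ibd : rintegrable mu (fun z => C * (\1_K z.1 + \1_G z * `|gradient f z| `^ p +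
      2 `^ p * (\1_G z * `|gradient u z| `^ p + \1_G z * `|gradient f z| `^ p))).
    apply: rintegrableZ; apply: rintegrableD.
      by apply: rintegrableD; [exact: (rintegrable_fst iK)|exact: rintegrable_gradient af.1].
    by apply: rintegrableZ; apply: rintegrableD; [exact: rintegrable_gradient au.1|exact: rintegrable_gradient af.1].
  have abd : \forall z \ae mu, forall n, setT z -> (`|(a n z)%:E| <=
      (C * (\1_K z.1 + \1_G z * `|gradient f z| `^ p + 2 `^ p *
      (\1_G z * `|gradient u z| `^ p + \1_G z * `|gradient f z| `^ p)))%:E)%E.
    by apply: aeW => z n _; rewrite lee_fin; exact: (ifluxM af (t01 n)).2.
  have [_ _] := dominated_convergence measurableT
    (fun n => measurable_int mu (ian n)) (measurable_int mu i0) aae ibd abd.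
  rewrite (EFin_Rintegral i0) (_ : (fun n => _) = (fun n => (\int[mu]_z a n z)%:E)).
    by move=> /fine_cvgP[_].
  by apply/funext => n; exact: EFin_Rintegral.
have key n : 0 <= 2^-1 * \int[mu]_z a n z + kap * \int[nu]_x (\1_O x * (u x * f x)) +
    t n * (kap / 2 * \int[nu]_x (\1_O x * f x ^+ 2)) - \int[nu]_x (g x * f x).
  have av := admissible_lincomb 1 (t n) au af.
  have i1 := rintegrable_energy au; have i2 := rintegrable_energy av.
  have j1 := rintegrable_fst (iOM af); have j2 := rintegrable_fst f2.
  have j3 := rintegrable_fst (rintegrable_source af.1).
  pose h z := 2^-1 * a n z + kap * (\1_O z.1 * (u z.1 * f z.1)) +
    t n * (kap / 2) * (\1_O z.1 * f z.1 ^+ 2) - g z.1 * f z.1.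
  have k1 : rintegrable mu (fun z => 2^-1 * a n z + kap * (\1_O z.1 * (u z.1 * f z.1))).
    by apply: rintegrableD; exact: rintegrableZ.
  have k2 : rintegrable mu (fun z => 2^-1 * a n z + kap * (\1_O z.1 * (u z.1 * f z.1)) +
    t n * (kap / 2) * (\1_O z.1 * f z.1 ^+ 2)).
    by apply: rintegrableD => //; exact: rintegrableZ.
  have ih : rintegrable mu h by exact: rintegrableB.
  have hE : \int[mu]_z h z = 2^-1 * \int[mu]_z a n z +
      kap * \int[nu]_x (\1_O x * (u x * f x)) +
      t n * (kap / 2 * \int[nu]_x (\1_O x * f x ^+ 2)) - \int[nu]_x (g x * f x).
    rewrite /h (RintegralBT k2 j3) (RintegralDT k1 (rintegrableZ _ j2)).
    rewrite (RintegralDT (rintegrableZ _ (ian n)) (rintegrableZ _ j1)).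
    rewrite (RintegralZT _ (ian n)) (RintegralZT _ j1) (RintegralZT _ j2).
    rewrite (Rintegral_fst (iOM af)) (Rintegral_fst f2) (Rintegral_fst (rintegrable_source af.1)).
    by rewrite -[t n * (kap / 2) * _]mulrA.
  rewrite -hE -(pmulr_rge0 _ (t0 n)) -(RintegralZT _ ih).
  apply: (@le_trans _ _ (energy (fun x => 1 * u x + t n * f x) - energy u)).
    by rewrite subr_ge0; exact: umin.
  rewrite /energy -(RintegralBT i2 i1); apply: le_RintegralT.
  - exact: rintegrableB.
  - exact: rintegrableZ.
  move=> z; rewrite /energy_density /h /a.
  have -> : gradient (fun x => 1 * u x + t n * f x) z = gradient u z + t n * gradient f z.
    by rewrite /gradient; ring.
  set r := gradient u z; set s := gradient f z.
  by have := Phi_subgradient z (r + t n * s) r; rewrite mul1r; set tn := t n; lra.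
have lcv : 2^-1 * \int[mu]_z a n z + kap * \int[nu]_x (\1_O x * (u x * f x)) +
    t n * (kap / 2 * \int[nu]_x (\1_O x * f x ^+ 2)) - \int[nu]_x (g x * f x)
    @[n --> \oo] --> 2^-1 * \int[mu]_z (A z (gradient u z) * gradient f z) +
    kap * \int[nu]_x (\1_O x * (u x * f x)) + 0 * (kap / 2 * \int[nu]_x (\1_O x * f x ^+ 2))
    - \int[nu]_x (g x * f x).
  apply: cvgB; last exact: cvg_cst.
  apply: cvgD; last by apply: cvgM => //; exact: cvg_cst.
  by apply: cvgD; last exact: cvg_cst; apply: cvgM => //; exact: cvg_cst.
rewrite mul0r addr0 in lcv.
by apply: (cvgr_to_ge lcv); exact: nearW.
Qed.

(** Testing with [\1_S] and with its negative gives an equality. Swapping the variables and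
    antisymmetry turn the pairing with the gradient of [\1_S] into -2 times the pairing with
    [\1_S z.1], which cancels the 1/2 of the energy. *)
Let variation_indic (S : set T) : measurable S -> S `<=` K ->
  \int[mu]_z (A z (gradient u z) * \1_S z.1) =
  kap * \int[nu]_x (\1_O x * (u x * \1_S x)) - \int[nu]_x (g x * \1_S x).
Proof.
move=> mS SK; pose f : T -> R := \1_S.
have af : admissible f := admissible_indic mS SK.
have anf : admissible (fun x => -1 * f x + 0 * f x) := admissible_lincomb (-1) 0 af af.
have mf : measurable_fun setT f by exact: measurable_indic.
have fb (x : T) : `|f x| <= 1.
  by rewrite /f indicE; case: (_ \in _); rewrite ?normr1 ?normr0.
have i1 : rintegrable mu (fun z => A z (gradient u z) * f z.1).
  by apply: (integrable_bounded_mul ia _ (fun z => fb z.1)); exact: measurableT_comp.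
have i2 : rintegrable mu (fun z => A z (gradient u z) * f z.2).
  by apply: (integrable_bounded_mul ia _ (fun z => fb z.2)); exact: measurableT_comp.
have E2 : \int[mu]_z (A z (gradient u z) * f z.2) = - \int[mu]_z (A z (gradient u z) * f z.1).
  rewrite -(Rintegral_swap (rintegrable_measurable i2)) -mulN1r -(RintegralZT _ i1).
  apply: eq_Rintegral => z _; rewrite /= [in RHS](flux_anti fA) mulN1r -mulNr opprK.
  by rewrite /gradient /= opprB.
have EL : \int[mu]_z (A z (gradient u z) * gradient f z) =
    - 2 * \int[mu]_z (A z (gradient u z) * f z.1).
  transitivity (\int[mu]_z (A z (gradient u z) * f z.2 - A z (gradient u z) * f z.1)).
    by apply: eq_Rintegral => z _; rewrite /gradient mulrBr.
  by rewrite (RintegralBT i2 i1) E2; ring.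
have iG : rintegrable mu (fun z => A z (gradient u z) * gradient f z).
  have := rintegrableB i2 i1; congr rintegrable; apply/funext => z.
  by rewrite /gradient mulrBr.
have := variation_ge0 anf; have := variation_ge0 af.
have -> : \int[mu]_z (A z (gradient u z) * gradient (fun x => -1 * f x + 0 * f x) z) =
    - 1 * \int[mu]_z (A z (gradient u z) * gradient f z).
  by rewrite -(RintegralZT _ iG); apply: eq_Rintegral => z _; rewrite /gradient; ring.
have -> : \int[nu]_x (\1_O x * (u x * (-1 * f x + 0 * f x))) =
    - 1 * \int[nu]_x (\1_O x * (u x * f x)).
  by rewrite -(RintegralZT _ (iOM af)); apply: eq_Rintegral => z _; ring.
have -> : \int[nu]_x (g x * (-1 * f x + 0 * f x)) = - 1 * \int[nu]_x (g x * f x).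
  by rewrite -(RintegralZT _ (rintegrable_source af.1)); apply: eq_Rintegral => z _; ring.
by rewrite EL -/f; lra.
Qed.

(** Two functions with equal integrals over every measurable [E] agree almost everywhere. The test
    set is [E] cut down to [K], so that its indicator is admissible; off [K] both sides are 0. *)
Lemma minimizer_equation : \forall x \ae nu,
  (\int[k x]_y (A (x, y) (u y - u x))%:E)%E = (kap * (\1_O x * u x) - g x)%:E.
Proof.
have [iFl _] := integrable_kernel_prod ia.
have [[mu_ u0 _] _] := au.
have A0 x y : ~ K x -> A (x, y) (u y - u x) = 0.
  by move=> nK; apply: (flux_off fA) => /GK[].
have mh : measurable_fun setT (fun x => (kap * (\1_O x * u x) - g x)%:E).
  apply/measurable_EFinP; apply: measurable_funB => //; apply: measurable_funM => //.
  by apply: measurable_funM => //; exact: measurable_indic.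
suff : forall E, E `<=` setT -> measurable E ->
    (\int[nu]_(x in E) \int[k x]_y (A (x, y) (gradient u (x, y)))%:E =
    \int[nu]_(x in E) (kap * (\1_O x * u x) - g x)%:E)%E.
  move=> /(lebesgue_integrable.integral_ae_eq measurableT iFl mh).
  by apply: filterS => x /(_ I).
move=> E _ mE; pose S := E `&` K.
have mS : measurable S by exact: measurableI.
have SK : S `<=` K by move=> x [].
have af := admissible_indic mS SK.
have fb (x : T) : `|\1_S x : R| <= 1.
  by rewrite indicE; case: (_ \in _); rewrite ?normr1 ?normr0.
have i1 : rintegrable mu (fun z => A z (gradient u z) * \1_S z.1).
  apply: (integrable_bounded_mul ia _ (fun z => fb z.1)).
  by apply: measurableT_comp => //; exact: measurable_indic.
have j1 := rintegrableZ kap (iOM af); have j2 := rintegrable_source af.1.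
have eqS : (\int[nu]_x \int[k x]_y (A (x, y) (gradient u (x, y)) * \1_S x)%:E =
    \int[nu]_x (kap * (\1_O x * (u x * \1_S x)) - g x * \1_S x)%:E)%E.
  rewrite (EFin_Rintegral (rintegrableB j1 j2)) (RintegralBT j1 j2).
  rewrite (RintegralZT _ (iOM af)) -(variation_indic mS SK) -(EFin_Rintegral i1).
  by rewrite (integrable_kernel_prod i1).2.
rewrite integral_mkcond [RHS]integral_mkcond.
transitivity (\int[nu]_x \int[k x]_y (A (x, y) (gradient u (x, y)) * \1_S x)%:E)%E.
  apply: eq_integral => x _; rewrite patchE indicE.
  have [Kx|nKx] := pselect (K x); last first.
    rewrite [in RHS]integral0_eq => [|y _]; last by rewrite A0// mul0r.
    by case: ifPn => // _; apply: integral0_eq => y _; rewrite A0.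
  rewrite in_setI (mem_set Kx) andbT; case: ifPn => _ /=.
    by apply: eq_integral => y _; rewrite mulr1.
  by rewrite integral0_eq// => y _; rewrite mulr0.
rewrite eqS; apply: eq_integral => x _; rewrite patchE [\1_S x]indicE.
have [Kx|nKx] := pselect (K x); last first.
  have Ox0 : \1_O x = 0 :> R by rewrite indicE memNset// => /OK.
  by rewrite Ox0 g_off// !mul0r mulr0 subrr; case: ifPn.
rewrite in_setI (mem_set Kx) andbT; case: ifPn => _ /=.
  by rewrite !mulr1.
by rewrite !mulr0 subrr.
Qed.

End first_variation.

End variational_problem.

(** * From the energy to the operator *)

Section Lp_versions.
Context d (T : measurableType d) (R : realType) (mu : {measure set T -> \bar R}).
Local Open Scope ring_scope.

(** The version vanishes at every point off the measurable set [D0], which is the exact support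
    condition used in the variational problem. *)
Lemma Lp_on_version (D D0 : set T) (p : R) (f : T -> R) : 0 < p ->
  measurable D0 -> (\forall x \ae mu, D x <-> D0 x) ->
  Lp_on mu D p f <-> exists g : T -> R, [/\ measurable_fun setT g,
    forall x, ~ D0 x -> g x = 0, \forall x \ae mu, (f \_ D) x = g x &
    rintegrable mu (fun x => `|g x| `^ p)].
Proof.
move=> p0 mD0 DD0.
have cD : completed_algebra_gen mu D by apply/completed_algebra_genP; exists D0.
rewrite (Lp_onP f p0 cD); split=> [[g [mg fg gp]]|[g [mg g0 fg gp]]]; last first.
  by exists g; split => //; rewrite EFin_Rintegral ?ltry.
pose h x := \1_D0 x * g x.
have mh : measurable_fun setT h by apply: measurable_funM => //; exact: measurable_indic.
exists h; split => //.
- by move=> x nD; rewrite /h indicE memNset// mul0r.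
- apply: filterS2 DD0 fg => x Dx fgx; have [D0x|nD0] := pselect (D0 x).
    by rewrite /h indicE mem_set// mul1r.
  by rewrite /h indicE memNset// mul0r patchE memNset// => /Dx.
- have ig : rintegrable mu (fun x => `|g x| `^ p).
    apply: rintegrable_ge0 => //.
    apply: (measurableT_comp (measurable_powR _)); exact: measurableT_comp.
  apply: (rintegrable_le _ ig).
    apply: (measurableT_comp (measurable_powR _)); exact: measurableT_comp.
  move=> x; rewrite ger0_norm ?powR_ge0// /h indicE; case: (_ \in _) => /=.
    by rewrite mul1r.
  by rewrite mul0r normr0 powR0 ?powR_ge0// gt_eqF.
Qed.

Lemma rintegrable_powR_norm (D0 : set T) (q : R) (g : T -> R) : measurable D0 ->
  (mu D0 < +oo)%E -> 1 <= q -> measurable_fun setT g ->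
  (forall x, ~ D0 x -> g x = 0) -> rintegrable mu (fun x => `|g x| `^ q) ->
  rintegrable mu g.
Proof.
move=> mD0 D0y q1 mg g0 gq.
apply: (rintegrable_le mg (rintegrableD (rintegrable_indic mD0 D0y) gq)) => x.
have [Dx|nD] := pselect (D0 x).
  by rewrite indicE mem_set//; exact: normr_le_powR.
by rewrite g0// normr0 addr_ge0// powR_ge0.
Qed.

Lemma Lp_on_L1 (D D0 : set T) (q : R) (f : T -> R) : 1 <= q ->
  measurable D0 -> (\forall x \ae mu, D x <-> D0 x) -> (mu D0 < +oo)%E ->
  Lp_on mu D q f -> Lp_on mu D 1 f.
Proof.
move=> q1 mD0 DD0 D0y; have q0 : 0 < q by exact: lt_le_trans q1.
move=> /(Lp_on_version _ q0 mD0 DD0)[g [mg g0 fg gq]].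
apply/(Lp_on_version _ ltr01 mD0 DD0); exists g; split => //.
have := integrable_abse (rintegrable_powR_norm mD0 D0y q1 mg g0 gq).
by congr (integrable _ _); apply/funext => x /=; rewrite powRr1.
Qed.

Lemma rintegrable_lincomb_powR (q : R) (f g : T -> R) (b c : R) : 0 < q ->
  measurable_fun setT f -> measurable_fun setT g ->
  rintegrable mu (fun x => `|f x| `^ q) -> rintegrable mu (fun x => `|g x| `^ q) ->
  rintegrable mu (fun x => `|b * f x + c * g x| `^ q).
Proof.
move=> q0 mf mg fq gq.
apply: (rintegrable_le (g := fun x => 2 `^ q * (`|b| `^ q * `|f x| `^ q + `|c| `^ q * `|g x| `^ q))).
- apply: (measurableT_comp (measurable_powR _)); apply: measurableT_comp => //.
  by apply: measurable_funD; exact: measurable_funM.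
- by apply: rintegrableZ; apply: rintegrableD; exact: rintegrableZ.
- move=> x; rewrite ger0_norm ?powR_ge0// -!powRM// -!normrM.
  by apply: powRD_le; exact: ltW.
Qed.

(** Jensen's inequality for a probability measure, obtained from Holder's inequality against the
    constant 1. *)
Lemma integral_norm_powR_le (q : R) (f : T -> R) : mu setT = 1%E -> 1 < q ->
  measurable_fun setT f ->
  ((\int[mu]_x `|(f x)%:E|) `^ q <= \int[mu]_x (`|f x| `^ q)%:E)%E.
Proof.
move=> mu1 q1 mf; have q0 : 0 < q by exact: lt_trans q1.
have r0 : 0 < conj_exp q by exact: lt_trans (conj_exp_gt1 q1).
have qr : q^-1 + (conj_exp q)^-1 = 1.
  by rewrite /conj_exp invf_div -[X in X + _]mul1r -mulrDl addrC subrK divff// gt_eqF.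
have := hoelder mu mf (measurable_cst (1 : R)) q0 r0 qr.
rewrite Lnorm_cst1 mu1 poweR1r mule1 Lnorm1 => h.
have -> : (\int[mu]_x (`|f x| `^ q)%:E = 'N[mu]_q%:E[EFin \o f] `^ q)%E.
  by rewrite poweR_Lnorm ?gt_eqF.
apply: gt0_ler_poweR; rewrite ?in_itv/= ?leey ?andbT ?integral_ge0 ?Lnorm_ge0//.
  exact: ltW.
apply: le_trans h; rewrite le_eqVlt; apply/orP; left; apply/eqP.
by apply: eq_integral => x _; rewrite /= mulr1.
Qed.

End Lp_versions.

Section flux_versions.
Context d (T : measurableType d) (R : realType).
Variables (nu : {measure set T -> \bar R}) (k : R.-pker T ~> T).
Local Notation mu := (kernel_prod nu k).
Hypothesis rev : forall A : set (T * T), measurable A ->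
  mu A = mu [set z | A (z.2, z.1)].
Local Open Scope ring_scope.
Variables (K D : set T) (G : set (T * T)).
Variables (p c C : R) (A : T * T -> R -> R) (a : T -> T -> R -> R).
Hypothesis GK : forall z, G z -> K z.1 /\ K z.2.
Hypothesis KG : \forall z \ae mu, K z.1 /\ K z.2 -> G z.
Hypothesis Aa : forall z r, G z -> A z r = a z.1 z.2 r.
Hypothesis fA : flux G p c C A.
Hypothesis DK : \forall x \ae nu, D x <-> K x.

(** Null sets of [nu] are discarded in both variables, by reversibility in the second. On the
    remaining pairs [D * D] and [G] agree up to a null set, and both fluxes are 0 outside. *)
Lemma flux_version (u v : T -> R) : (\forall x \ae nu, (u \_ D) x = v x) ->
  \forall z \ae mu, ((fun z => a z.1 z.2 (u z.2 - u z.1)) \_ (D `*` D)) z =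
    A z (v z.2 - v z.1).
Proof.
move=> uv.
have h : \forall x \ae nu, (D x <-> K x) /\ (u \_ D) x = v x by exact: filterS2 DK uv.
apply: filterS3 KG (ae_kernel_prod_fst k h) (ae_kernel_prod_snd rev h) => z KGz.
rewrite !patchE => -[DK1 uv1] [DK2 uv2].
have [[D1 D2]|nD] := pselect (D z.1 /\ D z.2).
  rewrite mem_set//; move: uv1 uv2; rewrite !mem_set// => <- <-.
  by rewrite Aa//; apply: KGz; tauto.
by rewrite memNset// (flux_off fA)// => /GK; tauto.
Qed.

Lemma flux_integral_version (u v : T -> R) : (\forall x \ae nu, (u \_ D) x = v x) ->
  \forall x \ae nu, D x -> (\int[k x]_(y in D) (a x y (u y - u x))%:E =
    \int[k x]_y (A (x, y) (v y - v x))%:E)%E.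
Proof.
move=> /flux_version/kernel_prod_ae; apply: filterS => x ux Dx.
rewrite integral_mkcond; apply: Defs.integral_ae_eq; apply: filterS ux => y + _.
rewrite !patchE in_setX/= (mem_set Dx)/= => <-.
by case: ifPn.
Qed.

End flux_versions.

Section flux_operator.
Context d (T : measurableType d) (R : realType).
Variables (nu : {measure set T -> \bar R}) (k : R.-pker T ~> T).
Local Notation mu := (kernel_prod nu k).
Hypothesis rev : forall A : set (T * T), measurable A ->
  mu A = mu [set z | A (z.2, z.1)].
Local Open Scope ring_scope.
Variables (K O : set T) (G : set (T * T)).
Hypotheses (mK : measurable K) (nuK : (nu K < +oo)%E).
Hypotheses (mO : measurable O) (OK : O `<=` K).
Hypotheses (mG : measurable G) (GK : forall z, G z -> K z.1 /\ K z.2).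
Variables (p c C : R) (A : T * T -> R -> R).
Hypotheses (p1 : 1 < p) (c0 : 0 < c) (C0 : 0 < C) (fA : flux G p c C A).

Let p0 : 0 < p. Proof. exact: lt_trans p1. Qed.

Let flux_sign z r : 0 <= A z r * r.
Proof.
have [Gz|nG] := pselect (G z); last by rewrite (flux_off fA)// mul0r.
apply: le_trans (flux_coercive fA r Gz).
by rewrite mulr_ge0 ?powR_ge0// ltW.
Qed.

(** [A z r] never has the sign opposite to [r], so by continuity its limits along [-1/(n+1)] and
    [1/(n+1)] force the value 0. *)
Let flux0 z : A z 0 = 0.
Proof.
have cv (s : R) : A z (s * n.+1%:R^-1) @[n --> \oo] --> A z 0.
  have scv : s * n.+1%:R^-1 @[n --> \oo] --> 0.
    by rewrite -(mulr0 s); apply: cvgM; [exact: cvg_cst|exact: cvg_harmonic].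
  by apply: (@cvg_comp _ _ _ _ (A z) _ _ _ scv); exact: flux_continuous fA z 0.
apply/eqP; rewrite eq_le; apply/andP; split.
  apply: (cvgr_to_le (cv (-1))); apply: nearW => n /=.
  have x0 : -1 * n.+1%:R^-1 < 0 :> R by rewrite mulN1r oppr_lt0 invr_gt0 ltr0n.
  by have := flux_sign z (-1 * n.+1%:R^-1); rewrite (nmulr_lge0 _ x0).
apply: (cvgr_to_ge (cv 1)); apply: nearW => n /=.
have x0 : 0 < 1 * n.+1%:R^-1 :> R by rewrite mul1r invr_gt0 ltr0n.
by have := flux_sign z (1 * n.+1%:R^-1); rewrite (pmulr_lge0 _ x0).
Qed.

Lemma flux_equation_solution (g : T -> R) (kap : R) : 0 < kap ->
  measurable_fun setT g -> (forall x, ~ K x -> g x = 0) ->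
  rintegrable nu (fun x => `|g x| `^ conj_exp p) ->
  (exists2 L, 0 <= L & forall w, admissible nu K O p w ->
    (\int[nu]_x (`|w x| `^ p)) `^ p^-1 <=
    L * ((\int[mu]_z (\1_G z * `|gradient w z| `^ p)) `^ p^-1 +
       `|\int[nu]_x (\1_O x * w x)|)) ->
  exists2 u, admissible nu K O p u & \forall x \ae nu,
    (\int[k x]_y (A (x, y) (u y - u x))%:E)%E = (kap * (\1_O x * u x) - g x)%:E.
Proof.
move=> kap0 mg g0 ig poinc.
have [Phi [mPhi Phi0 Phi_ge0 Phi_sub]] :=
  exists_potential (flux_measurable fA) (flux_mono fA) flux0.
have [u au umin] := exists_minimizer rev mK nuK mO OK mG GK p1 c0 C0 fA mPhi Phi0
  Phi_ge0 Phi_sub kap0 mg ig poinc.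
exists u => //.
exact: (minimizer_equation rev mK nuK mO OK mG GK p1 C0 fA mPhi Phi0 Phi_ge0 Phi_sub
  mg g0 ig au umin).
Qed.

(** The difference of the two fluxes is paired with [q (u1 - u2)] over the whole space. On [O] its
    average is [- (z1 - z2)], on [K] minus [O] it cancels because both functions have the same
    boundary flux, and off [K] it vanishes; [monotone_flux_le0] then gives the sign required by
    [integral_J0_le]. *)
Lemma flux_accretive (u1 u2 z1 z2 : T -> R) (lam : R) (j : R -> \bar R) :
  Lp_supported nu K p u1 -> Lp_supported nu K p u2 ->
  rintegrable nu z1 -> rintegrable nu z2 ->
  (\forall x \ae nu, O x -> (z1 x)%:E = - \int[k x]_y (A (x, y) (u1 y - u1 x))%:E)%E ->
  (\forall x \ae nu, O x -> (z2 x)%:E = - \int[k x]_y (A (x, y) (u2 y - u2 x))%:E)%E ->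
  (\forall x \ae nu, K x -> ~ O x -> \int[k x]_y (A (x, y) (u1 y - u1 x))%:E =
    \int[k x]_y (A (x, y) (u2 y - u2 x))%:E)%E ->
  0 < lam -> J0 j ->
  (\int[nu]_(x in O) j (u1 x - u2 x)%R <=
    \int[nu]_(x in O) j (u1 x - u2 x + lam * (z1 x - z2 x))%R)%E.
Proof.
move=> s1 s2 iz1 iz2 e1 e2 e3 lam0 jJ0.
have i1 := rintegrable_flux rev mK nuK mG GK p1 C0 fA s1.
have i2 := rintegrable_flux rev mK nuK mG GK p1 C0 fA s2.
have ib := rintegrableB i1 i2.
have [m1 u10 p1_] := s1; have [m2 u20 p2_] := s2.
have iu1 := rintegrable_powR_norm mK nuK (ltW p1) m1 u10 p1_.
have iu2 := rintegrable_powR_norm mK nuK (ltW p1) m2 u20 p2_.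
have iw := rintegrableB iu1 iu2; have iz := rintegrableB iz1 iz2.
have mw := rintegrable_measurable iw.
have iS (f : T -> R) : rintegrable nu f -> nu.-integrable O (EFin \o f).
  by move=> fi; apply: integrableS fi.
apply: integral_J0_le => //; [exact: iS iw|exact: iS iz|].
move=> q L qm qL.
have mq : measurable_fun setT q by exact: nondecreasing_measurable.
have bA : \forall z \ae mu, A (swap_pair z) (gradient u1 (swap_pair z)) -
      A (swap_pair z) (gradient u2 (swap_pair z)) =
    - (A z (gradient u1 z) - A z (gradient u2 z)).
  apply: aeW => z.
  have h w : A z (gradient w z) = - A (swap_pair z) (gradient w (swap_pair z)).
    by rewrite (flux_anti fA) /gradient /= opprB.
  by rewrite (h u1) (h u2); ring.
have bw : \forall z \ae mu, 0 <= (A z (gradient u1 z) - A z (gradient u2 z)) *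
    ((u1 z.2 - u2 z.2) - (u1 z.1 - u2 z.1)).
  apply: aeW => z; have := flux_mono fA z (gradient u1 z) (gradient u2 z).
  by rewrite (_ : gradient u1 z - gradient u2 z = (u1 z.2 - u2 z.2) - (u1 z.1 - u2 z.1))//
    /gradient; ring.
have := monotone_flux_le0 rev ib mw bA bw qm qL.
pose h x := \1_O x * (z1 x - z2 x) * q (u1 x - u2 x).
have iOz : rintegrable nu (fun x => \1_O x * (z1 x - z2 x)).
  apply: (rintegrable_le (g := fun x => `|z1 x - z2 x|)).
  - apply: measurable_funM; first exact: measurable_indic.
    exact: rintegrable_measurable iz.
  - by have := integrable_abse iz.
  - move=> x; rewrite normrM indicE; case: (_ \in _) => /=; first by rewrite normr1 mul1r.
    by rewrite normr0 mul0r.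
have ih : rintegrable nu h.
  by apply: (integrable_bounded_mul iOz _ (fun x => qL _)); exact: measurableT_comp.
have -> : (\int[nu]_x ((q (u1 x - u2 x)%R)%:E *
    \int[k x]_y (A (x, y) (gradient u1 (x, y)) - A (x, y) (gradient u2 (x, y)))%:E) =
    \int[nu]_x (-1 * h x)%:E)%E.
  apply: Defs.integral_ae_eq.
  have a1 := ae_integrable_kernel_prod i1; have a2 := ae_integrable_kernel_prod i2.
  apply: filterS2 (filterS2 _ (fun x h1 h2 => conj h1 h2) a1 a2)
    (filterS3 _ (fun x h1 h2 h3 => And3 h1 h2 h3) e1 e2 e3) => x [b1 b2] [f1 f2 f3] _.
  rewrite [X in (_ * X)%E](integralB_EFin measurableT b1 b2) /h indicE.
  have [Ox|nO] := pselect (O x).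
    rewrite mem_set// mul1r.
    have -> : (\int[k x]_y (A (x, y) (gradient u1 (x, y)))%:E = (- z1 x)%:E)%E.
      by rewrite EFinN f1// oppeK.
    have -> : (\int[k x]_y (A (x, y) (gradient u2 (x, y)))%:E = (- z2 x)%:E)%E.
      by rewrite EFinN f2// oppeK.
    by rewrite -EFinB -EFinM; congr EFin; ring.
  rewrite memNset// mul0r mul0r mulr0.
  have [Kx|nK] := pselect (K x).
    rewrite [X in (_ * (X - _))%E](f3 Kx nO) subee ?mule0//.
    exact: integrable_fin_num b2.
  rewrite !integral0_eq ?sube0 ?mule0// => y _;
    by rewrite (flux_off fA)// => /GK[].
rewrite (EFin_Rintegral (rintegrableZ _ ih)) (RintegralZT _ ih) lee_fin => h0.
have -> : (\int[nu]_(x in O) (q (u1 x - u2 x)%R * (z1 x - z2 x)%R)%:E = (\int[nu]_x h x)%:E)%E.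
  rewrite -(EFin_Rintegral ih) integral_mkcond; apply: eq_integral => x _.
  rewrite patchE /h indicE; case: (_ \in _) => /=; first by rewrite mul1r mulrC.
  by rewrite !mul0r.
by rewrite lee_fin; lra.
Qed.

End flux_operator.

(** * Borel versions of the domain and its boundary *)

Section outer_measure_ae.
Context d (T : measurableType d) (R : realType) (mu : {measure set T -> \bar R}).

(** Off a null set [N] the two sets agree, so [A] lies between [B] minus [N] and [B] united with
    [N], both of measure [mu B]. *)
Lemma mu_ext_ae_eq (A B : set T) : measurable B -> (\forall x \ae mu, A x <-> B x) ->
  (mu^*)%mu A = mu B.
Proof.
move=> mB /ae_measurable_cover[N [mN N0 AB]].
have mBN : measurable (B `\` N) by exact: measurableD.
have mBUN : measurable (B `|` N) by exact: measurableU.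
apply/eqP; rewrite eq_le; apply/andP; split.
  apply: (@le_trans _ _ (mu^*%mu (B `|` N))).
    apply: le_mu_ext => x Ax; have [Nx|nN] := pselect (N x); first by right.
    by left; exact/(AB _ nN).
  rewrite measurable_mu_extE//; apply: le_trans (measureU2 _ mB mN) _.
  by rewrite [X in _ + X]N0 adde0.
apply: (@le_trans _ _ (mu^*%mu (B `\` N))); last first.
  by apply: le_mu_ext => x [Bx nN]; exact/(AB _ nN).
rewrite measurable_mu_extE//; apply: (@le_trans _ _ (mu ((B `\` N) `|` N))).
  apply: le_measure; rewrite ?inE//; first exact: measurableU.
  by move=> x Bx; have [Nx|nN] := pselect (N x); [right|left].
by apply: le_trans (measureU2 _ mBN mN) _; rewrite [X in _ + X]N0 adde0.
Qed.

End outer_measure_ae.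

Section borel_versions.
Context (R : realType) (X : completeMetricType R).
Variables (m : R.-pker borel X ~> borel X) (nu : {measure set (borel X) -> \bar R}).
Hypothesis hac : forall x : borel X, m x `<< nu.
Variable Om : set (borel X).
Hypothesis hOm : completed_algebra_gen nu Om.
Hypothesis hfin : nu^*%mu (m_closure m Om) < +oo.

(** Absolute continuity carries the a.e. equality of [Om] with a Borel set [U] from [nu] to every
    [m x]. The outer measure of [Om] under [m x] is thus [m x U] for every [x], which is measurable
    in [x] and yields a Borel version of the boundary. *)
Lemma borel_domain_versions : exists O K : set (borel X),
  [/\ measurable O, measurable K, O `<=` K, nu K < +oo &
    [/\ \forall x \ae nu, Om x <-> O x,
        \forall x \ae nu, m_closure m Om x <-> K x &
        \forall x \ae nu, m_boundary m Om x <-> K x /\ ~ O x]].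
Proof.
have [U mU OmU] := (completed_algebra_genP nu Om).1 hOm.
have mOmU x : ((m x)^*)%mu Om = m x U.
  apply: mu_ext_ae_eq => //.
  have [N [mN N0 NP]] := ae_measurable_cover OmU.
  exists N; split => //.
    by have /null_content_dominatesP := hac x; apply.
  by move=> y nP; apply: contrapT => /NP.
pose K : set (borel X) := U `|` [set x | 0 < m x U].
have mK : measurable K.
  apply: measurableU => //.
  have mfk : measurable_fun setT (m^~ U) by exact: measurable_kernel.
  rewrite -[X in measurable X]setTI.
  rewrite (_ : [set x | _] = (m^~ U) @^-1` `]0, +oo]%classic); first by apply: mfk => //; exact: emeasurable_itv.
  by apply/seteqP; split => x /=; rewrite in_itv/= leey andbT.
have bd : \forall x \ae nu, m_boundary m Om x <-> K x /\ ~ U x.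
  apply: filterS OmU => x Ux; rewrite /m_boundary /K /setU /= mOmU; tauto.
have cl : \forall x \ae nu, m_closure m Om x <-> K x.
  apply: filterS OmU => x Ux; rewrite /m_closure /m_boundary /K /setU /= mOmU.
  by have := EM (U x); tauto.
exists U, K; split => //; first by move=> x; left.
by rewrite -(mu_ext_ae_eq mK cl).
Qed.

End borel_versions.

Section ae_versions.
Context d (T : measurableType d) (R : realType) (mu : {measure set T -> \bar R}).
Local Open Scope ring_scope.

Lemma aeI (P Q : T -> Prop) : (\forall x \ae mu, P x) ->
  (\forall x \ae mu, Q x) -> \forall x \ae mu, P x /\ Q x.
Proof. exact: filterI. Qed.

Lemma integral_ae_version (D D0 : set T) (f g : T -> \bar R) :
  (\forall x \ae mu, D x <-> D0 x) -> (\forall x \ae mu, D0 x -> f x = g x) ->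
  (\int[mu]_(x in D) f x = \int[mu]_(x in D0) g x)%E.
Proof.
move=> DD0 fg; rewrite integral_mkcond [RHS]integral_mkcond.
apply: Defs.integral_ae_eq; apply: filterS2 DD0 fg => x Dx fgx _; rewrite !patchE.
have [D0x|nD] := pselect (D0 x).
  by rewrite mem_set ?(mem_set D0x) ?fgx//; tauto.
by rewrite memNset ?(memNset nD)//; tauto.
Qed.

Lemma Lnorm_ae_version (p : R) (F g : T -> R) : 0 < p ->
  (\forall x \ae mu, F x = g x) -> rintegrable mu (fun x => `|g x| `^ p) ->
  ('N[mu]_p%:E[EFin \o F] = ((\int[mu]_x (`|g x| `^ p)) `^ p^-1)%:E)%E.
Proof.
move=> p0 Fg gp; rewrite unlock /=.
rewrite -poweR_EFin -(EFin_Rintegral gp); congr (_ `^ _)%E.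
by apply: Defs.integral_ae_eq; apply: filterS Fg => x -> _.
Qed.

Lemma patch_ae_version (D D0 : set T) (g : T -> R) :
  (\forall x \ae mu, D x <-> D0 x) -> (forall x, ~ D0 x -> g x = 0) ->
  \forall x \ae mu, (g \_ D) x = g x.
Proof.
move=> DD0 g0; apply: filterS DD0 => x Dx; rewrite patchE.
case: ifPn => // /negP nD; rewrite g0// => D0x; apply: nD; apply/mem_set; tauto.
Qed.

End ae_versions.

Section kernel_average.
Context d d' (T : measurableType d) (T' : measurableType d') (R : realType).
Variables (nu : {measure set T -> \bar R}) (k : R.-pker T ~> T').
Local Open Scope ring_scope.

(** Jensen's inequality under each [k x], followed by Tonelli: averaging in the second variable
    preserves q-th power integrability. *)
Lemma rintegrable_powR_kernel_average (q : R) (F : T * T' -> R) (v : T -> R) :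
  1 < q -> measurable_fun setT F -> measurable_fun setT v ->
  rintegrable (kernel_prod nu k) (fun z => `|F z| `^ q) ->
  (\forall x \ae nu, (`|v x|%:E <= \int[k x]_y `|(F (x, y))%:E|)%E) ->
  rintegrable nu (fun x => `|v x| `^ q).
Proof.
move=> q1 mF mv Fq vF; have q0 : 0 < q by exact: lt_trans q1.
have mFq : measurable_fun setT (fun z => (`|F z| `^ q)%:E).
  apply/measurable_EFinP.
  by apply: (measurableT_comp (measurable_powR _)); exact: measurableT_comp.
have mvq : measurable_fun setT (fun x => `|v x| `^ q).
  by apply: (measurableT_comp (measurable_powR _)); exact: measurableT_comp.
apply: rintegrable_ge0 => //.
apply: (@le_lt_trans _ _ (\int[kernel_prod nu k]_z (`|F z| `^ q)%:E)%E); last first.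
  have /integrableP[_] := Fq.
  by under eq_integral do rewrite /= ger0_norm ?powR_ge0//.
have Fq0 z : (0 <= (`|F z| `^ q)%:E)%E by rewrite lee_fin powR_ge0.
rewrite (ge0_integral_kernel_prod _ _ Fq0 mFq).
apply: ae_ge0_le_integral => //.
- exact/measurable_EFinP.
- by move=> x _; exact: integral_ge0.
- exact: (measurable_fun_integral_finite_kernel (fun z => (`|F z| `^ q)%:E) k).
apply: filterS vF => x vFx _.
apply: le_trans (integral_norm_powR_le (f := fun y => F (x, y)) _ q1 _).
- rewrite -poweR_EFin; apply: gt0_ler_poweR => //.
  + exact: ltW.
  + by rewrite in_itv/= leey andbT lee_fin.
  + by rewrite in_itv/= leey andbT integral_ge0.
- exact: prob_kernel.
- exact: measurable_fun_pair2.
Qed.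

End kernel_average.

(** * Complete accretivity and the range condition *)

Section main.
Context (R : realType) (X : completeMetricType R).
Variables (m : R.-pker borel X ~> borel X) (nu : {measure set (borel X) -> \bar R}).
Hypothesis hrev : reversible_measure m nu.
Hypothesis hac : forall x : borel X, m x `<< nu.
Variable Om : set (borel X).
Hypothesis hOm : completed_algebra_gen nu Om.
Hypothesis hfin : nu^*%mu (m_closure m Om) < +oo.
Variables (p : R) (a : X -> X -> R -> R) (phi : borel X -> R).
Hypothesis hp : (1 < p)%R.
Hypothesis ha : leray_lions m nu p a.
Local Notation mu := (kernel_prod nu m).
Local Notation B := (B_op m Om nu p a phi).
Local Notation E := (Lp_on nu Om (conj_exp p)).
Local Open Scope ring_scope.

Let p0 : 0 < p. Proof. exact: lt_trans hp. Qed.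
Let q1 : 1 < conj_exp p. Proof. exact: conj_exp_gt1. Qed.
Let q0 : 0 < conj_exp p. Proof. exact: lt_trans q1. Qed.

Lemma flux_setting : exists (U K : set (borel X)) (G : set (borel X * borel X))
    (A : borel X * borel X -> R -> R) (c C : R),
  [/\ [/\ measurable U, measurable K, U `<=` K & (nu K < +oo)%E],
    [/\ \forall x \ae nu, Om x <-> U x,
        \forall x \ae nu, m_closure m Om x <-> K x &
        \forall x \ae nu, m_boundary m Om x <-> K x /\ ~ U x],
    [/\ measurable G, (forall z, G z -> K z.1 /\ K z.2),
        \forall z \ae mu, K z.1 /\ K z.2 -> G z &
        forall z r, G z -> A z r = a z.1 z.2 r],
    0 < c /\ 0 < C & flux G p c C A].
Proof.
have [U [K [mU mK UK Ky [e1 e2 e3]]]] := borel_domain_versions hac hOm hfin.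
have [h1 h2 h3 h4 [c [C [c0 C0 h5 h6]]]] := ha.
have mQ : measurable (K `*` K) by exact: measurableX.
have Qs (z : borel X * borel X) : (K `*` K) z -> (K `*` K) (swap_pair z).
  by move=> [].
have [G [A [mG [GQ Gs] fA QG Aa]]] := exists_flux hrev c0 C0 h1 h2 h3 h4 h5 h6 mQ Qs.
by exists U, K, G, A, c, C; split => //; split.
Qed.

Lemma B_op_completely_accretive : completely_accretive nu Om B.
Proof.
have [U [K [G [A [c [C [[mU mK UK Ky] [e1 e2 e3] [mG GK KG Aa] [c0 C0] fA]]]]]]] := flux_setting.
move=> [f1 v1] [f2 v2] [/= L1 M1 [u1 [E1 N1 _ F1 B1]]] [/= L2 M2 [u2 [E2 N2 _ F2 B2]]].
move=> lam lam0 j jJ0.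
have [w1 [mw1 w10 uw1 w1p]] := (Lp_on_version _ p0 mK e2).1 N1.
have [w2 [mw2 w20 uw2 w2p]] := (Lp_on_version _ p0 mK e2).1 N2.
have [z1 [mz1 z10 vz1 z1p]] := (Lp_on_version _ ltr01 mU e1).1 M1.
have [z2 [mz2 z20 vz2 z2p]] := (Lp_on_version _ ltr01 mU e1).1 M2.
have Uy : (nu U < +oo)%E by apply: le_lt_trans Ky; apply: le_measure; rewrite ?inE.
have iz1 := rintegrable_powR_norm mU Uy (lexx 1) mz1 z10 z1p.
have iz2 := rintegrable_powR_norm mU Uy (lexx 1) mz2 z20 z2p.
have I1 := flux_integral_version hrev GK KG Aa fA e2 uw1.
have I2 := flux_integral_version hrev GK KG Aa fA e2 uw2.
have eq1 (v u w z : borel X -> R) :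
    (\forall x \ae nu, Om x -> (v x)%:E =
      - \int[m x]_(y in m_closure m Om) (a x y (u y - u x))%:E)%E ->
    (\forall x \ae nu, (v \_ Om) x = z x) ->
    (\forall x \ae nu, m_closure m Om x ->
      \int[m x]_(y in m_closure m Om) (a x y (u y - u x))%:E =
      \int[m x]_y (A (x, y) (w y - w x))%:E)%E ->
    (\forall x \ae nu, U x -> (z x)%:E = - \int[m x]_y (A (x, y) (w y - w x))%:E)%E.
  move=> h1 h2 h3; apply: filterS2 (aeI e1 h1) (aeI h2 h3) => x [Ux h1x] [h2x h3x] U_x.
  have Ox : Om x by tauto.
  by rewrite -h2x patchE mem_set// h1x// h3x//; left.
(* Both averages equal [- phi] on the boundary, so the datum drops out of the difference. *)
have bd : (\forall x \ae nu, K x -> ~ U x -> \int[m x]_y (A (x, y) (w1 y - w1 x))%:E =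
    \int[m x]_y (A (x, y) (w2 y - w2 x))%:E)%E.
  apply: filterS2 (aeI e3 (aeI B1 B2)) (aeI I1 I2) => x [bx [b1 b2]] [i1 i2] Kx nU.
  have dx : m_boundary m Om x by tauto.
  have cx : m_closure m Om x by right.
  by apply: oppe_inj; rewrite -(i1 cx) -(i2 cx) -(b1 dx) -(b2 dx).
have ver (f u w : borel X -> R) : (u = f %[ae nu in Om]) ->
    (\forall x \ae nu, (u \_ (m_closure m Om)) x = w x) ->
    \forall x \ae nu, U x -> f x = w x /\ Om x.
  move=> uf uw; apply: filterS3 e1 uf uw => x Ux ufx <- U_x.
  have Ox : Om x by tauto.
  by rewrite patchE mem_set ?ufx//; left.
have r1 := ver _ _ _ E1 uw1; have r2 := ver _ _ _ E2 uw2.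
rewrite (integral_ae_version (g := fun x => j (w1 x - w2 x)) e1); last first.
  by apply: filterS2 r1 r2 => x h1 h2 Ux; rewrite (h1 Ux).1 (h2 Ux).1.
rewrite [leRHS](integral_ae_version (g := fun x => j (w1 x - w2 x + lam * (z1 x - z2 x))) e1); last first.
  apply: filterS2 (aeI r1 r2) (aeI vz1 vz2) => x [h1 h2] [y1 y2] Ux.
  have [f1x Ox] := h1 Ux; have [f2x _] := h2 Ux.
  by rewrite f1x f2x -y1 -y2 !patchE mem_set.
apply: (flux_accretive hrev mK Ky mU mG GK hp C0 fA) => //.
- exact: eq1 F1 vz1 I1.
- exact: eq1 F2 vz2 I2.
Qed.

Hypothesis hpoinc : poincare m Om nu p.

Let poincare_versions (U K : set (borel X)) (G : set (borel X * borel X)) :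
  measurable U -> measurable K -> (nu K < +oo)%E -> U `<=` K ->
  measurable G -> (forall z, G z -> K z.1 /\ K z.2) ->
  (\forall z \ae mu, K z.1 /\ K z.2 -> G z) ->
  (\forall x \ae nu, Om x <-> U x) ->
  (\forall x \ae nu, m_closure m Om x <-> K x) ->
  exists2 L, 0 <= L & forall w, admissible nu K U p w ->
    (\int[nu]_x (`|w x| `^ p)) `^ p^-1 <=
    L * ((\int[mu]_z (\1_G z * `|gradient w z| `^ p)) `^ p^-1 +
       `|\int[nu]_x (\1_U x * w x)|).
Proof.
move=> mU mK Ky UK mG GK KG e1 e2; have [L L0 LP] := hpoinc.
exists L => [|w [sw _]]; first exact: ltW.
have [mw w0 wp] := sw.
have wv : \forall x \ae nu, (w \_ (m_closure m Om)) x = w x.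
  exact: patch_ae_version e2 w0.
have Lw : Lp_on nu (m_closure m Om) p w.
  by apply/(Lp_on_version _ p0 mK e2); exists w.
have ig := rintegrable_gradient hrev mG hp sw.
have iw := rintegrable_powR_norm mK Ky (ltW hp) mw w0 wp.
have iUw : rintegrable nu (fun x => \1_U x * w x).
  apply: (rintegrable_le (g := fun x => `|w x|)).
  - by apply: measurable_funM => //; exact: measurable_indic.
  - by have := integrable_abse iw.
  - move=> x; rewrite normrM indicE; case: (_ \in _); first by rewrite normr1 mul1r.
    by rewrite normr0 mul0r.
have gv : \forall z \ae mu, ((fun z => w z.2 - w z.1) \_
    (m_closure m Om `*` m_closure m Om)) z = \1_G z * gradient w z.
  apply: filterS3 KG (ae_kernel_prod_fst m e2) (ae_kernel_prod_snd hrev e2) => z KGz d1 d2.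
  rewrite patchE indicE in_setX/=.
  have [[K1 K2]|nK] := pselect (K z.1 /\ K z.2).
    by rewrite !mem_set ?mul1r//; tauto.
  rewrite [z \in G]memNset ?mul0r; last by move=> /GK.
  by case: ifPn => // /andP[/set_mem h1 /set_mem h2]; exfalso; tauto.
have gp : (fun z => `|\1_G z * gradient w z| `^ p) = (fun z => \1_G z * `|gradient w z| `^ p).
  apply/funext => z; rewrite indicE; case: (_ \in _); first by rewrite !mul1r.
  by rewrite !mul0r normr0 powR0// gt_eqF.
have := LP w Lw.
rewrite (Lnorm_ae_version p0 wv wp) (Lnorm_ae_version p0 gv) ?gp//.
have -> : (\int[nu]_(x in Om) (w x)%:E = (\int[nu]_x (\1_U x * w x))%:E)%E.
  rewrite (integral_ae_version (g := EFin \o w) e1); last exact: aeW.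
  rewrite -(EFin_Rintegral iUw) integral_mkcond; apply: eq_integral => x _.
  by rewrite patchE indicE /=; case: ifPn => _; rewrite ?mul1r ?mul0r.
by rewrite -EFinD -EFinM lee_fin.
Qed.

Hypothesis hphi : Lp_on nu (m_boundary m Om) (conj_exp p) phi.

Lemma B_op_resolvent (lam : R) (f : borel X -> R) : 0 < lam -> E f ->
  resolvent_range nu Om lam (B `&` (E `*` E)) f.
Proof.
move=> lam0 Ef.
have [U [K [G [A [c [C [[mU mK UK Ky] [e1 e2 e3] [mG GK KG Aa] [c0 C0] fA]]]]]]] := flux_setting.
have mKU : measurable (K `\` U) by exact: measurableD.
have Uy : (nu U < +oo)%E by apply: le_lt_trans Ky; apply: le_measure; rewrite ?inE.
have [h [mh h0 fh hq]] := (Lp_on_version _ q0 mU e1).1 Ef.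
have [b [mb b0 phib bq]] := (Lp_on_version _ q0 mKU e3).1 hphi.
pose g x := lam^-1 * h x + 1 * b x.
have mg : measurable_fun setT g by apply: measurable_funD; exact: measurable_funM.
have g0 x : ~ K x -> g x = 0.
  by move=> nK; rewrite /g h0 ?b0 ?mulr0 ?addr0// => [[]|/UK].
have gq : rintegrable nu (fun x => `|g x| `^ conj_exp p).
  exact: rintegrable_lincomb_powR.
have lamV0 : 0 < lam^-1 by rewrite invr_gt0.
have [u [su u2] eqn] := flux_equation_solution hrev mK Ky mU UK mG GK hp c0 C0 fA
  lamV0 mg g0 gq (poincare_versions mU mK Ky UK mG GK KG e1 e2).
have [mu_ u0 up] := su.
have mUu : measurable_fun setT (fun x => \1_U x * u x).
  by apply: measurable_funM => //; exact: measurable_indic.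
pose v x := lam^-1 * h x - lam^-1 * (\1_U x * u x).
have mv : measurable_fun setT v by apply: measurable_funB; exact: measurable_funM.
have v0 x : ~ U x -> v x = 0.
  by move=> nU; rewrite /v h0// indicE memNset// mul0r !mulr0 subrr.
have eqU : \forall x \ae nu, U x ->
    ((v x)%:E = - \int[m x]_y (A (x, y) (u y - u x))%:E)%E.
  apply: filterS eqn => x -> Ux; rewrite -EFinN; congr EFin.
  by rewrite /v /g b0 => [|[]//]; ring.
have uv : \forall x \ae nu, (u \_ (m_closure m Om)) x = u x by exact: patch_ae_version e2 u0.
have Iu := flux_integral_version hrev GK KG Aa fA e2 uv.
(* On [U] the value [v x] is up to sign an average of the flux, which lies in L^p' of the
   product. *)
have vq : rintegrable nu (fun x => `|v x| `^ conj_exp p).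
  apply: (rintegrable_powR_kernel_average q1 (measurable_flux_gradient fA su) mv
    (rintegrable_flux_conj hrev mK Ky mG GK hp C0 fA su)).
  apply: filterS eqU => x eqx; have [Ux|nU] := pselect (U x); last first.
    by rewrite v0// normr0 integral_ge0.
  rewrite -abse_EFin eqx// abseN; apply: le_abse_integral => //.
  apply/measurable_EFinP.
  exact: (measurable_fun_pair2 _ (measurable_flux_gradient fA su)).
have Ev : E v.
  apply/(Lp_on_version _ q0 mU e1); exists v; split => //.
  exact: patch_ae_version e1 v0.
(* The energy controls [u] in L^p, and in L^2 on [U]; the L^p' bound on [U] comes from
   [u = f - lam v], where both terms are in L^p'. *)
have Eu : E u.
  apply/(Lp_on_version _ q0 mU e1); exists (fun x => \1_U x * u x); split => //.
  - by move=> x nU; rewrite indicE memNset// mul0r.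
  - apply: filterS e1 => x Ux; rewrite patchE indicE.
    have [U_x|nU] := pselect (U x); first by rewrite !mem_set ?mul1r//; tauto.
    by rewrite !memNset ?mul0r//; tauto.
  - have := rintegrable_lincomb_powR 1 (- lam) q0 mh mv hq vq.
    congr rintegrable; apply/funext => x; congr (`|_| `^ _).
    rewrite /v; move: (h x) (_ * u x) => r s; field; rewrite gt_eqF//.
have cl_prod : \forall z \ae mu, (m_closure m Om `*` m_closure m Om) z <-> (K `*` K) z.
  apply: filterS2 (ae_kernel_prod_fst m e2) (ae_kernel_prod_snd hrev e2) => z d1 d2.
  by split => -[? ?]; split; tauto.
exists (u, v); last first.
  apply: filterS2 e1 fh => x Ux; rewrite patchE => fx Ox /=.
  move: fx; rewrite mem_set// => ->; rewrite /v indicE mem_set; last by tauto.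
  by rewrite mul1r; move: (h x) (u x) => r s; field; rewrite gt_eqF.
split => //; split.
- exact: Lp_on_L1 (ltW q1) mU e1 Uy Eu.
- exact: Lp_on_L1 (ltW q1) mU e1 Uy Ev.
exists u; split.
- exact: aeW.
- by apply/(Lp_on_version _ p0 mK e2); exists u.
- apply/(Lp_on_version _ q0 (measurableX mK mK) cl_prod).
  exists (fun z => A z (gradient u z)); split.
  + exact (measurable_flux_gradient fA su).
  + by move=> z nK; apply: (flux_off fA) => /GK.
  + exact (flux_version hrev GK KG Aa fA e2 uv).
  + exact (rintegrable_flux_conj hrev mK Ky mG GK hp C0 fA su).
- apply: filterS3 e1 eqU Iu => x Ux eqx ix Ox.
  by rewrite ix; [apply: eqx; tauto|left].
- apply: filterS3 (aeI e3 eqn) phib Iu => x [bx eqx] fx ix dx.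
  have [Kx nU] : K x /\ ~ U x by tauto.
  rewrite ix; last by right.
  rewrite eqx -EFinN; congr EFin; move: fx; rewrite patchE mem_set// => ->.
  by rewrite /g h0// indicE memNset// mulr0 add0r !mul1r mul0r mulr0 sub0r opprK.
Qed.

Lemma B_op_m_completely_accretive : m_completely_accretive nu Om E B.
Proof.
split => [[f1 v1] [f2 v2] [B1 _] [B2 _]|lam lam0].
  exact: B_op_completely_accretive.
apply/seteqP; split => [f|f]; last exact: B_op_resolvent.
move=> [[u v] [_ [/= Eu Ev]] fuv].
have [U [K [G [A [c [C [[mU mK UK Ky] [e1 e2 e3] _ _ _]]]]]]] := flux_setting.
have [g [mg g0 ug gq]] := (Lp_on_version _ q0 mU e1).1 Eu.
have [h [mh h0 vh hq]] := (Lp_on_version _ q0 mU e1).1 Ev.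
apply/(Lp_on_version _ q0 mU e1); exists (fun x => 1 * g x + lam * h x); split.
- by apply: measurable_funD; exact: measurable_funM.
- by move=> x nU; rewrite g0// h0// !mulr0 addr0.
- apply: filterS3 ug vh fuv => x; rewrite !patchE.
  case: ifPn => [/set_mem Ox <- <- ->//|_ <- <- _]; first by rewrite mul1r.
  by rewrite !mulr0 addr0.
- exact: rintegrable_lincomb_powR.
Qed.

End main.

Theorem theorem2p7 (R : realType) (X : completeMetricType R)
    (hX : separable_space X)
    (m : R.-pker borel X ~> borel X) (hm : finite_first_moments m)
    (nu : {measure set (borel X) -> \bar R}) (hnu : radon nu)
    (hinv : invariant_measure m nu) (hrev : reversible_measure m nu)
    (hac : forall x : borel X, m x `<< nu) (hconn : m_connected m nu)
    (Om : set (borel X)) (hOm : completed_algebra_gen nu Om)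
    (hfin : nu^*%mu (m_closure m Om) < +oo)
    (p : R) (hp : (1 < p)%R) (hpoinc : poincare m Om nu p)
    (a : X -> X -> R -> R) (ha : leray_lions m nu p a)
    (phi : borel X -> R)
    (hphi : Lp_on nu (m_boundary m Om) (conj_exp p) phi) :
  let B := B_op m Om nu p a phi in
  let E := Lp_on nu Om (conj_exp p) in
  [/\ completely_accretive nu Om B,
      E `<=` resolvent_range nu Om 1 B &
      m_completely_accretive nu Om E B].
Proof.
split.
- exact: B_op_completely_accretive.
- move=> f Ef.
  have [uv [Buv _] fuv] := B_op_resolvent hrev hac hOm hfin hp ha hpoinc hphi ltr01 Ef.
  by exists uv.
- exact: B_op_m_completely_accretive.
Qed.
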